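(* Let $A_1=[0,\frac15)$, $A_2=[\frac15,\frac35)$, $A_3=[\frac35,1]$. For $\varepsilon\in(0,1)$ let $u,r\in\mathscr W$ be $$u(x,y)=\begin{cases}0&(x,y)\in A_2^2\cup(A_1\times A_3)\cup(A_3\times A_1),\\ \varepsilon&(x,y)\in A_3^2\cup(A_1\times A_2)\cup(A_2\times A_1),\\ 1&\text{otherwise},\end{cases}$$ $$r(x,y)=\begin{cases}0&(x,y)\in A_2^2\cup(A_1\times A_2)\cup(A_2\times A_1),\\ \varepsilon&(x,y)\in A_3^2\cup(A_1\times A_3)\cup(A_3\times A_1),\\ 1&\text{otherwise},\end{cases}$$ and let $\sigma\in\mathscr M$ be given by $\sigma(x)=x$ for $x\in A_1$, $\sigma(x)=x+\frac25$ for $x\in A_2$, $\sigma(x)=x-\frac25$ for $x\in A_3$. Then, for $\varepsilon>0$ sufficiently small and $T>0$ sufficiently small (given $\varepsilon$), $$\tilde H^*=\{\tilde h^*_{u\to r},\tilde h^*_{u\to r^\sigma}\}\qquad\text{and}\qquad\tilde h^*_{u\to r}\ne\tilde h^*_{u\to r^\sigma}.$$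
   Context: Rates $\lambda,\mu\in(0,\infty)$ are fixed. $\mathscr W$ is the space of measurable symmetric $h:[0,1]^2\to[0,1]$ modulo almost-everywhere equality. $\mathscr M$ is the set of measure-preserving bijections of $[0,1]$ (up to null sets), $h^\sigma(x,y)=h(\sigma(x),\sigma(y))$, $h_1\sim h_2$ iff $h_1=h_2^\sigma$ for some $\sigma\in\mathscr M$, $\tilde{\mathscr W}=\mathscr W/\!\sim$. Paths: $\mathscr W\times[0,T]$ is the set of $\mathscr W$-valued paths $h=(h_t)_{t\in[0,T]}$; $h_1\sim h_2$ iff $(h_1)_t\sim(h_2)_t$ for all $t\in[0,T]$; $\tilde{\mathscr W}\times[0,T]$ is the quotient and $\tilde h$ the class of $h$. Action: $I(h)=\int_0^Tdt\int_{[0,1]^2}dx\,dy\,\mathcal L(h_t(x,y),h'_t(x,y))$ if $t\mapsto h_t(x,y)$ is absolutely continuous for almost all $(x,y)$ (with $h'$ the time derivative) and $I(h)=\infty$ otherwise, where $\mathcal L(a,b)=\sup_{v\in\mathbb R}[vb-\lambda(e^v-1)(1-a)-\mu(e^{-v}-1)a]$. $\tilde I(\tilde h)=\inf_{h\sim\tilde h}I(h)$. $\tilde H^*$ is the set of minimisers of $\tilde I$ among paths in $\tilde{\mathscr W}\times[0,T]$ that start at $\tilde u$ at time $0$ and end at $\tilde r$ at time $T$. Candidate paths: put $p_{01,t}=\frac{\lambda-\lambda e^{-t(\lambda+\mu)}}{\lambda+\mu}$, $p_{11,t}=\frac{\lambda+\mu e^{-t(\lambda+\mu)}}{\lambda+\mu}$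 and, for $a,w\in[0,1]$, $I_{1,t}(a,w)=\sup_{v\in\mathbb R}[vw-a\log(1-p_{11,t}+e^vp_{11,t})-(1-a)\log(1-p_{01,t}+e^vp_{01,t})]$. For $a,b\in[0,1]$, $f^*_{a\to b}(t)=\operatorname{argmin}_{s\in[0,1]}[I_{1,t}(a,s)+I_{1,T-t}(s,b)]$, $t\in[0,T]$; for $u,r\in\mathscr W$, $h^*_{u\to r}(x,y,t)=f^*_{u(x,y)\to r(x,y)}(t)$, a path in $\mathscr W\times[0,T]$, with class $\tilde h^*_{u\to r}$. *)

(* Defs.v *)
From mathcomp Require Import all_boot all_order all_algebra.
From mathcomp Require Import all_classical all_reals all_analysis.

Set Implicit Arguments.
Unset Strict Implicit.
Unset Printing Implicit Defensive.
Import Order.TTheory GRing.Theory Num.Theory.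
Import numFieldNormedType.Exports.

Local Open Scope classical_set_scope.
Local Open Scope ring_scope.

(* The unit interval and square are subsets of R and R * R; functions are
   total on R (resp. R * R), and only their values on the unit interval
   (resp. square) matter.  Likewise a path is indexed by all of R, and only its
   values at times in [0, T] matter. *)

Section Graphons.
Context {R : realType}.
Implicit Types (h g u r : R * R -> R) (sigma tau : R -> R).

Definition I01 : set R := `[0, 1]%classic.
Definition sqr01 : set (R * R) := I01 `*` I01.

Notation leb := (@lebesgue_measure R).
Notation leb2 := (leb \x leb)%E.

(* A representative of an element of the space W. *)
Definition graphon h : Prop :=
  [/\ measurable_fun sqr01 h,
      (forall x y, I01 x -> I01 y -> h (x, y) = h (y, x)) &
      (forall z, sqr01 z -> 0 <= h z <= 1)].

Definition measure_preserving sigma : Prop :=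
  [/\ (forall x, I01 x -> I01 (sigma x)),
      measurable_fun I01 sigma &
      (forall B : set R, measurable B -> B `<=` I01 ->
         leb (I01 `&` sigma @^-1` B) = leb B)].

(* Bijections up to null sets: there is a measure-preserving inverse almost
   everywhere. *)
Definition mp_bijection sigma : Prop :=
  measure_preserving sigma /\
  exists tau, [/\ measure_preserving tau,
    {ae leb, forall x, I01 x -> tau (sigma x) = x} &
    {ae leb, forall x, I01 x -> sigma (tau x) = x}].

Definition relabel h sigma : R * R -> R := fun z => h (sigma z.1, sigma z.2).

(* Equality in W is almost-everywhere equality, so the relation ~ on W, read on
   representatives, is equality almost everywhere up to relabelling. *)
Definition gequiv h g : Prop :=
  exists2 sigma, mp_bijection sigma &
    {ae leb2, forall z, sqr01 z -> h z = relabel g sigma z}.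

Definition gclass h : set (R * R -> R) := [set g | graphon g /\ gequiv g h].

End Graphons.

Section Paths.
Context {R : realType}.
Variables (lambda mu T : R).
Implicit Types h g : R -> R * R -> R.

Notation leb := (@lebesgue_measure R).
Notation leb2 := (leb \x leb)%E.

Definition gpath h : Prop := forall t, 0 <= t <= T -> graphon (h t).

(* The relabelling may depend on t. *)
Definition pequiv h g : Prop := forall t, 0 <= t <= T -> gequiv (h t) (g t).

Definition pclass h : set (R -> R * R -> R) := [set g | gpath g /\ pequiv g h].

Definition abs_continuous (a b : R) (f : R -> R) : Prop :=
  forall e : R, 0 < e -> exists2 d : R, 0 < d &
    forall (n : nat) (p q : 'I_n -> R),
      (forall i, [/\ a <= p i, p i <= q i & q i <= b]) ->
      (forall i j, i != j -> q i <= p j \/ q j <= p i) ->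
      \sum_i (q i - p i) < d -> \sum_i `|f (q i) - f (p i)| < e.

Definition lagrangian (a b : R) : \bar R :=
  ereal_sup [set (v * b - lambda * (expR v - 1) * (1 - a)
                        - mu * (expR (- v) - 1) * a)%:E | v in [set: R]].

(* Read on a family of representatives (h_t).  The set pclass h contains, with
   a path, every other choice of representatives of each h_t, so the infimum
   below also ranges over all versions of a given path in W. *)
Definition action h : \bar R :=
  if `[< {ae leb2, forall z, sqr01 z -> abs_continuous 0 T (h ^~ z)} >] then
    (\int[leb]_(t in `[0%R, T]) \int[leb2]_(z in sqr01)
       lagrangian (h t z) (derive1 (h ^~ z) t))%E
  else +oo%E.

Definition caction (C : set (R -> R * R -> R)) : \bar R :=
  ereal_inf [set action h | h in C].

Definition admissible (u r : R * R -> R) (C : set (R -> R * R -> R)) : Prop :=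
  exists h, [/\ gpath h, C = pclass h,
                gclass (h 0) = gclass u & gclass (h T) = gclass r].

Definition Hstar (u r : R * R -> R) : set (set (R -> R * R -> R)) :=
  [set C | admissible u r C /\
           forall D, admissible u r D -> (caction C <= caction D)%E].

Definition p01 (t : R) : R :=
  (lambda - lambda * expR (- (t * (lambda + mu)))) / (lambda + mu).

Definition p11 (t : R) : R :=
  (lambda + mu * expR (- (t * (lambda + mu)))) / (lambda + mu).

Definition rate1 (t a w : R) : \bar R :=
  ereal_sup [set (v * w - a * ln (1 - p11 t + expR v * p11 t)
                  - (1 - a) * ln (1 - p01 t + expR v * p01 t))%:E
            | v in [set: R]].

Definition fstar_objective (a b t s : R) : \bar R :=
  (rate1 t a s + rate1 (T - t) s b)%E.

(* argmin over s in [0, 1]; the default 0 is used only if there is none. *)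
Definition fstar (a b t : R) : R :=
  xget 0 [set s | I01 s /\ forall s', I01 s' ->
                    (fstar_objective a b t s <= fstar_objective a b t s')%E].

Definition hstar (u r : R * R -> R) : R -> R * R -> R :=
  fun t z => fstar (u z) (r z) t.

End Paths.

Section Example.
Context {R : realType}.

Definition A1 : set R := `[0, 1 / 5[%classic.
Definition A2 : set R := `[1 / 5, 3 / 5[%classic.
Definition A3 : set R := `[3 / 5, 1]%classic.

Definition uex (eps : R) (z : R * R) : R :=
  if z \in (A2 `*` A2) `|` (A1 `*` A3) `|` (A3 `*` A1) then 0
  else if z \in (A3 `*` A3) `|` (A1 `*` A2) `|` (A2 `*` A1) then eps
  else 1.

Definition rex (eps : R) (z : R * R) : R :=
  if z \in (A2 `*` A2) `|` (A1 `*` A2) `|` (A2 `*` A1) then 0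
  else if z \in (A3 `*` A3) `|` (A1 `*` A3) `|` (A3 `*` A1) then eps
  else 1.

(* The identity on A1 (and outside the unit interval). *)
Definition sigmaex (x : R) : R :=
  if x \in A2 then x + 2 / 5 else if x \in A3 then x - 2 / 5 else x.

End Example.

(* Main.v *)
Require Import Defs.
From HB Require Import structures.
From mathcomp Require Import all_boot all_order all_algebra.
From mathcomp Require Import all_classical all_reals all_analysis.
From mathcomp Require Import measurable_realfun lebesgue_measure.
From mathcomp Require Import lebesgue_integral_fubini.
From mathcomp Require Import ring lra.
Set Implicit Arguments.
Unset Strict Implicit.
Unset Printing Implicit Defensive.
Import Order.TTheory GRing.Theory Num.Theory.
Import numFieldNormedType.Exports.
Local Open Scope classical_set_scope.
Local Open Scope ring_scope.

(** One edge is a two-state chain with flip rates [lambda] and [mu].  Moving it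
from density [a] to density [b] in time [T] has a least cost, the Legendre
transform [rate1 T a b].  Weights [x0], [x1] on the two final states turn into
the backward functions [psi0], [psi1]; the function
[x * ln psi1 + (1 - x) * ln psi0] solves the Hamilton-Jacobi equation of the
Lagrangian, so its increment along any absolutely continuous path is at most
the action of the path ([path_cost_le]), with equality along the path [phi] of
the tilted chain ([optimal_path_cost]).  Cutting a path at an intermediate
time and tilting the weights there improves the bound by a multiple of the
squared distance to [phi] ([path_cost_stability]).  This stability both
identifies [fstar] with [phi] ([fstarE]) and forces paths of nearly minimal
action to stay close to it.

Integrated over the unit square, these bounds say that a path from a
relabelling of [uex] to a relabelling of [rex] costs at least what its two
endpoints require, plus a penalty for not following the optimal paths
([action_blocks_ge]).  The cost of the endpoints depends only on the 3 x 3
matrix of masses by which the blocks of [uex] are coupled to those of [rex].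
For small [T], changing an edge density between 1 and a value in
[{0, eps}] costs at least about [(1 - eps) * ln (1 / T)], whereas changes within
[{0, eps}] cost at most about [eps * ln (1 / T)]
([exists_small_time]).  Both graphons have density 1 exactly on
the block pairs 11, 23 and 32, and the only couplings that respect this
pattern are the identity and the exchange of the blocks 2 and 3.  A coupling
at distance [d] from both of them breaks the pattern on a set of measure at
least [d / 20] ([coupling_mismatch]), which is too expensive.  The two good
couplings have the same cost because the exchange permutes the table of
costs ([alignedcostE]).  They give the two paths of the theorem, which are
therefore minimal.

For the converse, a minimal class contains paths whose action tends to the
minimum.  Relabellings may vary with time and with the path, so at each time
[t] the representative [h t] is only known to be close, for the measure, to
block kernels [w (k x) (k y)] with one fixed table [w] and varying labels [k].
The value of [w] on the pattern 11, 23, 32 is separated from its other values,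
so two such labels are close to each other or differ by an exchange; after
fixing the type, the labels form a Cauchy sequence and [h t] is itself a
relabelled block kernel ([block_limit], [label_bijection]).

Finally the two classes differ at time [T / 2]: a relabelling between them
would again respect the pattern, and would then equate the value of the path
from 0 to 0 with the value of the path from 0 to [eps] or from [eps] to 0, but
it is strictly smaller than both. *)

(** * Absolute continuity and total variation *)

Section IntervalFamilies.
Context {R : realType}.
Implicit Types (a b : R) (I J : R * R) (s : seq (R * R)) (f : R -> R).

(** Only the endpoints are compared, so that degenerate and adjacent intervals are
allowed, as in the definition of absolute continuity. *)
Definition nonoverlapping I J := (I.2 <= J.1) || (J.2 <= I.1).

Definition subinterval a b I := [&& a <= I.1, I.1 <= I.2 & I.2 <= b].

Definition osc f I : R := `|f I.2 - f I.1|.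

Definition consecutive (a : R) (l : seq R) : seq (R * R) := pairmap pair a l.

(** Families indexed by ordinals are awkward to concatenate and refine; sequences
of intervals are not. *)
Lemma abs_continuous_seq a b f : abs_continuous a b f ->
  forall e : R, 0 < e -> exists2 d : R, 0 < d & forall s,
    all (subinterval a b) s -> pairwise nonoverlapping s ->
    \sum_(I <- s) (I.2 - I.1) < d -> \sum_(I <- s) osc f I < e.
Proof.
move=> acf e /acf[d d0 H]; exists d => // s sab sno sd.
have := H (size s) (fun i => (nth (0, 0) s i).1) (fun i => (nth (0, 0) s i).2).
rewrite (big_nth (0, 0)) big_mkord in sd.
rewrite (big_nth (0, 0)) big_mkord; apply => //.
- by move=> i; have /(all_nthP (0, 0))/(_ i (ltn_ord i))/and3P[] := sab.
- move=> i j ij; wlog lij : i j ij / (i < j)%N.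
    move=> W; case: (ltngtP i j) => [|ji|/val_inj ij']; first exact: W.
    + by rewrite or_comm; apply: W => //; rewrite eq_sym.
    + by rewrite ij' eqxx in ij.
  have /(pairwiseP (0, 0))/(_ i j) := sno.
  by rewrite !inE !ltn_ord => /(_ isT isT lij)/orP.
Qed.

Lemma sum_consecutive a b f l : last a l = b ->
  variation a b f l = \sum_(I <- consecutive a l) osc f I.
Proof.
rewrite /variation; elim: l a => [|x l ih] a /=; first by rewrite !big_nil.
move=> lb; rewrite big_cons big_nat_recl//=; congr +%R.
by rewrite -(ih x lb).
Qed.

Lemma length_consecutive a l :
  \sum_(I <- consecutive a l) (I.2 - I.1) = last a l - a.
Proof.
elim: l a => [|x l ih] a /=; first by rewrite big_nil subrr.
by rewrite big_cons ih /= addrC subrKA.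
Qed.

Lemma subinterval_consecutive a l : path <%R a l ->
  all (subinterval a (last a l)) (consecutive a l).
Proof.
elim: l a => [|x l ih] a //= /andP[ax xl]; rewrite /subinterval/= lexx (ltW ax)/=.
have /andP[xl'  {}ih] : (x <= last x l) && all (subinterval x (last x l)) (consecutive x l).
  rewrite ih// andbT; case: l xl {ih} => //= y l xl.
  by have /allP H := @order_path_min _ _ x (y :: l) lt_trans xl; apply/ltW/H/mem_last.
rewrite xl'/=; apply: sub_all ih => I /and3P[h1 h2 h3]; rewrite /subinterval.
by rewrite h2 h3 (le_trans (ltW ax)).
Qed.

Lemma nonoverlapping_consecutive a l : path <%R a l ->
  pairwise nonoverlapping (consecutive a l).
Proof.
elim: l a => [|x l ih] a //= /andP[ax xl]; rewrite ih// andbT.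
apply/allP => I /(allP (subinterval_consecutive xl))/and3P[h _ _].
by rewrite /nonoverlapping /= h.
Qed.

Lemma nonoverlapping_sym : symmetric nonoverlapping.
Proof. by move=> I J; rewrite /nonoverlapping orbC. Qed.

Lemma nonoverlappingS I J a b : nonoverlapping J (a, b) -> subinterval a b I ->
  nonoverlapping J I.
Proof.
move=> /orP[/= h|/= h] /and3P[h1 h2 h3]; apply/orP; [left|right].
  exact: le_trans h1.
exact: le_trans h.
Qed.

(** Total variation over small disjoint intervals is as small as the sum of the
oscillations, because refining every interval by a partition keeps the family
admissible.  The intervals of [s0] are those already refined: the induction
moves the pieces of one partition of the head of [s] into [s0] and takes the
supremum over that partition afterwards. *)
Lemma total_variation_le_abs a b f (e : R) s0 s (d : R) :
  (forall s, all (subinterval a b) s -> pairwise nonoverlapping s ->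
    \sum_(I <- s) (I.2 - I.1) < d -> \sum_(I <- s) osc f I < e) ->
  all (subinterval a b) (s0 ++ s) -> pairwise nonoverlapping (s0 ++ s) ->
  \sum_(I <- s0 ++ s) (I.2 - I.1) < d ->
  ((\sum_(I <- s0) osc f I)%:E +
     \sum_(I <- s) total_variation I.1 I.2 f <= e%:E)%E.
Proof.
move=> H; elim: s s0 => [|[p q] s ih] s0.
  by rewrite cats0 big_nil adde0 lee_fin => h1 h2 h3; apply/ltW/H.
rewrite big_cons /= => sab sno sd.
have pq : p <= q.
  by move: sab; rewrite all_cat /= => /and3P[_ /and3P[]].
have [<-|ltpq] := eqVneq p q.
  rewrite total_variationxx add0e; apply: ih.
  - by move: sab; rewrite !all_cat /= => /and3P[-> _ ->].
  - move: sno; rewrite !pairwise_cat /= => /and3P[+ -> /andP[_ ->]] /=.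
    by rewrite allrel_consr => /andP[_ ->].
  - apply: le_lt_trans sd; rewrite !big_cat/= big_cons lerD2l lerDr.
    by rewrite subr_ge0.
have {}ltpq : p < q by rewrite lt_neqAle ltpq.
have vne : variations p q f !=set0 by exact: variations_neq0.
(* Refine the interval [p, q] by the partition [l] and apply the induction hypothesis. *)
have key l : itv_partition p q l ->
    ((\sum_(I <- s0) osc f I)%:E + ((variation p q f l)%:E +
     \sum_(I <- s) total_variation I.1 I.2 f) <= e%:E)%E.
  move=> [pl /eqP lq]; rewrite (sum_consecutive _ lq) addeA -EFinD -big_cat.
  have subl := subinterval_consecutive pl; rewrite lq in subl.
  apply: ih.
  - move: sab; rewrite !all_cat /= => /and3P[-> /and3P[h1 h2 h3] ->]/=.
    rewrite andbT; apply: sub_all subl => I /and3P[g1 g2 g3].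
    by rewrite /subinterval g2 (le_trans h1)// (le_trans g3).
  - move: sno; rewrite !pairwise_cat /= (nonoverlapping_consecutive pl).
    rewrite allrel_consr allrel_catl.
    move=> /and3P[/andP[/allP h1 h2] h3 /andP[h4 h5]].
    rewrite h2 h3 h5 /= !andbT.
    suff -> : allrel nonoverlapping (consecutive p l) s.
      by apply/allrelP => I J /h1 /nonoverlappingS IJ /(allP subl) /IJ.
    apply/allrelP => I J /(allP subl) IJ /(allP h4).
    by rewrite ![nonoverlapping _ J]nonoverlapping_sym => /nonoverlappingS /(_ IJ).
  - apply: le_lt_trans sd.
    by rewrite !big_cat big_cons/= length_consecutive lq addrA.
have tvge (x : R) : (forall l, itv_partition p q l -> variation p q f l <= x) ->
    (total_variation p q f <= x%:E)%E.
  move=> h; apply: ge_ereal_sup => _ [_ [l pl <-] <-]; rewrite lee_fin; exact: h.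
set S := (\sum_(I <- s) _)%E in key *; set Z := \sum_(_ <- _) _ in key *.
have S0 : (0 <= S)%E.
  rewrite /S big_seq; apply: sume_ge0 => I Is; apply: total_variation_ge0.
  by move: sab; rewrite all_cat /= => /and3P[_ _ /allP/(_ _ Is)/and3P[]].
case: vne => _ [l0 pl0 _].
have : S \is a fin_num.
  rewrite ge0_fin_numE// ltey; apply: contraPN (key _ pl0) => /eqP ->.
  by rewrite addey// addey// leye_eq.
move: S S0 key => [S| |]// S0 key _.
have : (total_variation p q f <= (e - Z - S)%:E)%E.
  apply: tvge => l /key; rewrite -!EFinD lee_fin; lra.
move: (total_variation p q f) (total_variation_ge0 f pq) => [t| |]//=.
by rewrite -!EFinD !lee_fin => _; lra.
Qed.

End IntervalFamilies.

Section AbsolutelyContinuousMonotone.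
Context {R : realType}.
Implicit Types (a b : R) (I J : R * R) (s : seq (R * R)) (f : R -> R).

(** Absolute continuity on [a, b], in the form given by [abs_continuous_seq]. *)
Definition ac_seq a b f := forall e : R, 0 < e -> exists2 d : R, 0 < d &
  forall s, all (subinterval a b) s -> pairwise nonoverlapping s ->
    \sum_(I <- s) (I.2 - I.1) < d -> \sum_(I <- s) osc f I < e.

Definition clamp a b x : R := Num.max a (Num.min x b).

Lemma clamp_itv a b x : a <= b -> a <= clamp a b x <= b.
Proof. by move=> ab; rewrite /clamp le_max lexx /= ge_max ab ge_min lexx orbT. Qed.

Lemma clamp_id a b x : a <= x <= b -> clamp a b x = x.
Proof. by move=> /andP[ax xb]; rewrite /clamp (min_idPl xb) (max_idPr ax). Qed.

Lemma le_clamp a b x y : x <= y -> clamp a b x <= clamp a b y.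
Proof.
move=> xy; rewrite /clamp ge_max !le_max lexx/=; apply/orP; right.
by rewrite le_min !ge_min xy lexx orbT.
Qed.

Lemma clamp_contract a b x y : x <= y -> clamp a b y - clamp a b x <= y - x.
Proof.
move=> xy; rewrite /clamp; case: (leP x b) => xb; case: (leP y b) => yb;
  case: (leP a x) => ax; case: (leP a y) => ay; case: (leP a b) => ab; lra.
Qed.

Definition setI_of I : set R := `]I.1, I.2]%classic.

Lemma disjoint_nonoverlapping I J : I.1 < I.2 -> J.1 < J.2 ->
  setI_of I `&` setI_of J = set0 -> nonoverlapping I J.
Proof.
move=> I12 J12 IJ; rewrite /nonoverlapping.
case: (leP I.2 J.1) => //= h1; rewrite leNgt; apply/negP => h2.
suff : (setI_of I `&` setI_of J) (Num.min I.2 J.2) by rewrite IJ.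
by split; rewrite /setI_of/= in_itv/= lt_min ge_min lexx ?orbT ?I12 ?J12 ?h1 ?h2.
Qed.

Local Notation leb := (@lebesgue_measure R).

Lemma stieltjes_oc (F : cumulative R R) (p q : R) : p <= q ->
  lebesgue_stieltjes_measure F `]p, q]%classic = (F q - F p)%:E.
Proof.
move=> pq; rewrite /lebesgue_stieltjes_measure /measure_extension/=.
rewrite measurable_mu_extE/=; last by exists (p, q).
by rewrite wlength_itv_bnd.
Qed.

(** A Lebesgue null set has a cover by half-open intervals of total length less
than the [d] of absolute continuity.  A finite union of them is a finite disjoint
union of half-open intervals, on which the Stieltjes measure is a sum of
increments, hence less than [e]; the full cover follows by continuity from
below. *)
Lemma stieltjes_dominated a b (F : cumulative R R) : a <= b ->
  (forall x, F x = F (clamp a b x)) -> ac_seq a b F ->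
  forall A, measurable A -> leb A = 0%E -> lebesgue_stieltjes_measure F A = 0%E.
Proof.
move=> ab Fc acF A mA A0; apply/eqP; rewrite eq_le measure_ge0 andbT.
apply/lee_addgt0Pr => e e0; rewrite add0e.
have [d d0 Hd] := acF _ e0.
have : (ereal_inf [set \sum_(k <oo) wlength idfun (B k) | B in
          @measurable_cover _ (ocitv_type R) A] < d%:E)%E.
  by move: A0; rewrite /lebesgue_measure/= /lebesgue_stieltjes_measure
    /measure_extension/= /mu_ext => ->; rewrite lte_fin.
move=> /ereal_inf_lt[_ [B [mB AB] <-]] Bd.
have lebB k : leb (B k) = wlength idfun (B k).
  rewrite /lebesgue_measure /lebesgue_stieltjes_measure /measure_extension/=.
  by rewrite measurable_mu_extE.
have mB' k : measurable (B k : set (measurableTypeR R)).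
  exact: sub_sigma_algebra.
set mu := lebesgue_stieltjes_measure F.
pose U n := \big[setU/set0]_(k < n.+1) B k.
have mU n : measurable (U n : set (measurableTypeR R)).
  by apply: bigsetU_measurable => k _; exact: mB'.
have UB : \bigcup_n U n = \bigcup_n B n by rewrite bigcup_bigsetU_bigcup.
have mUB : measurable (\bigcup_n U n : set (measurableTypeR R)).
  exact: bigcup_measurable.
apply: (@le_trans _ _ (mu (\bigcup_n U n))).
  by apply: le_measure; rewrite ?inE//= UB.
have : mu \o U @ \oo --> mu (\bigcup_n U n).
  apply: nondecreasing_cvg_mu => //.
  by move=> m n mn; apply/subsetPset; exact: subset_bigsetU.
move=> /cvg_lim <- //; apply: lime_le; first by apply/cvg_ex; eexists;
  apply: nondecreasing_cvg_mu => //;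
  move=> m n mn; apply/subsetPset; exact: subset_bigsetU.
apply: nearW => n /=.
have lebU : (leb (U n) < d%:E)%E.
  apply: le_lt_trans Bd; apply: (@le_trans _ _ (\sum_(k < n.+1) leb (B k))%E).
    exact: (Boole_inequality leb).
  under eq_bigr do rewrite lebB.
  by rewrite -(big_mkord xpredT (fun k => wlength idfun (B k)));
    apply: nneseries_lim_ge => k _ _; exact: wlength_ge0.
have mUr : measurable (U n : set (SetRing.type (ocitv_type R))).
  by apply: bigsetU_measurable => k _; exact: SetRing.measurable_subring.
(* The ring generated by half-open intervals consists of finite disjoint unions. *)
have [S [Sfin Sne Str Sm SU]] := SetRing.ring_finite_set mUr.
have /finite_seqP[s0 Es0] := Sfin.
pose s := undup s0.
have sS X : (X \in s) = (X \in S) by rewrite mem_undup Es0 mem_setE.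
have Sin X : X \in s -> exists I, I.1 < I.2 /\ X = setI_of I.
  rewrite sS => XS; have /ocitvP[X0|[I I12 XI]] := Sm X XS; last by exists I.
  by have := Sne X (set_mem XS); rewrite X0 => -[].
have [X|h hP] := @boolp.choice (set R) (R * R)
    (fun X I => X \in s -> I.1 < I.2 /\ X = setI_of I).
  case: (boolP (X \in s)) => [/Sin[I IP]|_]; first by exists I.
  by exists (0, 0).
have sum_of (G : cumulative R R) : (lebesgue_stieltjes_measure G (U n) =
    (\sum_(X <- s) (G (h X).2 - G (h X).1))%:E)%E.
  have -> : U n = \big[setU/set0]_(X <- s) X.
    rewrite SU -bigcup_seq; congr (bigcup _ _); apply/seteqP.
    by split => X /=; [move/mem_set; rewrite -sS|rewrite sS => /set_mem].
  rewrite -bigcup_seq measure_fin_bigcup//=; first last.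
  - by move=> X /hP[_ ->]; exact: measurable_itv.
  - by move=> X Y; rewrite /= !sS => XS YS; apply: Str; exact: set_mem.
  - exact: finite_seq.
  - rewrite -fsbig_seq ?undup_uniq// -sumEFin big_seq [RHS]big_seq.
    apply: eq_bigr => X Xs; have [h12 {1}->] := hP X Xs.
    by rewrite stieltjes_oc// ltW.
rewrite /mu sum_of lee_fin.
pose c I := (clamp a b I.1, clamp a b I.2).
apply: ltW; apply: le_lt_trans (Hd [seq c (h X) | X <- s] _ _ _).
- rewrite big_map big_seq [leRHS]big_seq; apply: ler_sum => X Xs.
  by rewrite /osc /= -!Fc; exact: ler_norm.
- apply/allP => _ /mapP[X /hP[h12 _] ->]; rewrite /subinterval /c /=.
  have /andP[-> _] := clamp_itv (h X).1 ab.
  by have /andP[_ ->] := clamp_itv (h X).2 ab; rewrite le_clamp// ltW.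
- rewrite pairwise_map; apply/(pairwiseP set0) => i j; rewrite !inE => si sj ij.
  have [hi Xi] := hP _ (mem_nth set0 si); have [hj Xj] := hP _ (mem_nth set0 sj).
  have : nonoverlapping (h (nth set0 s i)) (h (nth set0 s j)).
    apply: disjoint_nonoverlapping => //; rewrite -Xi -Xj; apply: contrapT.
    move/eqP/set0P => ne.
    have memS k : (k < size s)%N -> S (nth set0 s k).
      by move=> ks; apply: set_mem; rewrite -sS mem_nth.
    have := Str _ _ (memS _ si) (memS _ sj) ne.
    move/(uniqP _ (undup_uniq s0)); rewrite !inE si sj => /(_ isT isT) ij'.
    by rewrite ij' ltnn in ij.
  by move=> /orP[h1|h1]; apply/orP; [left|right]; rewrite /c/= le_clamp.
- rewrite big_map -lte_fin; apply: le_lt_trans lebU.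
  rewrite /lebesgue_measure sum_of lee_fin big_seq [leRHS]big_seq.
  by apply: ler_sum => X /hP[h12 _]; rewrite clamp_contract// ltW.
Qed.

End AbsolutelyContinuousMonotone.

Section AbsolutelyContinuous.
Context {R : realType}.
Implicit Types (a b : R) (f : R -> R).
Local Notation leb := (@lebesgue_measure R).

Lemma ac_seq_interval a b f : ac_seq a b f -> forall e : R, 0 < e ->
  exists2 d : R, 0 < d & forall x y, a <= x -> x <= y -> y <= b -> y - x < d ->
    `|f y - f x| < e.
Proof.
move=> acf e /acf[d d0 H]; exists d => // x y ax xy yb xyd.
have := H [:: (x, y)]; rewrite /= !big_seq1 /subinterval /= ax xy yb.
exact.
Qed.

(** Composing with [clamp] extends a function from an interval to the whole
line, where Stieltjes measures are defined. *)
Lemma continuous_ac_clamp a b f : a <= b -> ac_seq a b f ->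
  continuous (f \o clamp a b).
Proof.
move=> ab /ac_seq_interval acf x; apply/cvgrPdist_lt => e /acf[d d0 H].
have key u v : `|u - v| < d -> u <= v -> `|f (clamp a b v) - f (clamp a b u)| < e.
  move=> uvd uv; apply: H; [|exact: le_clamp| |].
  - by have /andP[] := clamp_itv u ab.
  - by have /andP[] := clamp_itv v ab.
  - apply: le_lt_trans (clamp_contract a b uv) _.
    by rewrite -(ger0_norm (_ : 0 <= v - u)) ?subr_ge0// distrC.
near=> y => /=.
have yx : `|x - y| < d by near: y; apply: cvgr_dist_lt.
case: (leP x y) => [xy|/ltW xy]; first by rewrite distrC; exact: key.
by apply: key => //; rewrite distrC.
Unshelve. all: by end_near. Qed.

Lemma ac_seq_clamp a b f : a <= b -> ac_seq a b f -> ac_seq a b (f \o clamp a b).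
Proof.
move=> ab acf e /acf[d d0 H]; exists d => // s sab sno sd.
apply: le_lt_trans (H s sab sno sd); rewrite big_seq [leRHS]big_seq.
apply: ler_sum => I /(allP sab)/and3P[h1 h2 h3]; rewrite /osc/=.
by rewrite !clamp_id ?h1 ?h3 ?(le_trans h1)//= (le_trans h2).
Qed.

(** Radon-Nikodym for the Stieltjes measure of the clamped function, which is
dominated by Lebesgue measure. *)
Lemma monotone_ac_density a b f : a <= b ->
  {in `[a, b] &, nondecreasing_fun f} -> ac_seq a b f ->
  exists g : R -> R, leb.-integrable setT (EFin \o g) /\
    forall x, a <= x <= b -> (f x - f a)%:E = (\int[leb]_(t in `]a, x]) (g t)%:E)%E.
Proof.
move=> ab ndf acf; pose F := f \o clamp a b.
have ndF : nondecreasing F.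
  move=> x y xy; apply: ndf; last exact: le_clamp;
  by rewrite in_itv/= clamp_itv.
have rcF : right_continuous F.
  by apply: right_continuousW; exact: continuous_ac_clamp.
pose Fc : cumulative R R := HB.pack F (isCumulative.Build R _ R F ndF rcF).
have clampK x : clamp a b (clamp a b x) = clamp a b x.
  by rewrite (clamp_id (clamp_itv x ab)).
have Fclamp x : Fc x = Fc (clamp a b x) by rewrite /= /F /= clampK.
have dom := stieltjes_dominated ab Fclamp (ac_seq_clamp ab acf).
have mD : measurable (`]a, b]%classic : set (measurableTypeR R)).
  exact: measurable_itv.
have finD : (lebesgue_stieltjes_measure Fc `]a, b]%classic < +oo)%E.
  by rewrite stieltjes_oc// ltry.
pose nu : {finite_measure set (measurableTypeR R) -> \bar R} := mfrestr mD finD.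
have nudom : nu `<< leb.
  apply/null_content_dominatesP => A mA A0.
  rewrite /nu/= /mfrestr /mrestr dom//; first exact: measurableI.
  by apply/eqP; rewrite eq_le measure_ge0 andbT -A0 le_measure// inE//;
    exact: measurableI.
have [g [g0 gfin gint gE]] := radon_nikodym_sigma_finite nudom.
exists (fine \o g); split.
  by rewrite (_ : EFin \o _ = g)//; apply/funext => x /=; rewrite fineK.
move=> x /andP[ax xb]; under eq_integral do rewrite /= fineK//.
rewrite -gE; last exact: measurable_itv.
rewrite /nu/= /mfrestr /mrestr (_ : _ `&` _ = `]a, x]%classic).
  by rewrite stieltjes_oc//= /F/= !clamp_id ?lexx ?ab ?ax ?xb.
apply/seteqP; split => [y []//|y /=]; rewrite !in_itv/= => /andP[-> yx].
by rewrite yx (le_trans yx xb).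
Qed.

(** Intervals shorter than the [d] attached to the oscillation 1 have finite
variation, and finitely many of them cover [x, y]. *)
Lemma total_variation_fin a b f : a <= b -> ac_seq a b f ->
  forall x y, a <= x -> x <= y -> y <= b -> total_variation x y f \is a fin_num.
Proof.
move=> ab acf x y ax xy yb.
have [d d0 H] := acf 1 ltr01.
have small u v : a <= u -> u <= v -> v <= b -> v - u < d ->
    total_variation u v f \is a fin_num.
  move=> au uv vb uvd; rewrite ge0_fin_numE ?total_variation_ge0//.
  have := total_variation_le_abs (s0 := [::]) (s := [:: (u, v)]) H.
  rewrite /= big_nil add0e !big_seq1 /subinterval /= au uv vb => /(_ isT isT uvd) h.
  by apply: le_lt_trans h _; rewrite ltry.
have d2 : 0 < d / 2 by rewrite divr_gt0.
(* Advance by steps of length [d / 2]. *)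
have step n : forall v, x <= v -> v <= b -> v - x <= n%:R * (d / 2) ->
    total_variation x v f \is a fin_num.
  elim: n => [|n ih] v xv vb vn.
    by apply: small => //; rewrite (le_lt_trans vn)// mul0r.
  case: (leP (v - d / 2) x) => h.
    by apply: small => //; move: d2 h; lra.
  rewrite (total_variationD f (ltW h)); last by rewrite gerBl ltW.
  rewrite fin_numD ih ?(ltW h)//=.
  - apply: small => //; [|by rewrite gerBl ltW|move: d0; lra].
    by rewrite (le_trans ax)// ltW.
  - by rewrite (le_trans _ vb)// gerBl ltW.
  - by move: vn; rewrite -natr1; lra.
apply: (step (Num.bound ((y - x) / (d / 2)))) => //.
rewrite -ler_pdivrMr//; apply/ltW/archi_boundP.
by rewrite divr_ge0// ?subr_ge0// ltW.
Qed.

Lemma ac_seq_total_variation a b f : a <= b -> ac_seq a b f ->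
  ac_seq a b (fun x => fine (total_variation a x f)).
Proof.
move=> ab acf e e0; have e2 : 0 < e / 2 by rewrite divr_gt0.
have [d d0 H] := acf _ e2; exists d => // s sab sno sd.
have := total_variation_le_abs (s0 := [::]) H sab sno sd.
rewrite big_nil add0e => h; rewrite -lte_fin.
apply: (@le_lt_trans _ _ (e / 2)%:E); last by rewrite lte_fin; lra.
apply: le_trans h; rewrite -sumEFin big_seq [leRHS]big_seq.
apply: lee_sum => I /(allP sab)/and3P[h1 h2 h3]; rewrite /osc.
have fin := total_variation_fin ab acf.
rewrite (total_variationD f h1 h2) fineD ?fin//; last exact: le_trans h3.
rewrite addrAC subrr add0r ger0_norm ?fine_ge0 ?total_variation_ge0//.
by rewrite fineK// fin.
Qed.

Lemma ac_seqD a b f g : ac_seq a b f -> ac_seq a b g -> ac_seq a b (f \+ g).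
Proof.
move=> acf acg e e0; have e2 : 0 < e / 2 by rewrite divr_gt0.
have [d d0 H] := acf _ e2; have [d' d'0 H'] := acg _ e2.
exists (Num.min d d'); first by rewrite lt_min d0.
move=> s sab sno; rewrite lt_min => /andP[sd sd'].
apply: (@le_lt_trans _ _ (\sum_(I <- s) osc f I + \sum_(I <- s) osc g I)).
  rewrite -big_split/=; apply: ler_sum => I _; rewrite /osc /=.
  by rewrite opprD addrACA ler_normD.
by rewrite (splitr e) ltrD ?H ?H'.
Qed.

Lemma ac_seqN a b f : ac_seq a b f -> ac_seq a b (\- f).
Proof.
move=> acf e /acf[d d0 H]; exists d => // s sab sno sd.
apply: le_lt_trans (H s sab sno sd); apply: ler_sum => I _; rewrite /osc /=.
by rewrite -opprD normrN.
Qed.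

(** Jordan decomposition: the variation and its difference with [f] are both
monotone and absolutely continuous. *)
Lemma ac_density a b f : a <= b -> ac_seq a b f ->
  exists g : R -> R, leb.-integrable setT (EFin \o g) /\
    forall x, a <= x <= b -> (f x - f a)%:E = (\int[leb]_(t in `]a, x]) (g t)%:E)%E.
Proof.
move=> ab acf; pose V x := fine (total_variation a x f).
have fin := total_variation_fin ab acf.
have acV : ac_seq a b V := ac_seq_total_variation ab acf.
have VB x y : a <= x -> x <= y -> y <= b -> `|f y - f x| <= V y - V x.
  move=> ax xy yb; rewrite /V (total_variationD f ax xy) fineD ?fin//; last exact: le_trans yb.
  rewrite addrAC subrr add0r -lee_fin fineK ?fin//.
  exact: total_variation_ge.
have ndV : {in `[a, b] &, nondecreasing_fun V}.
  move=> x y; rewrite !in_itv/= => /andP[ax _] /andP[_ yb] xy.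
  by rewrite -subr_ge0 (le_trans _ (VB x y ax xy yb)).
have ndVf : {in `[a, b] &, nondecreasing_fun (V \- f)}.
  move=> x y; rewrite !in_itv/= => /andP[ax _] /andP[_ yb] xy.
  by have := le_trans (ler_norm _) (VB x y ax xy yb); lra.
have [g [ig gE]] := monotone_ac_density ab ndV acV.
have [h [ih hE]] := monotone_ac_density ab ndVf (ac_seqD acV (ac_seqN acf)).
exists (g \- h); split.
  rewrite (_ : EFin \o _ = (EFin \o g) \- (EFin \o h))%E//.
  exact: (integrableB measurableT ig ih).
move=> x axb; under eq_integral do rewrite /= EFinB.
have ig' : leb.-integrable `]a, x] (EFin \o g) by apply: integrableS ig.
have ih' : leb.-integrable `]a, x] (EFin \o h) by apply: integrableS ih.
rewrite integralB//=.
by rewrite -gE// -hE// -EFinB; congr EFin; rewrite /=; lra.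
Qed.

Lemma ac_ftc a b f : a <= b -> ac_seq a b f ->
  exists g : R -> R, [/\ leb.-integrable setT (EFin \o g),
    (f b - f a)%:E = (\int[leb]_(t in `[a, b]) (g t)%:E)%E &
    {ae leb, forall x, a < x < b -> is_derive x 1 f (g x)}].
Proof.
move=> ab acf; have [g [ig gE]] := ac_density ab acf.
exists g; split => //.
  rewrite gE ?ab ?lexx// integral_itv_obnd_cbnd//.
  have ig' : leb.-integrable `]a, b] (EFin \o g) by apply: integrableS ig.
  exact: measurable_int ig'.
have /FTC1 : forall y, leb.-integrable [set` Interval (BRight a) (BRight y)] (EFin \o g).
  by move=> y; apply: integrableS ig.
move=> /(_ (open_integrable_locally openT ig)).
apply: filterS; first exact: (ae_filter_ringOfSetsType leb).
move=> x H /andP[ax xb].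
have [dx gx] := H ax.
have : is_derive x 1 (cst (f a) \+ (fun y => \int[leb]_(t in `]a, y]) g t)%R) (g x).
  rewrite -[g x]add0r; apply: is_deriveD.
  by apply: (DeriveDef dx); rewrite -derive1E; exact: gx.
apply: near_eq_is_derive; near=> y.
have /andP[ay yb] : a < y < b by apply/andP; split; near: y;
  [exact: lt_nbhsr|exact: lt_nbhsl].
rewrite /= /Rintegral -gE ?(ltW ay) ?(ltW yb)//=.
by rewrite addrC subrK.
Unshelve. all: by end_near. Qed.
End AbsolutelyContinuous.

(** * A verification inequality for the action of one edge *)

Section Verification.
Context {R : realType}.
Implicit Types (a b : R) (f : R -> R).
Local Notation leb := (@lebesgue_measure R).

Lemma lipschitz_of_derive a b (f df : R -> R) (M : R) :
  (forall x, a <= x <= b -> is_derive x 1 f (df x)) ->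
  (forall x, a <= x <= b -> `|df x| <= M) ->
  forall x y, a <= x -> x <= y -> y <= b -> `|f y - f x| <= M * (y - x).
Proof.
move=> fdf dfM x y ax xy yb.
have [c|t|c] := @MVT_segment _ f df x y xy.
- rewrite in_itv/= => /andP[xc cy].
  by apply: fdf; rewrite (le_trans ax (ltW xc)) (le_trans (ltW cy) yb).
- have : {in `[x, y], forall z, derivable f z 1}.
    move=> z; rewrite in_itv/= => /andP[xz zy].
    by have [] := fdf z; rewrite ?(le_trans ax)// (le_trans zy).
  by move=> /derivable_within_continuous; exact.
- rewrite in_itv/= => /andP[xc cy] ->.
  rewrite normrM (ger0_norm (_ : 0 <= y - x)) ?subr_ge0//.
  by rewrite ler_wpM2r ?subr_ge0// dfM// (le_trans ax)//= (le_trans cy).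
Qed.

Lemma ac_seq_lipschitz a b f (M : R) :
  (forall x y, a <= x -> x <= y -> y <= b -> `|f y - f x| <= M * (y - x)) ->
  ac_seq a b f.
Proof.
move=> fM e e0; exists (e / (`|M| + 1)) => [|s /allP sab _ sd].
  by rewrite divr_gt0// ltr_wpDl.
apply: (@le_lt_trans _ _ (\sum_(I <- s) (`|M| + 1) * (I.2 - I.1))).
  rewrite big_seq [leRHS]big_seq; apply: ler_sum => I /sab/and3P[h1 h2 h3].
  apply: le_trans (fM _ _ h1 h2 h3) _.
  by rewrite ler_wpM2r ?subr_ge0// (le_trans (ler_norm _))// lerDl.
by rewrite -mulr_sumr mulrC -ltr_pdivlMr// ltr_wpDl.
Qed.

Lemma ac_seqM a b f g (M : R) : 0 <= M ->
  (forall x, a <= x <= b -> `|f x| <= M) -> (forall x, a <= x <= b -> `|g x| <= M) ->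
  ac_seq a b f -> ac_seq a b g -> ac_seq a b (f \* g).
Proof.
move=> M0 fM gM acf acg e e0.
have e2 : 0 < e / 2 / (M + 1) by rewrite !divr_gt0// ltr_wpDl.
have [d d0 H] := acf _ e2; have [d' d'0 H'] := acg _ e2.
exists (Num.min d d'); first by rewrite lt_min d0.
move=> s sab sno; rewrite lt_min => /andP[sd sd'].
apply: (@le_lt_trans _ _ ((M + 1) * (\sum_(I <- s) osc f I + \sum_(I <- s) osc g I))).
  rewrite -big_split/= mulr_sumr big_seq [leRHS]big_seq.
  apply: ler_sum => -[p q] /(allP sab)/and3P[/= h1 h2 h3]; rewrite /osc /=.
  have -> : f q * g q - f p * g p = (f q - f p) * g q + f p * (g q - g p) by ring.
  rewrite (le_trans (ler_normD _ _))// !normrM mulrDr lerD//.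
    by rewrite mulrC ler_wpM2r// (le_trans (gM _ _)) ?lerDl// h3 (le_trans h1).
  by rewrite ler_wpM2r// (le_trans (fM _ _)) ?lerDl// h1 (le_trans h2).
have := ltrD (H s sab sno sd) (H' s sab sno sd').
rewrite -(@ltr_pM2l _ (M + 1)) ?ltr_wpDl// => /lt_le_trans; apply.
have -> : e / 2 / (M + 1) + e / 2 / (M + 1) = e / (M + 1) by field; lra.
by rewrite mulrC divfK//; lra.
Qed.

Lemma ac_seq_cst a b (c : R) : ac_seq a b (cst c).
Proof.
apply: (@ac_seq_lipschitz _ _ _ 0) => x y _ _ _.
by rewrite /cst subrr normr0 mul0r.
Qed.

Lemma derive_le_bounded a b (G dG : R -> R) (M : R) : a <= b ->
  (forall x, a <= x <= b -> is_derive x 1 G (dG x)) ->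
  (forall x, a <= x <= b -> `|dG x| <= M) ->
  forall x, a <= x <= b -> `|G x| <= `|G a| + `|M| * (b - a).
Proof.
move=> ab GdG dGM x /andP[ax xb].
have := lipschitz_of_derive GdG dGM (lexx a) ax xb => h.
rewrite -(subrK (G a) (G x)) addrC (le_trans (ler_normD _ _))// lerD//.
apply: le_trans h _.
apply: (@le_trans _ _ (`|M| * (x - a))); first by rewrite ler_wpM2r ?subr_ge0// ler_norm.
by rewrite ler_wpM2l// lerB.
Qed.

(** With [G1] and [G0] smooth, [t |-> f t * G1 t + (1 - f t) * G0 t] is absolutely
continuous; it is the integral of its derivative, which [ell] dominates at almost
every time.  The nonnegative part of the derivative is used so that [ell] need
not be integrable. *)
Lemma verification a b f (G1 dG1 G0 dG0 : R -> R) (M : R) (ell : R -> \bar R) :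
  a <= b -> ac_seq a b f -> (forall x, a <= x <= b -> 0 <= f x <= 1) ->
  (forall x, a <= x <= b -> is_derive x 1 G1 (dG1 x)) ->
  (forall x, a <= x <= b -> `|dG1 x| <= M) ->
  (forall x, a <= x <= b -> is_derive x 1 G0 (dG0 x)) ->
  (forall x, a <= x <= b -> `|dG0 x| <= M) ->
  measurable_fun `[a, b] ell -> (forall t, 0 <= ell t)%E ->
  (forall t, a < t < b -> forall df, is_derive t 1 f df ->
    ((df * (G1 t - G0 t) + f t * dG1 t + (1 - f t) * dG0 t)%:E <= ell t)%E) ->
  ((f b * G1 b + (1 - f b) * G0 b - (f a * G1 a + (1 - f a) * G0 a))%:E
    <= \int[leb]_(t in `[a, b]) ell t)%E.
Proof.
move=> ab acf f01 G1d dG1M G0d dG0M mell ell0 Hell.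
(* A common bound for [f], [1 - f], [G1] and [G0], as needed for their products. *)
pose C := Num.max 1 (Num.max (`|G1 a| + `|M| * (b - a)) (`|G0 a| + `|M| * (b - a))).
have C1 : 1 <= C by rewrite /C le_max lexx.
have C0 : 0 <= C by exact: le_trans C1.
have fC x : a <= x <= b -> `|f x| <= C.
  by move=> /f01/andP[f0 f1]; rewrite ger0_norm// (le_trans f1).
have fC' x : a <= x <= b -> `|(cst 1 \- f) x| <= C.
  move=> /f01/andP[f0 f1]; rewrite /cst/= ger0_norm ?subr_ge0//.
  by rewrite (le_trans _ C1)// lerBlDr lerDl.
have G1C x : a <= x <= b -> `|G1 x| <= C.
  move=> xab; apply: le_trans (derive_le_bounded ab G1d dG1M xab) _.
  by rewrite /C !le_max lexx orbT.
have G0C x : a <= x <= b -> `|G0 x| <= C.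
  move=> xab; apply: le_trans (derive_le_bounded ab G0d dG0M xab) _.
  by rewrite /C !le_max lexx !orbT.
have acG1 : ac_seq a b G1 := ac_seq_lipschitz (lipschitz_of_derive G1d dG1M).
have acG0 : ac_seq a b G0 := ac_seq_lipschitz (lipschitz_of_derive G0d dG0M).
have acf' : ac_seq a b (cst 1 \- f) := ac_seqD (ac_seq_cst _ _ _) (ac_seqN acf).
pose G := (f \* G1) \+ ((cst 1 \- f) \* G0).
have acG : ac_seq a b G.
  by apply: ac_seqD; [exact: (ac_seqM C0 fC G1C)|exact: (ac_seqM C0 fC' G0C)].
have [g [ig gE gd]] := ac_ftc ab acG.
have [f' [_ _ fd]] := ac_ftc ab acf.
rewrite -[X in (X%:E <= _)%E]/(G b - G a) gE.
have ig' : leb.-integrable `[a, b] (EFin \o g) by apply: integrableS ig.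
have mg : measurable_fun `[a, b] (EFin \o g) by apply: measurable_int ig'.
apply: (@le_trans _ _ (\int[leb]_(t in `[a, b]) ((EFin \o g)^\+ t))%E).
  rewrite [X in (X <= _)%E]integralE -[leRHS]sube0; apply: leeB => //.
  exact: integral_ge0.
apply: ae_ge0_le_integral => //.
- exact: measurable_funepos.
have nab : {ae leb, forall x, x != a /\ x != b}.
  exists [set a; b]; split; first by apply: measurableU; exact: measurable_set1.
    apply: countable_lebesgue_measure0.
    by apply: finite_set_countable; rewrite finite_setU.
  move=> x /= /not_andP[/negP/negPn/eqP ->|/negP/negPn/eqP ->]; [by left|by right].
have aef := ae_filter_ringOfSetsType leb.
move: gd fd nab; apply: filterS3 => x gx fx [xa xb].
rewrite /= in_itv/= => /andP[ax bx].
have axb : a < x < b by rewrite !lt_neqAle ax bx eq_sym xa xb.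
have axb' : a <= x <= b by rewrite ax bx.
have {}fx := fx axb; have {}gx := gx axb.
rewrite funeposE ge_max; apply/andP; split; last exact: ell0.
have g1x := G1d x axb'; have g0x := G0d x axb'.
have : is_derive x 1 G ((f x *: dG1 x + G1 x *: f' x) +
    ((cst 1 \- f) x *: dG0 x + G0 x *: (0 - f' x))).
  apply: is_deriveD.
move=> -[_ GD]; have [_ gD] := gx; rewrite /= -gD GD.
apply: le_trans (Hell x axb _ fx); rewrite lee_fin /cst /= /GRing.scale/=.
by rewrite le_eqVlt; apply/orP; left; apply/eqP; ring.
Qed.

End Verification.

(** * Joint measurability of derivatives *)

Section Caratheodory.
Context d (Z : measurableType d) (R : realType).
Implicit Types (H : R -> Z -> R).

Lemma countable_bigcapT_measurable (U : countType) (F : U -> set (R * Z)) :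
  (forall i, measurable (F i)) -> measurable (\bigcap_i F i).
Proof.
move=> mF; rewrite -[X in measurable X]setCK setC_bigcap; apply: measurableC.
by apply: countable_bigcupT_measurable => // i; exact: measurableC.
Qed.

(** The grid points discretise time in the proof of joint measurability. *)
Lemma floor_grid_cvg (t : R) :
  ((Num.floor (t * n.+1%:R))%:~R / n.+1%:R : R) @[n --> \oo] --> t.
Proof.
apply/(@squeeze_cvgr _ _ _ _ (fun n => t - n.+1%:R^-1) (fun=> t)).
- apply: nearW => n; have n0 : 0 < n.+1%:R :> R by [].
  rewrite ler_pdivlMr// mulrBl mulVf ?gt_eqF// lerBlDr.
  rewrite ler_pdivrMr// floor_le_tmp andbT.
  by rewrite -[1]/(1%:~R) -intrD ltW// floorD1_gt.
- rewrite -[X in _ --> X]subr0; apply: cvgB; first exact: cvg_cst.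
  exact: cvg_harmonic.
- exact: cvg_cst.
Qed.

(** Replacing the time by the nearest grid point on its left gives a function that
is measurable on countably many strips, and these functions converge by
continuity in time. *)
Lemma caratheodory_measurable H : (forall t, measurable_fun setT (H t)) ->
  (forall z, continuous (H ^~ z)) ->
  measurable_fun setT (fun p : R * Z => H p.1 p.2).
Proof.
move=> mH cH.
pose grid n (t : R) : R := (Num.floor (t * n.+1%:R))%:~R / n.+1%:R.
apply: (@measurable_fun_cvg _ _ _ _ (fun n p => H (grid n p.1) p.2)); last first.
  move=> [t z] _ /=; apply: (@cvg_comp _ _ _ (fun n => grid n t) (H ^~ z) _ (nbhs t)); last exact: cH.
  exact: floor_grid_cvg.
move=> n _ Y mY; rewrite setTI.
rewrite (_ : _ @^-1` _ = \bigcup_(k : int)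
  ([set t | Num.floor (t * n.+1%:R : R) = k] `*` (H (k%:~R / n.+1%:R) @^-1` Y))).
  apply: countable_bigcupT_measurable => // k; apply: measurableX.
    rewrite (_ : [set _ | _] = `[k%:~R / n.+1%:R, (k + 1)%:~R / n.+1%:R[%classic).
      exact: measurable_itv.
    apply/seteqP; split => t /=; rewrite in_itv/= ler_pdivrMr// ltr_pdivlMr//.
      by move=> <-; rewrite floor_le_tmp floorD1_gt.
    by move=> /andP[h1 h2]; apply/eqP; rewrite floor_eq h1.
  by have := mH (k%:~R / n.+1%:R) measurableT Y mY; rewrite setTI.
apply/seteqP; split => [[t z] /= h|[t z] [k _ [/= <-]]//].
by exists (Num.floor (t * n.+1%:R)).
Qed.

Definition slope (f : R -> R) (t h : R) : R := h^-1 * (f (h + t) - f t).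

(** Derivability as a Cauchy condition on difference quotients with rational
steps: a countable combination of conditions, hence measurable in parameters. *)
Definition rational_cauchy (f : R -> R) (t : R) := forall k : nat, exists m : nat,
  forall qr : rat * rat, 0 < `|qr.1| < m.+1%:R^-1 -> 0 < `|qr.2| < m.+1%:R^-1 ->
    `|slope f t (ratr qr.1) - slope f t (ratr qr.2)| <= k.+1%:R^-1.

Lemma derivable_slope (f : R -> R) (t : R) :
  derivable f t 1 <-> cvg (slope f t h @[h --> 0^']).
Proof.
rewrite /derivable (_ : slope f t = fun h => h^-1 *: ((f \o shift t) (h *: 1) - f t))//.
by apply/funext => h; rewrite /slope /= /GRing.scale/= mulr1.
Qed.

Lemma ratr_small (q : rat) (m : nat) : 0 < `|q| < m.+1%:R^-1 ->
  0 < `|ratr q : R| < m.+1%:R^-1.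
Proof.
by rewrite -ratr_norm ltr0q => /andP[-> ?]; rewrite -(ratr_nat R) -fmorphV ltr_rat.
Qed.

Lemma derivable_rational_cauchy (f : R -> R) (t : R) :
  derivable f t 1 -> rational_cauchy f t.
Proof.
move=> /derivable_slope/cvg_ex[l] /cvgrPdist_le H k.
have k2 : 0 < k.+1%:R^-1 / 2 :> R by rewrite divr_gt0.
have [e /= e0 He] := H _ k2.
exists (Num.truncn (e^-1)) => -[q r] /= /ratr_small/andP[q0 qm] /ratr_small/andP[r0 rm].
have small (x : R) : 0 < `|x| -> `|x| < (Num.truncn e^-1).+1%:R^-1 ->
    `|l - slope f t x| <= k.+1%:R^-1 / 2.
  move=> x0 xm; apply: He; last by rewrite -normr_gt0.
  rewrite /ball_/= sub0r normrN (lt_le_trans xm)//.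
  by rewrite invf_ple ?posrE// ltW// truncnS_gt.
have := small _ q0 qm; have := small _ r0 rm.
move=> h1 h2; apply: le_trans (ler_distD l _ _) _.
by rewrite (splitr k.+1%:R^-1) lerD// distrC.
Qed.

Lemma slope_continuous (f : R -> R) (t h : R) : continuous f -> h != 0 ->
  {for h, continuous (slope f t)}.
Proof.
move=> cf h0; apply: continuousM; first exact: continuousV.
apply: continuousB; last exact: cvg_cst.
apply: (@continuous_comp _ _ _ (fun x => x + t) f); last exact: cf.
by apply: continuousD; [exact: cvg_id|exact: cvg_cst].
Qed.

(** By continuity of the quotients in the step, the Cauchy condition passes from
rational to real steps. *)
Lemma rational_cauchy_derivable (f : R -> R) (t : R) : continuous f ->
  rational_cauchy f t -> derivable f t 1.
Proof.
move=> cf H; apply/derivable_slope/cauchy_cvgP/cauchyP => e e0.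
pose k := Num.truncn e^-1.
have ke : k.+1%:R^-1 < e by rewrite invf_plt ?posrE// truncnS_gt.
have [m Hm] := H k.
have m0 : 0 < m.+1%:R^-1 :> rat by rewrite invr_gt0.
pose q0 : rat := m.+1%:R^-1 / 2.
have q0P : 0 < `|q0| < m.+1%:R^-1.
  by rewrite ger0_norm /q0 ?divr_ge0// divr_gt0//= ltr_pdivrMr// ltr_pMr// ltr1n.
exists (slope f t (ratr q0)).
exists m.+1%:R^-1 => /=; first by rewrite invr_gt0.
move=> h /=; rewrite sub0r normrN => hm h0.
have hc : {for h, continuous (slope f t)} by exact: slope_continuous.
rewrite /ball/=; apply: le_lt_trans ke; rewrite leNgt; apply/negP => far.
have N1 : \forall r \near h, k.+1%:R^-1 < `|slope f t (ratr q0) - slope f t r|.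
  have : `|slope f t (ratr q0) - slope f t r| @[r --> h] -->
      `|slope f t (ratr q0) - slope f t h|.
    by apply: cvg_norm; apply: cvgB; [exact: cvg_cst|exact: hc].
  by move=> /cvgr_gt; exact.
have N2 : \forall r \near h, 0 < `|r| < m.+1%:R^-1.
  have cn : `|r| @[r --> h] --> `|h| by apply: cvg_norm; exact: cvg_id.
  near=> r; apply/andP; split; near: r.
    by apply: (cvgr_gt _ cn); rewrite normr_gt0.
  exact: (cvgr_lt _ cn).
have [e' /= e'0 He'] := filterI N1 N2.
have [q] : exists q : rat, h < ratr q < h + e'.
  have : h < h + e' by rewrite ltrDl.
  by move=> /rat_in_itvoo[q]; rewrite in_itv/=; exists q.
move=> /andP[hq qh].
have [] := He' (ratr q).
  by rewrite /= distrC ger0_norm ?subr_ge0 ?(ltW hq)// ltrBlDl.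
move=> far' /andP[r0 rm].
have := Hm (q0, q) q0P; rewrite /= leNgt far' => /(_ _)/negP; apply.
by rewrite -(ltr0q R) -(ltr_rat R) ratr_norm r0 fmorphV/= ratr_nat.
Unshelve. all: by end_near. Qed.

Lemma slope_cvg_derive1 (f : R -> R) (t : R) : derivable f t 1 ->
  slope f t n.+1%:R^-1 @[n --> \oo] --> derive1 f t.
Proof.
move=> /derivable_slope ct.
have -> : derive1 f t = lim (slope f t h @[h --> 0^']).
  by rewrite /derive1; congr (lim _); congr (_ @ _); apply/funext => h.
apply: (@cvg_comp _ _ _ (fun n : nat => n.+1%:R^-1 : R) (slope f t) _ (0^')); last exact: ct.
move=> A [e /= e0 He]; near=> n; apply: He => //=.
rewrite sub0r normrN ger0_norm//; near: n.
exact: (cvgr_lt _ (@cvg_harmonic R) _ e0).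
Unshelve. all: by end_near. Qed.

Lemma measurable_slope H (q : R) : (forall t, measurable_fun setT (H t)) ->
  (forall z, continuous (H ^~ z)) ->
  measurable_fun setT (fun p : R * Z => slope (H ^~ p.2) p.1 q).
Proof.
move=> mH cH; apply: measurable_funM; first exact: measurable_cst.
apply: measurable_funB; last exact: caratheodory_measurable.
apply: (@caratheodory_measurable (fun t => H (q + t))) => // z t.
apply: (@continuous_comp _ _ _ (fun t => q + t) (H ^~ z)); last exact: cH.
by apply: continuousD; [exact: cvg_cst|exact: cvg_id].
Qed.

Definition derivable_pts H : set (R * Z) :=
  [set p | rational_cauchy (H ^~ p.2) p.1].

Lemma measurable_derivable_pts H : (forall t, measurable_fun setT (H t)) ->
  (forall z, continuous (H ^~ z)) -> measurable (derivable_pts H).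
Proof.
move=> mH cH.
have -> : derivable_pts H = \bigcap_(k : nat) \bigcup_(m : nat) \bigcap_(qr : rat * rat)
    [set p | 0 < `|qr.1| < m.+1%:R^-1 -> 0 < `|qr.2| < m.+1%:R^-1 ->
      `|slope (H ^~ p.2) p.1 (ratr qr.1) - slope (H ^~ p.2) p.1 (ratr qr.2)|
        <= k.+1%:R^-1].
  apply/seteqP; split => p h.
    by move=> k _; have [m hm] := h k; exists m => // qr _; exact: hm.
  by move=> k; have [m _ hm] := h k I; exists m => qr; exact: hm.
apply: bigcap_measurableType => k _; apply: bigcup_measurable => m _.
apply: countable_bigcapT_measurable => -[q r] /=.
have [hq|hq] := pselect (0 < `|q| < m.+1%:R^-1); last first.
  by rewrite (_ : [set _ | _] = setT)//; apply/seteqP; split => p // _ /hq.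
have [hr|hr] := pselect (0 < `|r| < m.+1%:R^-1); last first.
  by rewrite (_ : [set _ | _] = setT)//; apply/seteqP; split => p // _ _ /hr.
have mf : measurable_fun setT (fun p : R * Z =>
    `|slope (H ^~ p.2) p.1 (ratr q) - slope (H ^~ p.2) p.1 (ratr r)|).
  apply: measurableT_comp => //.
  by apply: measurable_funB; exact: measurable_slope.
have := mf measurableT _ (measurable_itv `]-oo, k.+1%:R^-1]).
rewrite setTI; congr measurable; apply/seteqP; split => p /=; rewrite in_itv/=.
  by move=> -> _ _.
by move=> /(_ hq hr).
Qed.

Lemma measurable_derive1_pts H : (forall t, measurable_fun setT (H t)) ->
  (forall z, continuous (H ^~ z)) ->
  measurable_fun (derivable_pts H) (fun p : R * Z => derive1 (H ^~ p.2) p.1).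
Proof.
move=> mH cH.
apply: (@measurable_fun_cvg _ _ _ _
  (fun n p => slope (H ^~ p.2) p.1 n.+1%:R^-1)).
  by move=> n; apply: measurable_funTS; exact: measurable_slope.
move=> [t z] /= h; apply: slope_cvg_derive1.
exact: rational_cauchy_derivable.
Qed.

End Caratheodory.

Section LagrangianMeasurable.
Context {R : realType}.
Variables (lambda mu : R).

Definition test_value (a b v : R) : R :=
  v * b - lambda * (expR v - 1) * (1 - a) - mu * (expR (- v) - 1) * a.

Lemma lagrangian_ge (a b v : R) : ((test_value a b v)%:E <= lagrangian lambda mu a b)%E.
Proof. by apply: ereal_sup_ubound; exists v. Qed.

Lemma lagrangian_ge0 (a b : R) : (0 <= lagrangian lambda mu a b)%E.
Proof.
apply: le_trans (lagrangian_ge a b 0).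
by rewrite /test_value oppr0 expR0 subrr !mulr0 !mul0r !subr0.
Qed.

Lemma continuous_test_value (a b : R) : continuous (test_value a b).
Proof.
move=> v; apply: cvgB.
  apply: cvgB; first by apply: cvgM; [exact: cvg_id|exact: cvg_cst].
  apply: cvgM; last exact: cvg_cst.
  apply: cvgM; first exact: cvg_cst.
  by apply: cvgB; [exact: continuous_expR|exact: cvg_cst].
apply: cvgM; last exact: cvg_cst.
apply: cvgM; first exact: cvg_cst.
apply: cvgB; last exact: cvg_cst.
apply: (@continuous_comp _ _ _ (fun x => - x) expR); last exact: continuous_expR.
exact: continuousN.
Qed.

Definition rat_enum (n : nat) : R := if unpickle n is Some q then ratr (q : rat) else 0.

(** The supremum over [v] may be restricted to the rationals by continuity, which
makes the Lagrangian a countable supremum and hence measurable. *)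
Lemma lagrangian_esups (a b : R) :
  lagrangian lambda mu a b = esups (fun n => (test_value a b (rat_enum n))%:E) 0%N.
Proof.
apply/eqP; rewrite eq_le; apply/andP; split; last first.
  by apply: ge_ereal_sup => _ [n _ <-]; exact: lagrangian_ge.
apply: ge_ereal_sup => _ [v _ <-]; apply/lee_subgt0Pr => e e0.
have : \forall u \near v, test_value a b v - e < test_value a b u.
  by apply: (cvgr_gt _ (@continuous_test_value a b v)); rewrite gtrBl.
move=> [d /= d0 Hd].
have [q] : exists q : rat, v < ratr q < v + d.
  have : v < v + d by rewrite ltrDl.
  by move=> /rat_in_itvoo[q]; rewrite in_itv/=; exists q.
move=> /andP[vq qd].
have := Hd (ratr q); rewrite /= distrC ger0_norm ?subr_ge0 ?(ltW vq)// ltrBlDl.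
move=> /(_ qd) h; rewrite -EFinB.
apply: (@le_trans _ _ (test_value a b (rat_enum (pickle q)))%:E).
  by rewrite /rat_enum pickleK lee_fin ltW.
by apply: ereal_sup_ubound; exists (pickle q).
Qed.

Lemma measurable_lagrangian d (Z : measurableType d) (D : set Z) (fa fb : Z -> R) :
  measurable_fun D fa -> measurable_fun D fb ->
  measurable_fun D (fun z => lagrangian lambda mu (fa z) (fb z)).
Proof.
move=> ma mb; under eq_fun do rewrite lagrangian_esups.
apply: (measurable_fun_esups (f := fun n z => (test_value (fa z) (fb z) (rat_enum n))%:E)).
move=> n; apply/measurable_EFinP; apply: measurable_funB.
  apply: measurable_funB; first by apply: measurable_funM.
  by apply: measurable_funM => //; apply: measurable_funB.
by apply: measurable_funM.
Qed.

End LagrangianMeasurable.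

(** * Exchanging the order of integration in the action *)

(** The integral of a nonnegative function is a supremum over simple functions
below it, so that monotonicity holds without measurability of the two functions.
The Lagrangian along an arbitrary path is not known to be measurable. *)
Lemma ge0_integral_le d (X : measurableType d) (R : realType)
    (m : {measure set X -> \bar R}) (f g : X -> \bar R) :
  (forall x, 0 <= f x)%E -> (forall x, f x <= g x)%E ->
  (\int[m]_x f x <= \int[m]_x g x)%E.
Proof.
move=> f0 fg; have g0 x : (0 <= g x)%E by exact: le_trans (fg x).
rewrite !ge0_integralTE//; apply: le_ereal_sup => _ [k /= kf <-].
by exists k => // x; exact: le_trans (fg x).
Qed.

Section ActionLowerBound.
Context {R : realType}.
Variables (lambda mu T : R).
Local Notation leb := (@lebesgue_measure R).
Local Notation leb2 := (leb \x leb)%E.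

Lemma measurable_sqr01 : measurable (@sqr01 R).
Proof. by apply: measurableX; exact: measurable_itv. Qed.

Lemma leb2_sigma_finite : sigma_finite setT leb2.
Proof.
have [F TF Foo] := sigma_finiteT leb.
exists (fun n => let nm := odflt (0, 0)%N (unpickle n) in F nm.1 `*` F nm.2).
  apply/seteqP; split => // -[x y] _.
  have : [set: R] x by []. have : [set: R] y by [].
  rewrite TF => -[n _ Fny] [m _ Fmx].
  by exists (pickle (m, n)) => //; rewrite pickleK.
move=> k; case: (odflt _ _) => n m; have [? ?] := Foo n; have [? ?] := Foo m.
split; first exact: measurableX.
rewrite [X in (X < _)%E]product_measure1E// lte_mul_pinfty// ge0_fin_numE//.
Qed.

(** The product measure packed with its sigma-finiteness, as Tonelli's theorem
requires. *)
Definition leb2_sf : {sigma_finite_measure set (measurableTypeR R * measurableTypeR R)%type -> \bar R} :=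
  HB.pack leb2 (@Measure_isSigmaFinite.Build _ _ _ leb2 leb2_sigma_finite).

(** A bound on the action of almost every edge gives a bound on the action of the
path.  The Lagrangian of the path is cut down to the set where the path is
derivable in time, which is jointly measurable once the path is made continuous
in time off the exceptional null set; on this smaller integrand Tonelli's theorem
applies.  The inner bound is stated for every measurable [ell] that dominates the
Lagrangian at derivable times, since that is all that is known of the restricted
integrand. *)
Theorem action_lower_bound (h : R -> R * R -> R) (K : R * R -> \bar R) : 0 < T ->
  gpath T h -> {ae leb2, forall z, sqr01 z -> abs_continuous 0 T (h ^~ z)} ->
  measurable_fun sqr01 K -> (forall z, sqr01 z -> 0 <= K z)%E ->
  (forall z, sqr01 z -> abs_continuous 0 T (h ^~ z) ->
    forall ell : R -> \bar R, measurable_fun `[0, T]%classic ell ->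
    (forall t, 0 <= ell t)%E ->
    (forall t, 0 < t < T -> derivable (h ^~ z) t 1 ->
      (lagrangian lambda mu (h t z) (derive1 (h ^~ z) t) <= ell t)%E) ->
    (K z <= \int[leb]_(t in `[0%R, T]) ell t)%E) ->
  (\int[leb2]_(z in sqr01) K z <= \int[leb]_(t in `[0%R, T])
     \int[leb2]_(z in sqr01) lagrangian lambda mu (h t z) (derive1 (h ^~ z) t))%E.
Proof.
move=> T0 gh [N [mN N0 Nac]] mK K0 HK.
have T0' := ltW T0.
pose X : set (R * R) := sqr01 `\` N.
have mX : measurable X by apply: measurableD => //; exact: measurable_sqr01.
have Xac z : X z -> abs_continuous 0 T (h ^~ z).
  by move=> [z01 Nz]; apply: contrapT => nac; apply: Nz; apply: Nac => /= /(_ z01).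
(* The path, continued constantly in time and set to 0 off the good edges [X]. *)
pose H t := (h (clamp 0 T t)) \_ X.
have HX t z : X z -> H t z = h (clamp 0 T t) z.
  by move=> Xz; rewrite /H patchE mem_set.
have HnX t z : ~ X z -> H t z = 0.
  by move=> Xz; rewrite /H patchE memNset.
have mH t : measurable_fun setT (H t).
  apply/(measurable_restrictT _ mX); apply: measurable_funS (_ : measurable_fun sqr01 _).
  - exact: measurable_sqr01.
  - by move=> z [].
  - by have [] := gh _ (clamp_itv t T0').
have cH z : continuous (H ^~ z).
  have [Xz|Xz] := pselect (X z).
    have -> : H ^~ z = (h ^~ z) \o clamp 0 T by apply/funext => t; rewrite /= HX.
    exact/(continuous_ac_clamp T0')/abs_continuous_seq/Xac.
  have -> : H ^~ z = cst 0 by apply/funext => t; rewrite /= HnX.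
  exact: cst_continuous.
pose G : set (R * (R * R)) := derivable_pts H `&` (`]0, T[%classic `*` X).
have mG : measurable G.
  apply: measurableI; first exact: measurable_derivable_pts.
  by apply: measurableX => //; exact: measurable_itv.
pose B := (fun p : R * (R * R) => lagrangian lambda mu (H p.1 p.2)
  (derive1 (H ^~ p.2) p.1)) \_ G.
have B0 p : (0 <= B p)%E.
  by rewrite /B patchE; case: ifP => // _; exact: lagrangian_ge0.
have mB : measurable_fun setT B.
  apply/(measurable_restrictT _ mG); apply: measurable_lagrangian.
    by apply: measurable_funTS; exact: caratheodory_measurable.
  apply: measurable_funS (measurable_derive1_pts mH cH).
  - exact: measurable_derivable_pts.
  - by move=> p [].
have Hnear t z : 0 < t < T -> X z -> \forall s \near t, H s z = h s z.
  move=> /andP[t0 tT] Xz; near=> s; rewrite HX// clamp_id//.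
  by apply/andP; split; apply: ltW; near: s; [exact: lt_nbhsr|exact: lt_nbhsl].
have Hder t z : 0 < t < T -> X z -> derive1 (H ^~ z) t = derive1 (h ^~ z) t.
  by move=> tT Xz; rewrite !derive1E; exact/near_eq_derive/Hnear.
have BE t z : G (t, z) -> B (t, z) = lagrangian lambda mu (h t z) (derive1 (h ^~ z) t).
  move=> Gtz; rewrite /B patchE mem_set//=; case: Gtz => _ [/=]; rewrite in_itv/= => tT Xz.
  by rewrite Hder// HX// clamp_id//; case/andP: tT => /ltW -> /ltW ->.
apply: (@le_trans _ _ (\int[leb]_t \int[leb2]_z B (t, z))%E); last first.
  rewrite [leRHS]integral_mkcond; apply: ge0_integral_le.
    by move=> t; exact: integral_ge0.
  move=> t; rewrite patchE; case: ifPn => tT.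
    rewrite [leRHS]integral_mkcond; apply: ge0_integral_le => // z.
    have [Gtz|Gtz] := pselect (G (t, z)).
      have z01 : sqr01 z by case: Gtz => _ [_ []].
      by rewrite BE// patchE mem_set.
    rewrite {1}/B patchE memNset// patchE; case: ifP => // _; exact: lagrangian_ge0.
  rewrite integral0_eq// => z _; rewrite /B patchE memNset//.
  move=> [_ [/= ]]; rewrite in_itv/= => /andP[t0 t1] _.
  by move/negP: tT; apply; rewrite inE/= in_itv/= !ltW.
have mB' : measurable_fun
    (setT : set (measurableTypeR R * (measurableTypeR R * measurableTypeR R))) B.
  exact: mB.
rewrite (fubini_tonelli (m1 := leb) (m2 := leb2_sf) B mB' B0).
pose F z := (\int[leb]_t B (t, z))%E.
have mF : measurable_fun setT F := measurable_fun_fubini_tonelli_G (m1 := leb) B mB' B0.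
have F0 z : (0 <= F z)%E by apply: integral_ge0.
apply: (@le_trans _ _ (\int[leb2]_(z in sqr01) F z)%E); last first.
  rewrite integral_mkcond; apply: ge0_integral_le => z; rewrite patchE;
    case: ifP => // _; exact: F0.
apply: ae_ge0_le_integral => //; first exact: measurable_sqr01.
  exact: measurable_funTS.
exists N; split => // z /= /not_implyP[z01 KF]; apply: contrapT => Nz; apply: KF.
have Xz : X z by [].
apply: (@le_trans _ _ (\int[leb]_(t in `[0%R, T]) B (t, z))%E); last first.
  rewrite integral_mkcond; apply: ge0_integral_le => t; rewrite patchE;
    case: ifP => // _; exact: B0.
apply: HK => //; first exact: Xac.
  apply: measurable_funTS; exact: measurable_fun_pair1.
move=> t tT dh; rewrite BE//; split => /=; last by rewrite in_itv/=.
apply: derivable_rational_cauchy.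
apply: near_eq_derivable dh; near=> s; apply/esym; near: s; exact: Hnear.
Unshelve. all: by end_near. Qed.

End ActionLowerBound.

(** * The two-state chain and its tilted paths *)

Section TwoStateChain.
Context {R : realType}.
Variables (lambda mu : R).
Hypotheses (lambda0 : 0 < lambda) (mu0 : 0 < mu).
Local Notation p0 := (p01 lambda mu).
Local Notation p1 := (p11 lambda mu).
Implicit Types (a b s t w x y T : R).

Let kap0 : 0 < lambda + mu. Proof. exact: addr_gt0. Qed.
Let kapN0 : lambda + mu != 0. Proof. by rewrite gt_eqF. Qed.

(** The spectral factor of the chain: [p11 t - p01 t]. *)
Definition decay t : R := expR (- (t * (lambda + mu))).

Lemma decay_gt0 t : 0 < decay t. Proof. exact: expR_gt0. Qed.

Lemma decay_le1 t : 0 <= t -> decay t <= 1.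
Proof. by move=> t0; rewrite -expR0 ler_expR oppr_le0 mulr_ge0// ltW. Qed.

Lemma decay_lt1 t : 0 < t -> decay t < 1.
Proof. by move=> t0; rewrite -expR0 ltr_expR oppr_lt0 mulr_gt0. Qed.

Lemma decayD s t : decay (s + t) = decay s * decay t.
Proof. by rewrite /decay mulrDl opprD expRD. Qed.

Lemma p01E t : p0 t = lambda / (lambda + mu) * (1 - decay t).
Proof. by rewrite /p01 /decay; field. Qed.

Lemma p11E t : 1 - p1 t = mu / (lambda + mu) * (1 - decay t).
Proof. by rewrite /p11 /decay; field. Qed.

Lemma p11Bp01 t : p1 t - p0 t = decay t.
Proof. by rewrite /p11 /p01 /decay; field. Qed.

Lemma p01_at0 : p0 0 = 0.
Proof. by rewrite p01E /decay mul0r oppr0 expR0 subrr mulr0. Qed.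

Lemma p11_at0 : p1 0 = 1.
Proof. by have := p11Bp01 0; rewrite p01_at0 subr0 /decay mul0r oppr0 expR0. Qed.

Lemma p01_ge0 t : 0 <= t -> 0 <= p0 t.
Proof. by move=> t0; rewrite p01E mulr_ge0 ?divr_ge0 ?subr_ge0 ?decay_le1// ltW. Qed.

Lemma p11_le1 t : 0 <= t -> p1 t <= 1.
Proof.
by move=> t0; rewrite -subr_ge0 p11E mulr_ge0 ?divr_ge0 ?subr_ge0 ?decay_le1// ltW.
Qed.

Lemma p01_gt0 t : 0 < t -> 0 < p0 t.
Proof. by move=> t0; rewrite p01E mulr_gt0 ?divr_gt0 ?subr_gt0 ?decay_lt1. Qed.

Lemma p11_lt1 t : 0 < t -> p1 t < 1.
Proof. by move=> t0; rewrite -subr_gt0 p11E mulr_gt0 ?divr_gt0 ?subr_gt0 ?decay_lt1. Qed.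

Lemma p01_ltp11 s t : p0 s < p1 t.
Proof.
apply: (@lt_trans _ _ (lambda / (lambda + mu))).
  by rewrite p01E gtr_pMr ?divr_gt0// gtrBl decay_gt0.
suff : 1 - p1 t < mu / (lambda + mu).
  have -> : lambda / (lambda + mu) = 1 - mu / (lambda + mu) by field.
  by lra.
by rewrite p11E gtr_pMr ?divr_gt0// gtrBl decay_gt0.
Qed.

Lemma p11_gt0 t : 0 <= t -> 0 < p1 t.
Proof. by move=> t0; rewrite (le_lt_trans (p01_ge0 t0))// p01_ltp11. Qed.

Lemma p01_lt1 t : 0 <= t -> p0 t < 1.
Proof. by move=> t0; rewrite (lt_le_trans (p01_ltp11 _ t))// p11_le1. Qed.

Lemma p01_le s t : s <= t -> p0 s <= p0 t.
Proof.
move=> st; have c0 : 0 <= lambda / (lambda + mu) by rewrite divr_ge0// ltW.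
by rewrite !p01E ler_wpM2l// lerB// ler_expR lerN2 ler_wpM2r// ltW.
Qed.

Lemma p11_ge s t : s <= t -> p1 t <= p1 s.
Proof.
move=> st; have c0 : 0 <= mu / (lambda + mu) by rewrite divr_ge0// ltW.
by rewrite -lerN2 -(lerD2l 1) !p11E ler_wpM2l// lerB// ler_expR lerN2 ler_wpM2r// ltW.
Qed.

Lemma is_derive_decay t : is_derive t 1 decay (- (lambda + mu) * decay t).
Proof.
have h : is_derive t 1 (fun t => - (t * (lambda + mu))) (- (lambda + mu)).
  have -> : (fun t : R => - (t * (lambda + mu))) = (- (lambda + mu)) \*: id.
    by apply/funext => u; rewrite /= /GRing.scale/=; ring.
  have := is_deriveZ (- (lambda + mu)) (is_derive_id t (1 : R)).
  by rewrite /GRing.scale/= mulr1.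
have := @is_derive1_comp _ _ _ t _ _ (is_derive_expR _) h.
by rewrite /GRing.scale /= mulrC.
Qed.

Lemma is_derive_p01 t : is_derive t 1 p0 (lambda * decay t).
Proof.
have -> : p0 = (cst (lambda / (lambda + mu)) \- (lambda / (lambda + mu)) \*: decay).
  by apply/funext => u; rewrite p01E /cst/= /GRing.scale/=; ring.
have := is_deriveB (@is_derive_cst _ _ _ (lambda / (lambda + mu)) t 1)
  (is_deriveZ (lambda / (lambda + mu)) (is_derive_decay t)).
by congr is_derive; rewrite /GRing.scale/=; field.
Qed.

Lemma is_derive_p11 t : is_derive t 1 p1 (- (mu * decay t)).
Proof.
have -> : p1 = p0 \+ decay by apply/funext => u; rewrite /= -p11Bp01; ring.
have := is_deriveD (is_derive_p01 t) (is_derive_decay t).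
by congr is_derive; ring.
Qed.

(** The solution of the backward equation with final weights [x0], [x1]: the
expected final weight of an edge that is absent ([psi0]) or present ([psi1]) with
time [t] left. *)
Definition psi0 x0 x1 t : R := (1 - p0 t) * x0 + p0 t * x1.
Definition psi1 x0 x1 t : R := (1 - p1 t) * x0 + p1 t * x1.

Lemma psi1Bpsi0 x0 x1 t : psi1 x0 x1 t - psi0 x0 x1 t = decay t * (x1 - x0).
Proof. by rewrite /psi1 /psi0 -p11Bp01; ring. Qed.

Lemma psi0_gt0 x0 x1 t : 0 < x0 -> 0 <= x1 -> 0 <= t -> 0 < psi0 x0 x1 t.
Proof.
move=> x00 x10 t0; rewrite /psi0 ltr_pwDl//.
  by rewrite mulr_gt0// subr_gt0 p01_lt1.
by rewrite mulr_ge0// p01_ge0.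
Qed.

Lemma psi1_gt0 x0 x1 t : 0 <= x0 -> 0 < x1 -> 0 <= t -> 0 < psi1 x0 x1 t.
Proof.
move=> x00 x10 t0; rewrite /psi1 ltr_wpDl//.
  by rewrite mulr_ge0// subr_ge0 p11_le1.
by rewrite mulr_gt0// p11_gt0.
Qed.

Lemma psi_gt0 x0 x1 t : 0 <= x0 -> 0 <= x1 -> 0 < x0 + x1 -> 0 < t ->
  0 < psi0 x0 x1 t /\ 0 < psi1 x0 x1 t.
Proof.
move=> x00 x10 x t0; have t0' := ltW t0.
have := p01_gt0 t0; have := p11_lt1 t0; have := p11_gt0 t0'; have := p01_lt1 t0'.
rewrite /psi0 /psi1; move: (p0 t) (p1 t) => u v h1 h2 h3 h4.
case: (ltgtP 0 x0) x00 x => // [x0p|<-] _ x.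
  by split; apply: ltr_pwDl; [apply: mulr_gt0; lra|apply: mulr_ge0; lra
    |apply: mulr_gt0; lra|apply: mulr_ge0; lra].
have x1p : 0 < x1 by lra.
by split; rewrite mulr0 add0r mulr_gt0.
Qed.

Lemma psi_gt0' x0 x1 t : 0 < x0 -> 0 < x1 -> 0 <= t ->
  0 < psi0 x0 x1 t /\ 0 < psi1 x0 x1 t.
Proof.
by move=> x00 x10 t0; split; [apply: psi0_gt0 => //|apply: psi1_gt0 => //]; exact: ltW.
Qed.

(** The semigroup property of the backward equation. *)
Lemma psi0D x0 x1 s t :
  psi0 x0 x1 (s + t) = (1 - p0 s) * psi0 x0 x1 t + p0 s * psi1 x0 x1 t.
Proof.
have -> : psi1 x0 x1 t = psi0 x0 x1 t + decay t * (x1 - x0) by rewrite -psi1Bpsi0; ring.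
by rewrite /psi0 !p01E decayD; ring.
Qed.

Lemma psi1D x0 x1 s t :
  psi1 x0 x1 (s + t) = (1 - p1 s) * psi0 x0 x1 t + p1 s * psi1 x0 x1 t.
Proof.
have h u : p1 u = p0 u + decay u by rewrite -p11Bp01; ring.
have -> : psi1 x0 x1 t = psi0 x0 x1 t + decay t * (x1 - x0) by rewrite -psi1Bpsi0; ring.
by rewrite /psi0 /psi1 !h !p01E decayD; field.
Qed.

Lemma is_derive_psi0 x0 x1 t :
  is_derive t 1 (psi0 x0 x1) (lambda * (psi1 x0 x1 t - psi0 x0 x1 t)).
Proof.
rewrite psi1Bpsi0; have -> : psi0 x0 x1 = (cst x0 \+ (x1 - x0) \*: p0).
  by apply/funext => u; rewrite /psi0 /cst/= /GRing.scale/=; ring.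
have := is_deriveD (@is_derive_cst _ _ _ x0 t 1)
  (is_deriveZ (x1 - x0) (is_derive_p01 t)).
by congr is_derive; rewrite /GRing.scale/=; ring.
Qed.

Lemma is_derive_psi1 x0 x1 t :
  is_derive t 1 (psi1 x0 x1) (- (mu * (psi1 x0 x1 t - psi0 x0 x1 t))).
Proof.
rewrite psi1Bpsi0; have -> : psi1 x0 x1 = (cst x0 \+ (x1 - x0) \*: p1).
  by apply/funext => u; rewrite /psi1 /cst/= /GRing.scale/=; ring.
have := is_deriveD (@is_derive_cst _ _ _ x0 t 1)
  (is_deriveZ (x1 - x0) (is_derive_p11 t)).
by congr is_derive; rewrite /GRing.scale/=; ring.
Qed.

(** The value at [e^v = x1 / x0] of the function whose supremum is [rate1 T a b],
written homogeneously so that either weight may vanish. *)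
Definition cost x0 x1 T a b : R :=
  b * ln x1 + (1 - b) * ln x0 - a * ln (psi1 x0 x1 T) - (1 - a) * ln (psi0 x0 x1 T).

(** The density at time [t] under the chain tilted by the final weights, started
with density [a]: the first term counts the edges present at time 0, the second
those absent at time 0. *)
Definition phi x0 x1 T a t : R :=
  a * p1 t * psi1 x0 x1 (T - t) / psi1 x0 x1 T +
  (1 - a) * p0 t * psi1 x0 x1 (T - t) / psi0 x0 x1 T.

Lemma ln_le_sub1 (y : R) : 0 < y -> ln y <= y - 1.
Proof. by move=> y0; rewrite lerBrDr addrC -[leRHS](lnK y0) expR_ge1Dx. Qed.

Lemma expR_le_quad w : w <= 1 / 2 -> expR w <= 1 + w + 2 * w ^+ 2.
Proof.
move=> w12; have h : 0 < 1 - w by lra.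
have : expR w <= (1 - w)^-1.
  by rewrite -[leLHS]invrK -expRN lef_pV2 ?posrE ?expR_gt0// expR_ge1Dx.
move=> /le_trans; apply; rewrite -div1r ler_pdivrMr//.
have -> : (1 + w + 2 * w ^+ 2) * (1 - w) = 1 + w ^+ 2 * (1 - 2 * w) by ring.
by rewrite lerDl mulr_ge0 ?sqr_ge0//; lra.
Qed.

Lemma phi01 x0 x1 T a t : 0 <= a <= 1 -> 0 <= t <= T ->
  0 < psi1 x0 x1 T -> 0 < psi0 x0 x1 T -> 0 <= x0 -> 0 <= x1 ->
  0 <= phi x0 x1 T a t <= 1.
Proof.
move=> /andP[a0 a1] /andP[t0 tT] h1 h0 x00 x10.
have Tt : 0 <= T - t by rewrite subr_ge0.
have q0 : 0 <= psi0 x0 x1 (T - t).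
  by rewrite addr_ge0// mulr_ge0// ?subr_ge0 ?p01_ge0// ltW// p01_lt1.
have q1 : 0 <= psi1 x0 x1 (T - t).
  by rewrite addr_ge0// mulr_ge0// ?subr_ge0 ?p11_le1// ltW// p11_gt0.
have e1 := psi1D x0 x1 t (T - t); have e0 := psi0D x0 x1 t (T - t).
rewrite addrC subrK in e1 e0.
have r1 : p1 t * psi1 x0 x1 (T - t) / psi1 x0 x1 T <= 1.
  by rewrite ler_pdivrMr// mul1r e1 lerDr mulr_ge0// subr_ge0 p11_le1.
have r0 : p0 t * psi1 x0 x1 (T - t) / psi0 x0 x1 T <= 1.
  by rewrite ler_pdivrMr// mul1r e0 lerDr mulr_ge0// subr_ge0 ltW// p01_lt1.
have r1' : 0 <= p1 t * psi1 x0 x1 (T - t) / psi1 x0 x1 T.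
  by apply: divr_ge0; [apply: mulr_ge0 => //; exact/ltW/p11_gt0|exact: ltW].
have r0' : 0 <= p0 t * psi1 x0 x1 (T - t) / psi0 x0 x1 T.
  by apply: divr_ge0; [apply: mulr_ge0 => //; exact: p01_ge0|exact: ltW].
have -> : phi x0 x1 T a t = a * (p1 t * psi1 x0 x1 (T - t) / psi1 x0 x1 T) +
  (1 - a) * (p0 t * psi1 x0 x1 (T - t) / psi0 x0 x1 T) by rewrite /phi; ring.
move: r1 r0 r1' r0'; move: (_ / _) (_ / _) => u v u1 v1 u0 v0.
apply/andP; split; first by rewrite addr_ge0// mulr_ge0// subr_ge0.
by nra.
Qed.

(** Passing through density [s] at time [t] costs more than the unconstrained
bound, by an amount quadratic in the distance to the tilted path.  On [0, t] the
final weights are the backward functions at time [t], with the weight of a present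
edge multiplied by [expR w]: the first-order gain is [(s - f) * w], and the
second-order loss at most [2 * w ^+ 2]. *)
Lemma cost_split x0 x1 T a b s t : 0 < x0 -> 0 < x1 -> 0 <= a <= 1 -> 0 <= s <= 1 ->
  0 <= t <= T -> exists y0 y1, [/\ 0 < y0, 0 < y1 &
    cost x0 x1 T a b + (s - phi x0 x1 T a t) ^+ 2 / 8 <=
      cost y0 y1 t a s + cost x0 x1 (T - t) s b].
Proof.
move=> x00 x10 a01 s01 tT; have /andP[t0 tT'] := tT.
have T0 : 0 <= T by exact: le_trans tT'.
have Tt : 0 <= T - t by rewrite subr_ge0.
have [h0 h1] := psi_gt0' x00 x10 T0; have [q0 q1] := psi_gt0' x00 x10 Tt.
have f01 := phi01 a01 tT h1 h0 (ltW x00) (ltW x10).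
have e1 := psi1D x0 x1 t (T - t); have e0 := psi0D x0 x1 t (T - t).
rewrite addrC subrK in e1 e0.
set f := phi x0 x1 T a t in f01 *.
(* This value maximises [(s - f) * w - 2 * w ^+ 2]. *)
pose w := (s - f) / 4.
exists (psi0 x0 x1 (T - t)), (psi1 x0 x1 (T - t) * expR w).
split => //; first by rewrite mulr_gt0// expR_gt0.
set u1 := p1 t * psi1 x0 x1 (T - t) / psi1 x0 x1 T.
set u0 := p0 t * psi1 x0 x1 (T - t) / psi0 x0 x1 T.
have fE : f = a * u1 + (1 - a) * u0 by rewrite /f /phi /u1 /u0; ring.
have E1 : psi1 (psi0 x0 x1 (T - t)) (psi1 x0 x1 (T - t) * expR w) t =
    psi1 x0 x1 T * (1 + u1 * (expR w - 1)).
  rewrite [LHS]/psi1 /u1; have := gt_eqF h1; move: e1.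
  by move: (psi1 x0 x1 T) => z -> zn; field; rewrite zn.
have E0 : psi0 (psi0 x0 x1 (T - t)) (psi1 x0 x1 (T - t) * expR w) t =
    psi0 x0 x1 T * (1 + u0 * (expR w - 1)).
  rewrite [LHS]/psi0 /u0; have := gt_eqF h0; move: e0.
  by move: (psi0 x0 x1 T) => z -> zn; field; rewrite zn.
have qe : 0 < psi1 x0 x1 (T - t) * expR w by rewrite mulr_gt0// expR_gt0.
have [g0 g1] := psi_gt0' q0 qe t0.
rewrite E1 pmulr_rgt0// in g1; rewrite E0 pmulr_rgt0// in g0.
have ew : expR w <= 1 + w + 2 * w ^+ 2.
  by apply: expR_le_quad; rewrite /w; case/andP: s01; case/andP: f01; lra.
rewrite /cost E1 E0 !lnM ?posrE ?expR_gt0// expRK.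
have l1 := ln_le_sub1 g1; have l0 := ln_le_sub1 g0.
set A := ln (psi1 x0 x1 T); set B := ln (psi0 x0 x1 T).
set C := ln (psi1 x0 x1 (T - t)); set D := ln (psi0 x0 x1 (T - t)).
move: l1 l0; set L1 := ln (1 + _); set L0 := ln (1 + _) => l1 l0.
have k : a * L1 + (1 - a) * L0 <= f * (expR w - 1).
  have -> : f * (expR w - 1) = a * (u1 * (expR w - 1)) + (1 - a) * (u0 * (expR w - 1)).
    by rewrite fE; ring.
  by case/andP: a01 => a0 a1; apply: lerD; apply: ler_wpM2l; lra.
have k2 : f * (expR w - 1) <= f * w + 2 * w ^+ 2.
  case/andP: f01 => f0 f1.
  have : f * (expR w - 1) <= f * (w + 2 * w ^+ 2) by rewrite ler_wpM2l//; lra.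
  by have := sqr_ge0 w; nra.
have k3 : (s - f) ^+ 2 / 8 = s * w - f * w - 2 * w ^+ 2 by rewrite /w; field.
lra.
Qed.

End TwoStateChain.

Section OptimalWeights.
Context {R : realType}.
Variables (lambda mu : R).
Hypotheses (lambda0 : 0 < lambda) (mu0 : 0 < mu).
Local Notation p0 := (p01 lambda mu).
Local Notation p1 := (p11 lambda mu).
Local Notation psi0 := (psi0 lambda mu).
Local Notation psi1 := (psi1 lambda mu).
Local Notation cost := (cost lambda mu).
Local Notation phi := (phi lambda mu).
Implicit Types (a b s t w x y T : R).

(** The critical point of the cost in the weights: the tilted path ends at [b].
The last condition records that the weights are positive except at the extreme
values of [b]. *)
Definition optimal_weights x0 x1 T a b : Prop :=
  [/\ 0 <= x0, 0 <= x1, x0 + x1 = 1, phi x0 x1 T a T = b &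
      (b < 1 -> 0 < x0) /\ (0 < b -> 0 < x1)].

Lemma psi0_at0 x0 x1 : psi0 x0 x1 0 = x0.
Proof. by rewrite /psi0 p01_at0// subr0 mul1r mul0r addr0. Qed.

Lemma psi1_at0 x0 x1 : psi1 x0 x1 0 = x1.
Proof. by rewrite /psi1 p11_at0// subrr mul1r mul0r add0r. Qed.

(** The endpoint of the tilted path moves continuously from 0 to 1 with the weight
[x1], so the intermediate value theorem applies. *)
Lemma exists_optimal_weights T a b : 0 < T -> 0 <= a <= 1 -> 0 <= b <= 1 ->
  exists x0 x1, optimal_weights x0 x1 T a b.
Proof.
move=> T0 a01 b01; have T0' := ltW T0.
have P y : 0 <= y <= 1 -> 0 < psi0 (1 - y) y T /\ 0 < psi1 (1 - y) y T.
  by move=> /andP[y0 y1]; apply: psi_gt0; rewrite ?subr_ge0 ?subrK.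
pose k y := phi (1 - y) y T a T.
have cpsi1 : continuous (fun y => psi1 (1 - y) y T).
  move=> y; apply: cvgD; (apply: cvgM; first exact: cvg_cst); last exact: cvg_id.
  by apply: cvgB; [exact: cvg_cst|exact: cvg_id].
have cpsi0 : continuous (fun y => psi0 (1 - y) y T).
  move=> y; apply: cvgD; (apply: cvgM; first exact: cvg_cst); last exact: cvg_id.
  by apply: cvgB; [exact: cvg_cst|exact: cvg_id].
have kE y : k y = a * p1 T * y / psi1 (1 - y) y T + (1 - a) * p0 T * y / psi0 (1 - y) y T.
  by rewrite /k /phi subrr psi1_at0.
have ck : {within `[0, 1], continuous k}.
  apply: continuous_in_subspaceT => y; rewrite inE/= in_itv/= => y01.
  have [h0 h1] := P y y01.
  have -> : k = fun y => a * p1 T * y / psi1 (1 - y) y T + (1 - a) * p0 T * y / psi0 (1 - y) y T.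
    exact/funext.
  apply: cvgD; apply: cvgM; try (by apply: cvgM; [exact: cvg_cst|exact: cvg_id]).
    by apply: cvgV; [rewrite gt_eqF|exact: cpsi1].
  by apply: cvgV; [rewrite gt_eqF|exact: cpsi0].
have k0 : k 0 = 0 by rewrite kE; ring.
have k1 : k 1 = 1.
  have [] := P 1; first by rewrite ler01 lexx.
  rewrite kE /psi1 /psi0 subrr !mulr0 !mulr1 !add0r => h0 h1.
  by field; rewrite !gt_eqF.
have [|y] := IVT ler01 ck (v := b).
  by rewrite k0 k1 min_l ?max_r.
rewrite in_itv/= => /andP[y0 y1] ky.
exists (1 - y), y; split => //; rewrite ?subr_ge0 ?subrK//; split.
  move=> b1; rewrite subr_gt0 lt_neqAle y1 andbT; apply: contraTN b1 => /eqP yE.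
  by rewrite -ky yE k1 ltxx.
move=> b0; rewrite lt_neqAle y0 andbT; apply: contraTN b0 => /eqP yE.
by rewrite -ky -yE k0 ltxx.
Qed.

Lemma optimal_weights_psi_gt0 x0 x1 T a b t : optimal_weights x0 x1 T a b -> 0 < t ->
  0 < psi0 x0 x1 t /\ 0 < psi1 x0 x1 t.
Proof.
by move=> [h0 h1 h2 _ _] t0; apply: psi_gt0 => //; rewrite h2.
Qed.

(** Bounds proved for positive weights extend to the optimal ones, which may lie on
the boundary.  The cost stays continuous there because a logarithm of a vanishing
weight is multiplied by the coefficient 0. *)
Lemma cost_limit x0 x1 T a b t s (V : \bar R) : 0 < T -> 0 <= a <= 1 -> 0 <= b <= 1 ->
  optimal_weights x0 x1 T a b ->
  (forall y0 y1, 0 < y0 -> 0 < y1 ->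
    ((cost y0 y1 T a b + (s - phi y0 y1 T a t) ^+ 2 / 8)%:E <= V)%E) ->
  ((cost x0 x1 T a b + (s - phi x0 x1 T a t) ^+ 2 / 8)%:E <= V)%E.
Proof.
move=> T0 a01 /andP[b0 b1] opt; have [g0 g1] := optimal_weights_psi_gt0 opt T0.
have [x00 x10 _ _ [b1x b0x]] := opt.
case: V => [r| |]//; last 2 first.
  by move=> _; rewrite leey.
  by move=> /(_ 1 1 ltr01 ltr01).
move=> H; rewrite lee_fin leNgt; apply/negP => lt.
(* Both weights are perturbed by [e], which makes them positive. *)
pose F e := cost (x0 + e) (x1 + e) T a b + (s - phi (x0 + e) (x1 + e) T a t) ^+ 2 / 8.
have cD x : {for 0, continuous (fun e => x + e)}.
  by apply: cvgD; [exact: cvg_cst|exact: cvg_id].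
have cpsi1 u : {for 0, continuous (fun e => psi1 (x0 + e) (x1 + e) u)}.
  by apply: cvgD; (apply: cvgM; first exact: cvg_cst); exact: cD.
have cpsi0 u : {for 0, continuous (fun e => psi0 (x0 + e) (x1 + e) u)}.
  by apply: cvgD; (apply: cvgM; first exact: cvg_cst); exact: cD.
have cln (g : R -> R) : {for 0, continuous g} -> 0 < g 0 ->
    {for 0, continuous (fun e => ln (g e))}.
  by move=> cg gp; apply: (@continuous_comp _ _ _ g (@ln R)) => //; exact: continuous_ln.
have cb : {for 0, continuous (fun e => b * ln (x1 + e))}.
  case: (ltgtP 0 b) b0 => // [b0' _|<- _].
    by apply: cvgM; [exact: cvg_cst|apply: cln => //; rewrite addr0 b0x].
  by apply: cvg_near_cst; apply: nearW => e; rewrite !mul0r.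
have cb' : {for 0, continuous (fun e => (1 - b) * ln (x0 + e))}.
  case: (ltgtP b 1) b1 => // [b1' _|-> _].
    by apply: cvgM; [exact: cvg_cst|apply: cln => //; rewrite addr0 b1x].
  by apply: cvg_near_cst; apply: nearW => e; rewrite subrr !mul0r.
have g1' : 0 < psi1 (x0 + 0) (x1 + 0) T by rewrite !addr0.
have g0' : 0 < psi0 (x0 + 0) (x1 + 0) T by rewrite !addr0.
have cphi : {for 0, continuous (fun e => phi (x0 + e) (x1 + e) T a t)}.
  apply: cvgD; apply: cvgM; try (by apply: cvgM; [exact: cvg_cst|exact: cpsi1]).
    by apply: cvgV; [rewrite gt_eqF|exact: cpsi1].
  by apply: cvgV; [rewrite gt_eqF|exact: cpsi0].
have cF : {for 0, continuous F}.
  apply: cvgD.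
    apply: cvgB.
      apply: cvgB; first by apply: cvgD; [exact: cb|exact: cb'].
      by apply: cvgM; [exact: cvg_cst|exact: cln].
    by apply: cvgM; [exact: cvg_cst|exact: cln].
  apply: cvgM; last exact: cvg_cst.
  have cB : {for 0, continuous (fun e => s - phi (x0 + e) (x1 + e) T a t)}.
    by apply: cvgB; [exact: cvg_cst|exact: cphi].
  by apply: cvgM; exact: cB.
have F0 : r < F 0 by rewrite /F !addr0.
have := cvgr_gt _ cF _ F0; move=> [d /= d0 Hd].
have := Hd (d / 2); rewrite /= sub0r normrN gtr0_norm ?divr_gt0//.
rewrite ltr_pdivrMr// ltr_pMr// ltr1n => /(_ isT).
by rewrite ltNge; have := H (x0 + d / 2) (x1 + d / 2);
   rewrite lee_fin => -> //; rewrite ltr_wpDl// divr_gt0.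
Qed.

Lemma rate1_ge_cost t a s y0 y1 : 0 < y0 -> 0 < y1 -> 0 <= t ->
  ((cost y0 y1 t a s)%:E <= rate1 lambda mu t a s)%E.
Proof.
move=> y00 y10 t0; apply: ereal_sup_ubound; exists (ln (y1 / y0)) => //.
have [g0 g1] := psi_gt0' lambda0 mu0 y00 y10 t0.
congr EFin; rewrite lnK ?posrE ?divr_gt0//.
have -> : 1 - p1 t + y1 / y0 * p1 t = psi1 y0 y1 t / y0.
  by rewrite /psi1; field; rewrite gt_eqF.
have -> : 1 - p0 t + y1 / y0 * p0 t = psi0 y0 y1 t / y0.
  by rewrite /psi0; field; rewrite gt_eqF.
by rewrite !ln_div ?posrE// /cost; ring.
Qed.

Lemma rate1_le t a s (V : \bar R) :
  (forall y1, 0 < y1 -> ((cost 1 y1 t a s)%:E <= V)%E) ->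
  (rate1 lambda mu t a s <= V)%E.
Proof.
move=> H; apply: ge_ereal_sup => _ [v _ <-].
apply: le_trans (H (expR v) (expR_gt0 v)); rewrite lee_fin le_eqVlt; apply/orP; left.
rewrite /cost /psi1 /psi0 expRK ln1 mulr0 addr0 !mulr1; apply/eqP.
by rewrite [p1 t * _]mulrC [p0 t * _]mulrC; ring.
Qed.

(** The objective minimised by [fstar] inherits the quadratic gain of [cost_split]. *)
Lemma rate1_split_ge x0 x1 T a b t s : 0 < T -> 0 <= a <= 1 -> 0 <= b <= 1 ->
  0 <= s <= 1 -> 0 <= t <= T -> optimal_weights x0 x1 T a b ->
  ((cost x0 x1 T a b + (s - phi x0 x1 T a t) ^+ 2 / 8)%:E
    <= fstar_objective lambda mu T a b t s)%E.
Proof.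
move=> T0 a01 b01 s01 tT opt; apply: (cost_limit T0 a01 b01 opt) => z0 z1 z00 z10.
have [y0 [y1 [y00 y10 H]]] := cost_split lambda0 mu0 b z00 z10 a01 s01 tT.
have /andP[t0 tT'] := tT.
apply: (@le_trans _ _ ((cost y0 y1 t a s)%:E + (cost z0 z1 (T - t) s b)%:E)%E).
  by rewrite -EFinD lee_fin.
by apply: leeD; apply: rate1_ge_cost => //; rewrite subr_ge0.
Qed.

Lemma rate1_ge0 t a s : (0 <= rate1 lambda mu t a s)%E.
Proof.
apply: ereal_sup_ubound; exists 0 => //; congr EFin.
by rewrite expR0 !mul1r !subrK ln1; ring.
Qed.

End OptimalWeights.

(** * Lower bound and stability of the cost of one edge *)

Section LowerBoundAlongPaths.
Context {R : realType}.
Variables (lambda mu : R).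
Hypotheses (lambda0 : 0 < lambda) (mu0 : 0 < mu).
Local Notation leb := (@lebesgue_measure R).
Local Notation psi0 := (psi0 lambda mu).
Local Notation psi1 := (psi1 lambda mu).
Local Notation cost := (cost lambda mu).
Local Notation phi := (phi lambda mu).
Local Notation lagr := (lagrangian lambda mu).
Implicit Types (a b s t w x y T : R) (f : R -> R) (ell : R -> \bar R).

(** The only link between [ell] and the Lagrangian that survives the measurable
cut-off in [action_lower_bound]. *)
Definition dominates_lagrangian s t f ell : Prop :=
  [/\ measurable_fun `[s, t]%classic ell, (forall u, 0 <= ell u)%E &
    forall u, s < u < t -> derivable f u 1 -> (lagr (f u) (derive1 f u) <= ell u)%E].

Lemma psi_bounds x0 x1 t : 0 < x0 -> 0 < x1 -> 0 <= t ->
  [/\ Num.min x0 x1 <= psi0 x0 x1 t, Num.min x0 x1 <= psi1 x0 x1 t &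
     `|psi1 x0 x1 t - psi0 x0 x1 t| <= x0 + x1].
Proof.
move=> x00 x10 t0.
have := p01_ge0 lambda0 mu0 t0; have := p11_le1 lambda0 mu0 t0.
have := p11_gt0 lambda0 mu0 t0; have := p01_lt1 lambda0 mu0 t0.
rewrite psi1Bpsi0// /psi0 /psi1.
have := decay_gt0 lambda mu t; have := decay_le1 lambda0 mu0 t0.
move: (decay _ _ _) (p01 _ _ _) (p11 _ _ _) => e u v e1 e0 u1 v0 v1 u0.
split; first by case: (leP x0 x1) => h; nra.
  by case: (leP x0 x1) => h; nra.
rewrite normrM gtr0_norm//; apply: (@le_trans _ _ (1 * `|x1 - x0|)).
  by rewrite ler_wpM2r.
rewrite mul1r (le_trans (ler_normB _ _))// !gtr0_norm//; lra.
Qed.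

Lemma is_derive_rev (g : R -> R) (t u dg : R) :
  is_derive (t - u) 1 g dg -> is_derive u 1 (fun v => g (t - v)) (- dg).
Proof.
move=> gd; have h : is_derive u 1 (fun v : R => t - v) (-1).
  by have := is_deriveB (is_derive_cst t u (1 : R)) (is_derive_id u (1 : R)); rewrite sub0r.
by have := @is_derive1_comp _ _ _ u _ _ gd h; rewrite mulrN1.
Qed.

Lemma is_derive_ln_comp (g : R -> R) (u dg : R) : 0 < g u ->
  is_derive u 1 g dg -> is_derive u 1 (fun v => ln (g v)) (dg / g u).
Proof.
move=> g0 gd.
by have := @is_derive1_comp _ _ _ u _ _ (is_derive1_ln g0) gd; rewrite mulrC.
Qed.

(** Verification with the logarithms of the backward functions.  The test value
[v = ln (psi1 / psi0)] in the supremum defining the Lagrangian is exactly the total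
derivative of [f * ln psi1 + (1 - f) * ln psi0] along the path. *)
Lemma path_cost_le s t x0 x1 f ell : s <= t -> ac_seq s t f ->
  (forall u, s <= u <= t -> 0 <= f u <= 1) -> 0 < x0 -> 0 < x1 ->
  dominates_lagrangian s t f ell ->
  ((cost x0 x1 (t - s) (f s) (f t))%:E <= \int[leb]_(u in `[s, t]) ell u)%E.
Proof.
move=> st acf f01 x00 x10 [mell ell0 Hell].
have rev u : s <= u <= t -> 0 <= t - u by move=> /andP[_ ut]; rewrite subr_ge0.
pose d u := psi1 x0 x1 (t - u) - psi0 x0 x1 (t - u).
pose G1 u := ln (psi1 x0 x1 (t - u)); pose G0 u := ln (psi0 x0 x1 (t - u)).
pose dG1 u := mu * d u / psi1 x0 x1 (t - u).
pose dG0 u := - (lambda * d u) / psi0 x0 x1 (t - u).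
pose M := (lambda + mu) * (x0 + x1) / Num.min x0 x1.
have m0 : 0 < Num.min x0 x1 by rewrite lt_min x00.
have pos u : s <= u <= t -> 0 < psi0 x0 x1 (t - u) /\ 0 < psi1 x0 x1 (t - u).
  by move=> /rev; exact: psi_gt0'.
have bound c u q : 0 <= c <= lambda + mu -> s <= u <= t -> Num.min x0 x1 <= q ->
    `|c * d u / q| <= M.
  move=> /andP[c0 c1] sut mq; have [_ _ db] := psi_bounds x00 x10 (rev _ sut).
  have q0 : 0 < q by exact: lt_le_trans mq.
  rewrite !normrM normfV (ger0_norm c0) (gtr0_norm q0).
  apply: ler_pM; rewrite ?mulr_ge0 ?invr_ge0 ?(ltW q0)//.
    by apply: ler_pM.
  by rewrite lef_pV2.
have l0 := ltW lambda0; have m0' := ltW mu0.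
have := @verification _ s t f G1 dG1 G0 dG0 M ell st acf f01.
have -> : f t * G1 t + (1 - f t) * G0 t - (f s * G1 s + (1 - f s) * G0 s) =
    cost x0 x1 (t - s) (f s) (f t).
  by rewrite /G1 /G0 subrr psi0_at0// psi1_at0// /cost; ring.
apply => //.
- move=> u sut; apply: is_derive_ln_comp; first by have [] := pos u sut.
  have := is_derive_rev (@is_derive_psi1 R lambda mu lambda0 mu0 x0 x1 (t - u)).
  by rewrite opprK.
- move=> u sut; apply: bound => //; first by rewrite m0' lerDr.
  by have [] := psi_bounds x00 x10 (rev _ sut).
- move=> u sut; apply: is_derive_ln_comp; first by have [] := pos u sut.
  exact: is_derive_rev (@is_derive_psi0 R lambda mu lambda0 mu0 x0 x1 (t - u)).
- move=> u sut; rewrite /dG0 mulNr normrN; apply: bound => //.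
    by rewrite l0 lerDl.
  by have [] := psi_bounds x00 x10 (rev _ sut).
- move=> u /andP[su ut] df fd.
  have sut : s <= u <= t by rewrite !ltW.
  have [g0 g1] := pos u sut.
  have fdv : derivable f u 1 by case: fd.
  apply: le_trans (Hell u _ fdv); last by rewrite su.
  have -> : derive1 f u = df by rewrite derive1E derive_val.
  apply: le_trans (lagrangian_ge lambda mu (f u) df (G1 u - G0 u)).
  rewrite lee_fin /test_value opprB.
  have e1 : expR (G1 u - G0 u) = psi1 x0 x1 (t - u) / psi0 x0 x1 (t - u).
    by rewrite /G1 /G0 -ln_div ?posrE// lnK// posrE divr_gt0.
  have e0 : expR (G0 u - G1 u) = psi0 x0 x1 (t - u) / psi1 x0 x1 (t - u).
    by rewrite /G1 /G0 -ln_div ?posrE// lnK// posrE divr_gt0.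
  rewrite e1 e0 /dG1 /dG0 /d le_eqVlt; apply/orP; left; apply/eqP.
  by field; rewrite !gt_eqF.
Qed.

Lemma integral_itv_split s t T ell : s <= t -> t <= T ->
  measurable_fun `[s, T]%classic ell -> (forall u, 0 <= ell u)%E ->
  (\int[leb]_(u in `[s, T]) ell u =
   \int[leb]_(u in `[s, t]) ell u + \int[leb]_(u in `[t, T]) ell u)%E.
Proof.
move=> st tT mell ell0.
have E : `[s, T]%classic = `[s, t[%classic `|` `[t, T]%classic.
  apply/seteqP; split => u /=; rewrite !in_itv/=.
    move=> /andP[su uT]; case: (ltP u t) => h; [left|right]; by rewrite ?su ?h ?uT.
  move=> [/andP[su ut]|/andP[tu uT]]; last by rewrite uT (le_trans st).
  by rewrite su (le_trans (ltW ut)).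
rewrite E ge0_integral_setU//=; first last.
- apply/disj_setPS => u /= []; rewrite !in_itv/= => /andP[_ ut] /andP[tu _].
  by move: ut; rewrite ltNge tu.
- by move: mell; rewrite E.
congr (_ + _)%E; rewrite integral_itv_bndo_bndc//.
apply: measurable_funS mell => //; apply: subset_itvl.
by rewrite bnd_simp.
Qed.

Lemma dominates_lagrangianS s t s' t' f ell : s <= s' -> t' <= t ->
  dominates_lagrangian s t f ell -> dominates_lagrangian s' t' f ell.
Proof.
move=> ss tt [m h0 H]; split => //.
  apply: measurable_funS m => //; apply: subset_itvScc => //.
by move=> u /andP[su ut]; apply: H; rewrite (le_lt_trans ss)// (lt_le_trans ut).
Qed.

Lemma ac_seqS s t s' t' f : s <= s' -> t' <= t -> ac_seq s t f -> ac_seq s' t' f.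
Proof.
move=> ss tt acf e /acf[d d0 H]; exists d => // q qst; apply: H.
apply: sub_all qst => I /and3P[h1 h2 h3]; rewrite /subinterval h2.
by rewrite (le_trans ss h1) (le_trans h3 tt).
Qed.

(** The bound [path_cost_le] on both sides of the time [t], with the weights of
[cost_split]. *)
Theorem path_cost_stability T f ell x0 x1 t : 0 < T -> ac_seq 0 T f ->
  (forall u, 0 <= u <= T -> 0 <= f u <= 1) -> dominates_lagrangian 0 T f ell ->
  optimal_weights lambda mu x0 x1 T (f 0) (f T) -> 0 <= t <= T ->
  ((cost x0 x1 T (f 0) (f T) + (f t - phi x0 x1 T (f 0) t) ^+ 2 / 8)%:E
     <= \int[leb]_(u in `[0%R, T]) ell u)%E.
Proof.
move=> T0 acf f01 dom opt tT; have T0' := ltW T0; have /andP[t0 tT'] := tT.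
have f0 : 0 <= f 0 <= 1 by apply: f01; rewrite lexx.
have fT : 0 <= f T <= 1 by apply: f01; rewrite lexx T0'.
apply: (cost_limit lambda0 mu0 T0 f0 fT opt) => z0 z1 z00 z10.
have [y0 [y1 [y00 y10 H]]] := cost_split lambda0 mu0 (f T) z00 z10 f0 (f01 _ tT) tT.
apply: (@le_trans _ _ ((cost y0 y1 t (f 0) (f t))%:E + (cost z0 z1 (T - t) (f t) (f T))%:E)%E).
  by rewrite -EFinD lee_fin.
have [m h0 _] := dom; rewrite (integral_itv_split t0 tT' m h0); apply: leeD.
- have := @path_cost_le 0 t y0 y1 f ell t0; rewrite subr0; apply => //.
  + exact: ac_seqS acf.
  + by move=> u /andP[u0 ut]; apply: f01; rewrite u0 (le_trans ut).
  + exact: dominates_lagrangianS dom.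
- apply: path_cost_le => //.
  + exact: ac_seqS acf.
  + by move=> u /andP[tu uT]; apply: f01; rewrite uT (le_trans t0).
  + exact: dominates_lagrangianS dom.
Qed.

End LowerBoundAlongPaths.

(** * The optimal path of one edge *)

Section OptimalPath.
Context {R : realType}.
Variables (lambda mu : R).
Hypotheses (lambda0 : 0 < lambda) (mu0 : 0 < mu).
Local Notation leb := (@lebesgue_measure R).
Local Notation p0 := (p01 lambda mu).
Local Notation p1 := (p11 lambda mu).
Local Notation psi0 := (psi0 lambda mu).
Local Notation psi1 := (psi1 lambda mu).
Local Notation cost := (cost lambda mu).
Local Notation phi := (phi lambda mu).
Local Notation lagr := (lagrangian lambda mu).

Lemma is_derive_continuous (f : R -> R) (x df : R) : is_derive x 1 f df ->
  {for x, continuous f}.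
Proof.
by move=> [fd _]; apply/differentiable_continuous; exact/derivable1_diffP.
Qed.

(** Criticality in the concave supremum over [v]: [b] is the drift of the chain
tilted by [v]. *)
Lemma lagrangian_opt (f e v : R) : 0 <= f <= 1 -> e = expR v ->
  lagr f (lambda * e * (1 - f) - mu * e^-1 * f) =
  (test_value lambda mu f (lambda * e * (1 - f) - mu * e^-1 * f) v)%:E.
Proof.
move=> /andP[f0 f1] ->; apply/eqP; rewrite eq_le lagrangian_ge andbT.
apply: ge_ereal_sup => _ [u _ <-]; rewrite lee_fin /test_value -expRN.
have aux (p q : R) : (p - q) * expR q <= expR p - expR q.
  have -> : expR p = expR q * expR (p - q) by rewrite -expRD; congr expR; ring.
  by have := ler_wpM2l (ltW (expR_gt0 q)) (expR_ge1Dx (p - q)); lra.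
have h1 := aux u v; have h2 := aux (- u) (- v).
have k1 : 0 <= lambda * (1 - f) by rewrite mulr_ge0 ?subr_ge0// ltW.
have k2 : 0 <= mu * f by rewrite mulr_ge0// ltW.
have := ler_wpM2l k1 h1; have := ler_wpM2l k2 h2.
by lra.
Qed.

Variables (T a b x0 x1 : R).
Implicit Types (s t : R).
Hypotheses (T0 : 0 < T) (a01 : 0 <= a <= 1) (b01 : 0 <= b <= 1).
Hypothesis opt : optimal_weights lambda mu x0 x1 T a b.

Local Notation f := (phi x0 x1 T a).

Let Psi1_gt0 : 0 < psi1 x0 x1 T.
Proof. by have [] := optimal_weights_psi_gt0 lambda0 mu0 opt T0. Qed.
Let Psi0_gt0 : 0 < psi0 x0 x1 T.
Proof. by have [] := optimal_weights_psi_gt0 lambda0 mu0 opt T0. Qed.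
Let x00 : 0 <= x0. Proof. by have [] := opt. Qed.
Let x10 : 0 <= x1. Proof. by have [] := opt. Qed.
Let x01 : x0 + x1 = 1. Proof. by have [] := opt. Qed.

(** The forward density of present edges ([forward1]) and of absent edges
([forward0]), each divided by the backward function of its starting state.  The
tilted path is the product of forward and backward functions. *)
Definition forward1 (t : R) : R :=
  a * p1 t / psi1 x0 x1 T + (1 - a) * p0 t / psi0 x0 x1 T.
Definition forward0 (t : R) : R :=
  a * (1 - p1 t) / psi1 x0 x1 T + (1 - a) * (1 - p0 t) / psi0 x0 x1 T.

Lemma phi_forward1 t : f t = psi1 x0 x1 (T - t) * forward1 t.
Proof. by rewrite /phi /forward1; ring. Qed.

Lemma phi_forward0 t : 1 - f t = psi0 x0 x1 (T - t) * forward0 t.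
Proof.
have e1 := psi1D lambda0 mu0 x0 x1 t (T - t).
have e0 := psi0D lambda0 mu0 x0 x1 t (T - t).
rewrite addrC subrK in e1 e0.
have h1 : psi1 x0 x1 T != 0 by rewrite gt_eqF.
have h0 : psi0 x0 x1 T != 0 by rewrite gt_eqF.
have k1 : (1 - p1 t) * psi0 x0 x1 (T - t) / psi1 x0 x1 T =
   1 - p1 t * psi1 x0 x1 (T - t) / psi1 x0 x1 T.
  rewrite (_ : (1 - p1 t) * _ = psi1 x0 x1 T - p1 t * psi1 x0 x1 (T - t)).
    by field.
  by rewrite [in RHS]e1; ring.
have k0 : (1 - p0 t) * psi0 x0 x1 (T - t) / psi0 x0 x1 T =
   1 - p0 t * psi1 x0 x1 (T - t) / psi0 x0 x1 T.
  rewrite (_ : (1 - p0 t) * _ = psi0 x0 x1 T - p0 t * psi1 x0 x1 (T - t)).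
    by field.
  by rewrite [in RHS]e0; ring.
transitivity (a * ((1 - p1 t) * psi0 x0 x1 (T - t) / psi1 x0 x1 T) +
  (1 - a) * ((1 - p0 t) * psi0 x0 x1 (T - t) / psi0 x0 x1 T)).
  by rewrite k1 k0 /phi; ring.
by rewrite /forward0; ring.
Qed.

Lemma phi_at0 : f 0 = a.
Proof.
rewrite /phi subr0 p11_at0// p01_at0//; field.
by rewrite !gt_eqF.
Qed.

(** The drift of the tilted chain; its jump rates are [lambda * psi1 / psi0] and
[mu * psi0 / psi1]. *)
Definition dphi (t : R) : R :=
  lambda * (psi1 x0 x1 (T - t) * forward0 t) - mu * (psi0 x0 x1 (T - t) * forward1 t).

Lemma is_derive_forward1 t :
  is_derive t 1 forward1 (lambda * forward0 t - mu * forward1 t).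
Proof.
have -> : forward1 = ((a / psi1 x0 x1 T) \*: p1 \+ ((1 - a) / psi0 x0 x1 T) \*: p0).
  by apply/funext => u; rewrite /forward1 /= /GRing.scale/=; ring.
have := is_deriveD (is_deriveZ (a / psi1 x0 x1 T) (is_derive_p11 lambda0 mu0 t))
  (is_deriveZ ((1 - a) / psi0 x0 x1 T) (is_derive_p01 lambda0 mu0 t)).
congr is_derive; rewrite /forward0 /= /GRing.scale/=.
have -> : p1 t = p0 t + decay lambda mu t by rewrite -p11Bp01//; ring.
have -> : decay lambda mu t = 1 - (lambda + mu) / lambda * p0 t.
  by rewrite p01E//; field; rewrite !gt_eqF// addr_gt0.
by field; rewrite !gt_eqF.
Qed.

Lemma is_derive_phi t : is_derive t 1 f (dphi t).
Proof.
have -> : f = (fun u => psi1 x0 x1 (T - u)) \* forward1.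
  by apply/funext => u; rewrite phi_forward1.
have := is_deriveM (is_derive_rev
  (@is_derive_psi1 R lambda mu lambda0 mu0 x0 x1 (T - t))) (is_derive_forward1 t).
by congr is_derive; rewrite /dphi /GRing.scale/=; ring.
Qed.

Lemma forward_ge0 t : 0 <= t -> 0 <= forward1 t /\ 0 <= forward0 t.
Proof.
move=> t0; case/andP: a01 => a0 a1.
have := p01_ge0 lambda0 mu0 t0; have := p11_le1 lambda0 mu0 t0.
have := p11_gt0 lambda0 mu0 t0; have := p01_lt1 lambda0 mu0 t0.
move=> h1 h2 h3 h4; split; apply: addr_ge0; apply: divr_ge0; rewrite ?(ltW Psi1_gt0)//;
  rewrite ?(ltW Psi0_gt0)//; apply: mulr_ge0; lra.
Qed.

Lemma psi_le1 t : 0 <= t -> [/\ 0 <= psi0 x0 x1 t, psi0 x0 x1 t <= 1,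
  0 <= psi1 x0 x1 t & psi1 x0 x1 t <= 1].
Proof.
move=> t0.
have := p01_ge0 lambda0 mu0 t0; have := p11_le1 lambda0 mu0 t0.
have := p11_gt0 lambda0 mu0 t0; have := p01_lt1 lambda0 mu0 t0.
rewrite /psi0 /psi1; have -> : x0 = 1 - x1 by rewrite -x01; ring.
have x11 : x1 <= 1 by rewrite -x01 lerDr.
move: (p01 _ _ _) (p11 _ _ _) => u v h1 h2 h3 h4.
by split; have := x10; nra.
Qed.

Lemma dphi_bound : exists M, forall t, 0 <= t <= T -> `|dphi t| <= M.
Proof.
exists ((lambda + mu) * ((psi1 x0 x1 T)^-1 + (psi0 x0 x1 T)^-1)) => t /andP[t0 tT].
have [k1 k0] := forward_ge0 t0; case/andP: a01 => a0 a1.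
have := p01_ge0 lambda0 mu0 t0; have := p11_le1 lambda0 mu0 t0.
have := p11_gt0 lambda0 mu0 t0; have := p01_lt1 lambda0 mu0 t0 => h1 h2 h3 h4.
set C := (psi1 x0 x1 T)^-1 + _.
have aux (u v : R) : 0 <= u <= 1 -> 0 <= v <= 1 ->
    a * u / psi1 x0 x1 T + (1 - a) * v / psi0 x0 x1 T <= C.
  move=> /andP[u0 u1] /andP[v0 v1]; rewrite /C.
  apply: lerD; rewrite -[leRHS]mul1r; apply: ler_wpM2r.
  - by rewrite invr_ge0 ltW.
  - by nra.
  - by rewrite invr_ge0 ltW.
  - by nra.
have f1C : forward1 t <= C by apply: aux; apply/andP; split; lra.
have f0C : forward0 t <= C by apply: aux; apply/andP; split; lra.
have [q0 q0' q1 q1'] : [/\ 0 <= psi0 x0 x1 (T - t), psi0 x0 x1 (T - t) <= 1,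
    0 <= psi1 x0 x1 (T - t) & psi1 x0 x1 (T - t) <= 1] by apply: psi_le1; rewrite subr_ge0.
rewrite /dphi (le_trans (ler_normB _ _))// (mulrDl lambda mu C); apply: lerD.
  rewrite ger0_norm; last by rewrite mulr_ge0 ?(ltW lambda0)// mulr_ge0.
  rewrite ler_wpM2l ?(ltW lambda0)// -[leRHS]mul1r; exact: ler_pM.
rewrite ger0_norm; last by rewrite mulr_ge0 ?(ltW mu0)// mulr_ge0.
rewrite ler_wpM2l ?(ltW mu0)// -[leRHS]mul1r; exact: ler_pM.
Qed.

Lemma phi_lipschitz : exists M, forall s t, 0 <= s -> s <= t -> t <= T ->
  `|f t - f s| <= M * (t - s).
Proof.
have [M HM] := dphi_bound; exists M; apply: lipschitz_of_derive HM => t _.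
exact: is_derive_phi.
Qed.

Lemma phi_itv t : 0 <= t <= T -> 0 <= f t <= 1.
Proof. by move=> tT; apply: phi01. Qed.

(** Along the tilted path the supremum in the Lagrangian is attained at the
logarithm of the tilt, so that the inequality in [path_cost_le] becomes an equality. *)
Lemma lagrangian_phi t : 0 <= t -> t < T ->
  lagr (f t) (dphi t) = (test_value lambda mu (f t) (dphi t)
    (ln (psi1 x0 x1 (T - t)) - ln (psi0 x0 x1 (T - t))))%:E.
Proof.
move=> t0 tT; have Tt : 0 < T - t by rewrite subr_gt0.
have [g0 g1] := optimal_weights_psi_gt0 lambda0 mu0 opt Tt.
have f01 : 0 <= f t <= 1 by apply: phi_itv; rewrite t0 ltW.
set v := ln _ - ln _.
have ev : psi1 x0 x1 (T - t) / psi0 x0 x1 (T - t) = expR v.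
  by rewrite /v -ln_div ?posrE// lnK// posrE divr_gt0.
have -> : dphi t = lambda * expR v * (1 - f t) - mu * (expR v)^-1 * f t.
  rewrite -ev /dphi phi_forward0 phi_forward1; field.
  by rewrite !gt_eqF.
by rewrite (lagrangian_opt f01 (erefl (expR v))).
Qed.

(** The Hamilton-Jacobi solution along the optimal path; its increment is the
action. *)
Definition value_along (t : R) : R :=
  f t * ln (psi1 x0 x1 (T - t)) + (1 - f t) * ln (psi0 x0 x1 (T - t)).

Lemma is_derive_value_along t : 0 < psi0 x0 x1 (T - t) -> 0 < psi1 x0 x1 (T - t) ->
  is_derive t 1 value_along (test_value lambda mu (f t) (dphi t)
    (ln (psi1 x0 x1 (T - t)) - ln (psi0 x0 x1 (T - t)))).
Proof.
move=> g0 g1.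
have d1 := is_derive_ln_comp (g := fun u => psi1 x0 x1 (T - u)) g1
  (is_derive_rev (@is_derive_psi1 R lambda mu lambda0 mu0 x0 x1 (T - t))).
have d0 := is_derive_ln_comp (g := fun u => psi0 x0 x1 (T - u)) g0
  (is_derive_rev (@is_derive_psi0 R lambda mu lambda0 mu0 x0 x1 (T - t))).
have df := is_derive_phi t.
have := is_deriveD (is_deriveM df d1)
  (is_deriveM (is_deriveB (is_derive_cst (1 : R) t (1 : R)) df) d0).
congr is_derive; rewrite /test_value /= /GRing.scale/= /cst/=.
have e1 : expR (ln (psi1 x0 x1 (T - t)) - ln (psi0 x0 x1 (T - t))) =
    psi1 x0 x1 (T - t) / psi0 x0 x1 (T - t).
  by rewrite -ln_div ?posrE// lnK// posrE divr_gt0.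
have e0 : expR (- (ln (psi1 x0 x1 (T - t)) - ln (psi0 x0 x1 (T - t)))) =
    psi0 x0 x1 (T - t) / psi1 x0 x1 (T - t).
  by rewrite opprB -ln_div ?posrE// lnK// posrE divr_gt0.
by rewrite e1 e0 !fctE; field; rewrite !gt_eqF.
Qed.

Lemma continuous_dphi : continuous dphi.
Proof.
have cq (q : R -> R) : (forall t, exists dq, is_derive t 1 q dq) -> continuous q.
  by move=> h t; have [dq] := h t; exact: is_derive_continuous.
have c1 : continuous (fun t => psi1 x0 x1 (T - t)).
  by apply: cq => t; eexists; apply: is_derive_rev; exact: is_derive_psi1.
have c0 : continuous (fun t => psi0 x0 x1 (T - t)).
  by apply: cq => t; eexists; apply: is_derive_rev; exact: is_derive_psi0.
have cp1 : continuous p1 by apply: cq => t; eexists; exact: is_derive_p11.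
have cp0 : continuous p0 by apply: cq => t; eexists; exact: is_derive_p01.
have cf1 : continuous forward1.
  by apply: cq => t; eexists; exact: is_derive_forward1.
have cf0 : continuous forward0.
  move=> t; apply: cvgD; (apply: cvgM; last exact: cvg_cst);
  (apply: cvgM; first exact: cvg_cst); (apply: cvgB; first exact: cvg_cst).
    exact: cp1.
  exact: cp0.
move=> t; apply: cvgB; (apply: cvgM; first exact: cvg_cst); apply: cvgM.
- exact: c1.
- exact: cf0.
- exact: c0.
- exact: cf1.
Qed.

Lemma continuous_phi : continuous f.
Proof. by move=> t; exact: is_derive_continuous (is_derive_phi t). Qed.

Lemma integral_value_along s : 0 < s -> s <= T ->
  (forall t, 0 <= t <= s -> 0 < psi0 x0 x1 (T - t) /\ 0 < psi1 x0 x1 (T - t)) ->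
  (\int[leb]_(t in `[0%R, s]) (test_value lambda mu (f t) (dphi t)
    (ln (psi1 x0 x1 (T - t)) - ln (psi0 x0 x1 (T - t))))%:E =
   (value_along s - value_along 0)%:E)%E.
Proof.
move=> s0 sT pos.
have cval t : 0 <= t <= s -> {for t, continuous value_along}.
  by move=> /pos[g0 g1]; apply: is_derive_continuous (is_derive_value_along g0 g1).
rewrite EFinB; apply: (continuous_FTC2 s0).
- apply: continuous_in_subspaceT => t; rewrite inE/= in_itv/= => /pos[g0 g1].
  have cv : {for t, continuous (fun t => ln (psi1 x0 x1 (T - t)) - ln (psi0 x0 x1 (T - t)))}.
    have c1 := is_derive_continuous (is_derive_ln_comp (g := fun u => psi1 x0 x1 (T - u)) g1
      (is_derive_rev (@is_derive_psi1 R lambda mu lambda0 mu0 x0 x1 (T - t)))).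
    have c0 := is_derive_continuous (is_derive_ln_comp (g := fun u => psi0 x0 x1 (T - u)) g0
      (is_derive_rev (@is_derive_psi0 R lambda mu lambda0 mu0 x0 x1 (T - t)))).
    by apply: cvgB; [exact: c1|exact: c0].
  have cf := @continuous_phi t; have cdf := @continuous_dphi t.
  have ce : {for t, continuous (fun t => expR (ln (psi1 x0 x1 (T - t)) - ln (psi0 x0 x1 (T - t))))}.
    by apply: (@continuous_comp _ _ _ _ expR) => //; exact: continuous_expR.
  have ce' : {for t, continuous (fun t => expR (- (ln (psi1 x0 x1 (T - t)) - ln (psi0 x0 x1 (T - t)))))}.
    apply: (@continuous_comp _ _ _ (fun t => - (ln (psi1 x0 x1 (T - t)) - ln (psi0 x0 x1 (T - t)))) expR) => //; last exact: continuous_expR.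
    by apply: cvgN.
  apply: cvgB; first apply: cvgB.
  + by apply: cvgM.
  + apply: cvgM; last by apply: cvgB; [exact: cvg_cst|].
    apply: cvgM; first exact: cvg_cst.
    by apply: cvgB; [|exact: cvg_cst].
  + apply: cvgM => //; apply: cvgM; first exact: cvg_cst.
    by apply: cvgB; [|exact: cvg_cst].
- split.
  + move=> t; rewrite in_itv/= => /andP[t0 ts].
    have [g0 g1] : 0 < psi0 x0 x1 (T - t) /\ 0 < psi1 x0 x1 (T - t).
      by apply: pos; rewrite !ltW.
    by have [] := is_derive_value_along g0 g1.
  + by apply: cvg_within_filter; apply: cval; rewrite lexx ltW.
  + by apply: cvg_within_filter; apply: cval; rewrite lexx ltW.
- move=> t; rewrite in_itv/= => /andP[t0 ts].
  have [g0 g1] : 0 < psi0 x0 x1 (T - t) /\ 0 < psi1 x0 x1 (T - t).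
    by apply: pos; rewrite !ltW.
  by rewrite derive1E; have := is_derive_value_along g0 g1; move=> /@derive_val.
Qed.

End OptimalPath.

Section OptimalPathCost.
Context {R : realType}.
Variables (lambda mu : R).
Hypotheses (lambda0 : 0 < lambda) (mu0 : 0 < mu).
Local Notation leb := (@lebesgue_measure R).
Local Notation psi0 := (psi0 lambda mu).
Local Notation psi1 := (psi1 lambda mu).
Local Notation cost := (cost lambda mu).
Local Notation phi := (phi lambda mu).
Local Notation lagr := (lagrangian lambda mu).
Variables (T a b x0 x1 : R).
Implicit Types (s t : R).
Hypotheses (T0 : 0 < T) (a01 : 0 <= a <= 1) (b01 : 0 <= b <= 1).
Hypothesis opt : optimal_weights lambda mu x0 x1 T a b.
Local Notation f := (phi x0 x1 T a).
Local Notation df := (dphi lambda mu T a x0 x1).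

Definition lagrangian_along t : \bar R := lagr (f t) (df t).

Lemma measurable_lagrangian_along : measurable_fun setT lagrangian_along.
Proof.
apply: measurable_lagrangian; apply: continuous_measurable_fun.
  exact: (continuous_phi lambda0 mu0 T0 opt).
exact: (continuous_dphi lambda0 mu0 T0 opt).
Qed.

Lemma cost_value_along : cost x0 x1 T a b =
  b * ln x1 + (1 - b) * ln x0 - value_along lambda mu T a x0 x1 0.
Proof. by rewrite /value_along subr0 (phi_at0 lambda0 mu0 T0 opt) /cost; ring. Qed.

Lemma integral_lagrangian_along_le s : 0 < s -> s < T ->
  (\int[leb]_(t in `[0%R, s]) lagrangian_along t =
    (value_along lambda mu T a x0 x1 s - value_along lambda mu T a x0 x1 0)%:E)%E.
Proof.
move=> s0 sT; rewrite -(integral_value_along lambda0 mu0 T0 opt s0 (ltW sT)).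
  apply: eq_integral => t; rewrite inE/= in_itv/= => /andP[t0 ts].
  by rewrite /lagrangian_along (lagrangian_phi lambda0 mu0 T0 a01 opt)// (le_lt_trans ts).
move=> t /andP[t0 ts]; apply: (optimal_weights_psi_gt0 lambda0 mu0 opt).
by rewrite subr_gt0 (le_lt_trans ts).
Qed.

Lemma value_along_T : value_along lambda mu T a x0 x1 T = b * ln x1 + (1 - b) * ln x0.
Proof.
by rewrite /value_along subrr psi0_at0// psi1_at0//; have [_ _ _ ->] := opt.
Qed.

Lemma ln_psi_le0 t : 0 <= t -> t < T ->
  ln (psi0 x0 x1 (T - t)) <= 0 /\ ln (psi1 x0 x1 (T - t)) <= 0.
Proof.
move=> t0 tT; have Tt : 0 <= T - t by rewrite subr_ge0 ltW.
by have [_ h0 _ h1] := psi_le1 lambda0 mu0 opt Tt; split; exact: ln_le0.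
Qed.

(** For [b = 0] or [b = 1] one weight vanishes and the other is 1.  The default
value [ln 0 = 0] is harmless here, its coefficient being 0. *)
Lemma degenerate_weights : b = 0 \/ b = 1 -> b * ln x1 + (1 - b) * ln x0 = 0.
Proof.
have [x00 x10 x01 fT _] := opt.
have [g0 g1] := optimal_weights_psi_gt0 lambda0 mu0 opt T0.
case/andP: a01 => a0 a1.
have T0' := ltW T0.
have := p01_gt0 lambda0 mu0 T0; have := p11_gt0 lambda0 mu0 T0' => k1 k0.
have := p01_lt1 lambda0 mu0 T0'; have := p11_lt1 lambda0 mu0 T0 => k1' k0'.
case=> bE.
  suff x1E : x1 = 0 by rewrite bE (_ : x0 = 1) ?ln1; [ring|rewrite -x01 x1E addr0].
  move: fT; rewrite phi_forward1 subrr psi1_at0// bE => /eqP.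
  rewrite mulf_eq0 => /orP[/eqP//|/eqP F].
  suff : 0 < forward1 lambda mu T a x0 x1 T by rewrite F ltxx.
  case: (ltgtP 0 a) a0 => // [a0 _|<- _]; rewrite /forward1.
    apply: ltr_pwDl; first by apply: divr_gt0 => //; exact: mulr_gt0.
    by apply: divr_ge0; [apply: mulr_ge0; lra|exact: ltW].
  by rewrite !mul0r add0r subr0 mul1r; exact: divr_gt0.
suff x0E : x0 = 0 by rewrite bE (_ : x1 = 1) ?ln1; [ring|rewrite -x01 x0E add0r].
have : 1 - f T = 0 by rewrite fT bE subrr.
rewrite (phi_forward0 lambda0 mu0 T0 opt) subrr psi0_at0// => /eqP.
rewrite mulf_eq0 => /orP[/eqP//|/eqP F].
suff : 0 < forward0 lambda mu T a x0 x1 T by rewrite F ltxx.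
case: (ltgtP 0 a) a0 => // [a0 _|<- _]; rewrite /forward0.
  apply: ltr_pwDl; first by apply: divr_gt0 => //; apply: mulr_gt0; lra.
  by apply: divr_ge0; [apply: mulr_ge0; lra|exact: ltW].
by rewrite !mul0r add0r subr0 mul1r; apply: divr_gt0 => //; lra.
Qed.

(** The backward functions are at most 1, so their logarithms make the value
nonpositive before the final time. *)
Lemma value_along_le s : 0 < s -> s < T -> b = 0 \/ b = 1 ->
  value_along lambda mu T a x0 x1 s <= b * ln x1 + (1 - b) * ln x0.
Proof.
move=> s0 sT bE; rewrite (degenerate_weights bE) /value_along.
have [l0 l1] := ln_psi_le0 (ltW s0) sT.
have sT' : 0 <= s <= T by rewrite !ltW.
have /andP[f0 f1] := phi_itv lambda0 mu0 T0 a01 opt sT'.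
by rewrite -[leRHS]addr0; apply: lerD; apply: mulr_ge0_le0 => //; rewrite subr_ge0.
Qed.

(** For [0 < b < 1] all functions are smooth up to the final time and the
fundamental theorem of calculus applies.  For [b = 0] or [b = 1] the Lagrangian may
blow up at the final time; the action is then the limit of the actions on
[0, r n], each bounded by the monotonicity recorded in [value_along_le]. *)
Theorem optimal_path_cost :
  (\int[leb]_(t in `[0%R, T]) lagrangian_along t <= (cost x0 x1 T a b)%:E)%E.
Proof.
have m := measurable_lagrangian_along.
rewrite -integral_itv_bndo_bndc; last exact: measurable_funTS.
have [deg|nondeg] := pselect (b = 0 \/ b = 1); last first.
  have b01' : 0 < b < 1.
    case/andP: b01 => h0 h1; rewrite !lt_neqAle h0 h1 !andbT.
    by apply/andP; split; apply/eqP => h; apply: nondeg; [left|right].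
  have [x00 x10 x01 fT [bx0 bx1]] := opt.
  rewrite cost_value_along -value_along_T.
  rewrite -(integral_value_along lambda0 mu0 T0 opt T0 (lexx T)).
    rewrite -[leRHS]integral_itv_bndo_bndc.
      rewrite le_eqVlt; apply/orP; left; apply/eqP.
      apply: eq_integral => t; rewrite inE/= in_itv/= => /andP[t0 tT].
      by rewrite /lagrangian_along (lagrangian_phi lambda0 mu0 T0 a01 opt).
    apply: (@eq_measurable_fun _ _ _ _ _ lagrangian_along); last exact: measurable_funTS.
    move=> t; rewrite inE/= in_itv/= => /andP[t0 tT].
    by rewrite /lagrangian_along (lagrangian_phi lambda0 mu0 T0 a01 opt).
  move=> t /andP[t0 tT]; case/andP: b01' => b0 b1; apply: psi_gt0' => //; auto.
  by rewrite subr_ge0.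
(* The times [r n] increase to [T] and avoid 0. *)
pose r n : R := T - T / n.+2%:R.
have rT n : r n < T by rewrite gtrBl divr_gt0.
have r0 n : 0 < r n.
  by rewrite subr_gt0 ltr_pdivrMr// ltr_pMr// ltr1n.
have ndr : {homo r : m n / (m <= n)%N >-> m <= n}.
  by move=> m1 n mn; rewrite lerB// ler_wpM2l ?(ltW T0)// lef_pV2 ?posrE// ler_nat.
have -> : `[0, T[%classic = \bigcup_n `[0, r n]%classic.
  apply/seteqP; split => t /=; rewrite in_itv/=.
    move=> /andP[t0 tT]; pose n := Num.bound (T / (T - t)).
    have Tt : 0 < T - t by rewrite subr_gt0.
    exists n => //=; rewrite in_itv/= t0 /r lerBrDr -lerBrDl ler_pdivrMr//.
    rewrite -ler_pdivrMl// mulrC; apply: (@le_trans _ _ n%:R).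
      by apply/ltW/archi_boundP; rewrite divr_ge0// ltW.
    by rewrite ler_nat; apply: leqW; exact: leqnSn.
  by move=> [n _ /=]; rewrite in_itv/= => /andP[-> tr]; rewrite (le_lt_trans tr).
have cvg : (\int[leb]_(x in `[0%R, r i]) lagrangian_along x)%E @[i --> \oo] -->
    (\int[leb]_(x in \bigcup_i `[0%R, r i]%classic) lagrangian_along x)%E.
  apply: ge0_nondecreasing_set_cvg_integral.
  - move=> m1 n mn; apply/subsetPset; apply: subset_itvScc => //; exact: ndr.
  - by move=> n; exact: measurable_itv.
  - by move=> n; exact: measurable_funTS.
  - by move=> n t _; exact: lagrangian_ge0.
rewrite -(cvg_lim _ cvg)//; apply: lime_le; first by apply/cvg_ex; eexists; exact: cvg.
apply: nearW => n; rewrite integral_lagrangian_along_le// lee_fin.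
by rewrite cost_value_along lerB// value_along_le.
Qed.

Lemma phi_derive1 t : derivable f t 1 /\ derive1 f t = df t.
Proof.
have d := is_derive_phi lambda0 mu0 T0 opt (t : R).
by split; [case: d|rewrite derive1E derive_val].
Qed.

Lemma ac_seq_phi : ac_seq 0 T f.
Proof.
have [M HM] := phi_lipschitz lambda0 mu0 T0 a01 opt.
exact: ac_seq_lipschitz HM.
Qed.

(** The two rates are at most the actions of the optimal path before and after [t],
and these two actions add up to the cost. *)
Lemma fstar_objective_phi t : 0 <= t <= T ->
  (fstar_objective lambda mu T a b t (f t) <= (cost x0 x1 T a b)%:E)%E.
Proof.
move=> /andP[t0 tT]; apply: le_trans optimal_path_cost.
have dom : dominates_lagrangian lambda mu 0 T f lagrangian_along.
  split; first exact: measurable_funTS measurable_lagrangian_along.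
  - by move=> u; exact: lagrangian_ge0.
  - by move=> u _ _; rewrite /lagrangian_along (phi_derive1 u).2.
have f01 := phi_itv lambda0 mu0 T0 a01 opt.
have fT : f T = b by have [] := opt.
have f0 : f 0 = a := phi_at0 lambda0 mu0 T0 opt.
have [m h0 _] := dom; rewrite (integral_itv_split t0 tT m h0); apply: leeD.
- apply: rate1_le => y1 y10.
  have := @path_cost_le R lambda mu lambda0 mu0 0 t 1 y1 f lagrangian_along t0.
  rewrite subr0 f0; apply => //.
  + exact: ac_seqS ac_seq_phi.
  + by move=> u /andP[u0 ut]; apply: f01; rewrite u0 (le_trans ut).
  + exact: dominates_lagrangianS dom.
- apply: rate1_le => y1 y10; rewrite -fT; apply: path_cost_le => //.
  + exact: ac_seqS ac_seq_phi.
  + by move=> u /andP[tu uT]; apply: f01; rewrite uT (le_trans t0).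
  + exact: dominates_lagrangianS dom.
Qed.

(** The objective exceeds its value at [phi t] by a multiple of the squared distance
to it, so [phi t] is the unique minimiser. *)
Theorem fstarE t : 0 <= t <= T -> fstar lambda mu T a b t = f t.
Proof.
move=> tT; rewrite /fstar.
have f01 := phi_itv lambda0 mu0 T0 a01 opt tT.
have ge s : I01 s -> ((cost x0 x1 T a b + (s - f t) ^+ 2 / 8)%:E
    <= fstar_objective lambda mu T a b t s)%E.
  by rewrite /I01/= in_itv/= => s01; apply: rate1_split_ge.
case: xgetP => [s _ [s01 smin]|none].
  have : ((cost x0 x1 T a b + (s - f t) ^+ 2 / 8)%:E <= (cost x0 x1 T a b)%:E)%E.
    apply: le_trans (ge s s01) _; apply: le_trans (fstar_objective_phi tT).
    by apply: smin; rewrite /I01/= in_itv/=.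
  rewrite lee_fin gerDl ler_pdivrMr// mul0r => h.
  have : (s - f t) ^+ 2 = 0 by apply/eqP; rewrite eq_le h sqr_ge0.
  by move=> /eqP; rewrite sqrf_eq0 subr_eq0 => /eqP.
have := none (f t); case; split; first by rewrite /I01/= in_itv/=.
move=> s s01; apply: le_trans (fstar_objective_phi tT) _; apply: le_trans (ge s s01).
by rewrite lee_fin lerDl divr_ge0// sqr_ge0.
Qed.

Lemma fstar_abs_continuous : abs_continuous 0 T (fstar lambda mu T a b).
Proof.
have [M HM] := phi_lipschitz lambda0 mu0 T0 a01 opt.
move=> e e0; exists (e / (`|M| + 1)) => [|n p q pq _ pqd].
  by rewrite divr_gt0// ltr_wpDl.
apply: (@le_lt_trans _ _ (\sum_i (`|M| + 1) * (q i - p i))).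
  apply: ler_sum => i _; have [h1 h2 h3] := pq i.
  rewrite !fstarE ?h3 ?h1 ?(le_trans h1)// ?(le_trans h2)//.
  apply: le_trans (HM _ _ h1 h2 h3) _.
  by rewrite ler_wpM2r ?subr_ge0// (le_trans (ler_norm _))// lerDl.
by rewrite -mulr_sumr mulrC -ltr_pdivlMr// ltr_wpDl.
Qed.

Lemma fstar_lagrangian t : 0 < t < T ->
  lagr (fstar lambda mu T a b t) (derive1 (fstar lambda mu T a b) t) = lagrangian_along t.
Proof.
move=> /andP[t0 tT]; rewrite fstarE ?ltW// /lagrangian_along -(phi_derive1 t).2.
congr lagr; rewrite !derive1E; apply: near_eq_derive; near=> s.
by apply: fstarE; apply/andP; split; apply: ltW; near: s; [exact: lt_nbhsr|exact: lt_nbhsl].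
Unshelve. all: by end_near. Qed.

End OptimalPathCost.

(** * The minimal cost of one edge, and its size for small times *)

Section MinimalCost.
Context {R : realType}.
Variables (lambda mu : R).
Hypotheses (lambda0 : 0 < lambda) (mu0 : 0 < mu).
Variable T : R.
Hypothesis T0 : 0 < T.
Implicit Types (a b : R).
Local Notation p0 := (p01 lambda mu T).
Local Notation p1 := (p11 lambda mu T).
Local Notation cost := (cost lambda mu).

(** The supremum is finite, so nothing is lost by taking its real part. *)
Definition mincost a b : R := fine (rate1 lambda mu T a b).

Lemma rate1_at0 a : rate1 lambda mu 0 a a = 0%E.
Proof.
apply/eqP; rewrite eq_le rate1_ge0 ?andbT//.
apply: ge_ereal_sup => _ [v _ <-].
have e0 := p01_at0 lambda0 mu0; have e1 := p11_at0 lambda0 mu0.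
rewrite e0 e1 lee_fin !subrr add0r mulr1 expRK mulr0 addr0 subr0 ln1 mulr0; lra.
Qed.

(** The case of time 0 in the two opposite bounds on the objective of [fstar]. *)
Lemma rate1_optimal x0 x1 a b : 0 <= a <= 1 -> 0 <= b <= 1 ->
  optimal_weights lambda mu x0 x1 T a b -> rate1 lambda mu T a b = (cost x0 x1 T a b)%:E.
Proof.
move=> a01 b01 opt; have t0 : 0 <= (0 : R) <= T by rewrite lexx ltW.
have f0 := phi_at0 lambda0 mu0 T0 opt.
have := fstar_objective_phi lambda0 mu0 T0 a01 b01 opt t0.
have := rate1_split_ge lambda0 mu0 T0 a01 b01 a01 t0 opt.
rewrite f0 /fstar_objective rate1_at0 add0e subr0 subrr expr0n/= mul0r addr0 => h1 h2.
by apply/eqP; rewrite eq_le h1 h2.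
Qed.

Lemma mincost_optimal x0 x1 a b : 0 <= a <= 1 -> 0 <= b <= 1 ->
  optimal_weights lambda mu x0 x1 T a b -> mincost a b = cost x0 x1 T a b.
Proof. by move=> a01 b01 opt; rewrite /mincost (rate1_optimal a01 b01 opt). Qed.

Lemma mincost_ge_cost a b y0 y1 : 0 <= a <= 1 -> 0 <= b <= 1 -> 0 < y0 -> 0 < y1 ->
  cost y0 y1 T a b <= mincost a b.
Proof.
move=> a01 b01 y00 y10; have [x0 [x1 opt]] := exists_optimal_weights lambda0 mu0 T0 a01 b01.
rewrite (mincost_optimal a01 b01 opt) -lee_fin -(rate1_optimal a01 b01 opt).
by apply: rate1_ge_cost => //; exact: ltW.
Qed.

Lemma mincost_ge0 a b : 0 <= mincost a b.
Proof. by apply: fine_ge0; exact: rate1_ge0. Qed.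

(** The weights [w11], [w10], [w01], [w00] say which fraction of the edges makes each
of the four transitions.  Letting edges flip independently in these proportions
costs the sum of the logarithms of the transition probabilities; formally, each
logarithm of a backward function is bounded below by one of its two terms. *)
Lemma mincost_le_coupling a b w11 w10 w01 w00 : 0 <= a <= 1 -> 0 <= b <= 1 ->
  0 <= w11 -> 0 <= w10 -> 0 <= w01 -> 0 <= w00 ->
  w11 + w10 = a -> w01 + w00 = 1 - a -> w11 + w01 = b ->
  mincost a b <= - (w11 * ln p1 + w10 * ln (1 - p1) + w01 * ln p0 + w00 * ln (1 - p0)).
Proof.
move=> a01 b01 h11 h10 h01 h00 ea e1a eb.
have [x0 [x1 opt]] := exists_optimal_weights lambda0 mu0 T0 a01 b01.
rewrite (mincost_optimal a01 b01 opt) -lee_fin -(rate1_optimal a01 b01 opt).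
apply: rate1_le => // y1 y10; rewrite lee_fin /cost ln1 mulr0 addr0.
have p0_gt0 := p01_gt0 lambda0 mu0 T0; have p0_lt1 := p01_lt1 lambda0 mu0 (ltW T0).
have p1_gt0 := p11_gt0 lambda0 mu0 (ltW T0); have p1_lt1 := p11_lt1 lambda0 mu0 T0.
have q0 : 0 < 1 - p0 by rewrite subr_gt0.
have q1 : 0 < 1 - p1 by rewrite subr_gt0.
have h0y : 0 < p0 * y1 by apply: mulr_gt0.
have h1y : 0 < p1 * y1 by apply: mulr_gt0.
have ple : psi1 lambda mu 1 y1 T = 1 - p1 + p1 * y1 by rewrite /psi1 mulr1.
have ple0 : psi0 lambda mu 1 y1 T = 1 - p0 + p0 * y1 by rewrite /psi0 mulr1.
have e10 : ln (1 - p1) <= ln (psi1 lambda mu 1 y1 T).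
  by rewrite ler_ln ?posrE// ple; lra.
have e11 : ln p1 + ln y1 <= ln (psi1 lambda mu 1 y1 T).
  by rewrite -lnM ?posrE// ler_ln ?posrE// ple; lra.
have e00 : ln (1 - p0) <= ln (psi0 lambda mu 1 y1 T).
  by rewrite ler_ln ?posrE// ple0; lra.
have e01 : ln p0 + ln y1 <= ln (psi0 lambda mu 1 y1 T).
  by rewrite -lnM ?posrE// ler_ln ?posrE// ple0; lra.
rewrite -eb -e1a -ea.
have := ler_wpM2l h10 e10; have := ler_wpM2l h11 e11.
have := ler_wpM2l h00 e00; have := ler_wpM2l h01 e01.
lra.
Qed.

End MinimalCost.

Section SmallTime.
Context {R : realType}.
Variables (lambda mu : R).
Hypotheses (lambda0 : 0 < lambda) (mu0 : 0 < mu).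

(** The probability that an edge flips within time [T] is small. *)
Definition small_time (T : R) : Prop :=
  [/\ 0 < T, p01 lambda mu T <= 1 / 16 & 1 - p11 lambda mu T <= 1 / 16].

(** The first five costs occur along the two good couplings; the last four are the
costs of breaking the pattern of ones.  The factor 60 and the margin 10 are what
[pairsum_gap] consumes. *)
Definition cost_gap (T eps M : R) : Prop :=
  [/\ [/\ mincost lambda mu T 0 0 <= M, mincost lambda mu T 1 1 <= M,
          mincost lambda mu T eps 0 <= M, mincost lambda mu T 0 eps <= M &
          mincost lambda mu T eps eps <= M] &
      [/\ 60 * M + 10 <= mincost lambda mu T 0 1,
          60 * M + 10 <= mincost lambda mu T 1 0,
          60 * M + 10 <= mincost lambda mu T eps 1 &
          60 * M + 10 <= mincost lambda mu T 1 eps]].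

(** The common factor of the two flip probabilities, about [T] for small [T]; all
costs are compared with its logarithm. *)
Definition flips (T : R) : R := (1 - decay lambda mu T) / (lambda + mu).

Lemma flips_p01 T : p01 lambda mu T = lambda * flips T.
Proof. by rewrite (p01E lambda0 mu0) /flips; field; rewrite gt_eqF// addr_gt0. Qed.

Lemma flips_p11 T : 1 - p11 lambda mu T = mu * flips T.
Proof. by rewrite (p11E lambda0 mu0) /flips; field; rewrite gt_eqF// addr_gt0. Qed.

Lemma flips_gt0 T : 0 < T -> 0 < flips T.
Proof.
by move=> T0; apply: divr_gt0; [rewrite subr_gt0; exact: decay_lt1|exact: addr_gt0].
Qed.

Lemma flips_le T : flips T <= T.
Proof.
rewrite /flips ler_pdivrMr ?addr_gt0// /decay.
have := expR_ge1Dx (- (T * (lambda + mu))); lra.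
Qed.

Lemma ln_half_ge (x : R) : 1 / 2 <= x -> - ln x <= 1.
Proof.
move=> x2; have x0 : 0 < x by lra.
have := @ln_le_sub1 R x^-1; rewrite invr_gt0 x0 lnV ?posrE// => /(_ isT) h.
apply: le_trans h _; have : x^-1 <= 2 by rewrite -[2]invrK lef_pV2 ?posrE; lra.
lra.
Qed.

Section CostBounds.
Variable T : R.
Hypotheses (T0 : 0 < T) (th1 : flips T <= 1).
Local Notation th := (flips T).
Local Notation L := (- ln (flips T)).

Let th0 : 0 < th. Proof. exact: flips_gt0. Qed.

(** The weights [x0 = flips T], [x1 = 1] nearly forbid absent edges at the end. *)
Lemma mincost_up_ge (a : R) : 0 <= a <= 1 -> lambda * th <= 1 ->
  (1 - a) * (L - ln (1 + lambda)) <= mincost lambda mu T a 1.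
Proof.
move=> a01 l1; have o01 : 0 <= (1 : R) <= 1 by rewrite lexx ler01.
apply: le_trans (mincost_ge_cost lambda0 mu0 T0 a01 o01 th0 ltr01).
rewrite /cost subrr mul0r ln1 mulr0 /psi1 /psi0 flips_p01 flips_p11 !mulr1.
have lp : 0 < 1 + lambda by rewrite addr_gt0.
have [a0 a1] := andP a01; have a1' : 0 <= 1 - a by rewrite subr_ge0.
have h1 : ln (mu * th * th + p11 lambda mu T) <= 0.
  apply: ln_le0; have := flips_p11 T.
  have : mu * th * th <= mu * th * 1 by rewrite ler_wpM2l// mulr_ge0// ltW.
  lra.
have h0 : ln ((1 - lambda * th) * th + lambda * th) <= ln (1 + lambda) - L.
  rewrite opprK -lnM ?posrE// ler_ln ?posrE//; last exact: mulr_gt0.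
    have : 0 <= lambda * th * th by apply: mulr_ge0; [apply: mulr_ge0|]; exact: ltW.
    lra.
  by apply: ltr_wpDl; [apply: mulr_ge0; [rewrite subr_ge0|exact: ltW]|exact: mulr_gt0].
have := ler_wpM2l a0 h1; have := ler_wpM2l a1' h0; lra.
Qed.

(** The weights [x0 = 1], [x1 = flips T] nearly forbid present edges at the end. *)
Lemma mincost_down_ge (b : R) : 0 <= b <= 1 ->
  (1 - b) * L - ln (1 + mu) <= mincost lambda mu T 1 b.
Proof.
move=> b01; have o01 : 0 <= (1 : R) <= 1 by rewrite lexx ler01.
apply: le_trans (mincost_ge_cost lambda0 mu0 T0 o01 b01 ltr01 th0).
rewrite /cost subrr mul0r ln1 mulr0 mul1r /psi1 flips_p11 mulr1.
have mp : 0 < 1 + mu by rewrite addr_gt0.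
have p1_gt0 := p11_gt0 lambda0 mu0 (ltW T0); have p1_lt1 := p11_lt1 lambda0 mu0 T0.
have h0 : ln (mu * th + p11 lambda mu T * th) <= ln (1 + mu) - L.
  rewrite opprK -lnM ?posrE// ler_ln ?posrE//; last exact: mulr_gt0.
    have : p11 lambda mu T * th <= 1 * th by rewrite ler_wpM2r// ltW.
    lra.
  by apply: addr_gt0; exact: mulr_gt0.
lra.
Qed.

Hypotheses (l2 : lambda * th <= 1 / 2) (m2 : mu * th <= 1 / 2).

Let lnp1 : - ln (p11 lambda mu T) <= 1.
Proof. by apply: ln_half_ge; have := flips_p11 T; have := m2; lra. Qed.

Let lnq0 : - ln (1 - p01 lambda mu T) <= 1.
Proof. by apply: ln_half_ge; rewrite flips_p01; have := l2; lra. Qed.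

Let lnp0 : ln (p01 lambda mu T) = ln lambda - L.
Proof. by rewrite flips_p01 lnM ?posrE// opprK. Qed.

Let lnq1 : ln (1 - p11 lambda mu T) = ln mu - L.
Proof. by rewrite flips_p11 lnM ?posrE// opprK. Qed.

Lemma mincost_stay_le (a : R) : 0 <= a <= 1 -> mincost lambda mu T a a <= 1.
Proof.
move=> a01; have [a0 a1] := andP a01; have a1' : 0 <= 1 - a by rewrite subr_ge0.
apply: le_trans (mincost_le_coupling lambda0 mu0 T0 (w11 := a) (w10 := 0) (w01 := 0)
  (w00 := 1 - a) a01 a01 a0 (lexx _) (lexx _) a1' _ _ _) _; rewrite ?addr0 ?add0r//.
have := ler_wpM2l a0 lnp1; have := ler_wpM2l a1' lnq0; lra.
Qed.

Lemma mincost_fall_le (a : R) : 0 <= a <= 1 -> mincost lambda mu T a 0 <= a * (L - ln mu) + 1.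
Proof.
move=> a01; have [a0 a1] := andP a01; have a1' : 0 <= 1 - a by rewrite subr_ge0.
have z01 : 0 <= (0 : R) <= 1 by rewrite lexx ler01.
apply: le_trans (mincost_le_coupling lambda0 mu0 T0 (w11 := 0) (w10 := a) (w01 := 0)
  (w00 := 1 - a) a01 z01 (lexx _) a0 (lexx _) a1' _ _ _) _; rewrite ?addr0 ?add0r//.
rewrite lnq1; have := ler_wpM2l a1' lnq0; lra.
Qed.

Lemma mincost_rise_le (b : R) : 0 <= b <= 1 -> mincost lambda mu T 0 b <= b * (L - ln lambda) + 1.
Proof.
move=> b01; have [b0 b1] := andP b01; have b1' : 0 <= 1 - b by rewrite subr_ge0.
have z01 : 0 <= (0 : R) <= 1 by rewrite lexx ler01.
apply: le_trans (mincost_le_coupling lambda0 mu0 T0 (w11 := 0) (w10 := 0) (w01 := b)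
  (w00 := 1 - b) z01 b01 (lexx _) (lexx _) b0 b1' _ _ _) _; rewrite ?addr0 ?add0r ?subr0//.
  by rewrite addrC subrK.
rewrite lnp0; have := ler_wpM2l b1' lnq0; lra.
Qed.

End CostBounds.

Local Notation slack :=
  (ln (1 + lambda) + ln (1 + mu) + `|ln lambda| + `|ln mu| + 1).

(** With [L = - ln (flips T)], the cheap costs are at most [eps * L] and the expensive
ones at least [(1 - eps) * L], up to constants; [eps < 1 / 100] leaves more than a third
of [L] after multiplying the cheap costs by 60. *)
Lemma cost_gap_flips (T eps : R) : 0 < T -> 0 < eps < 1 / 100 -> flips T <= 1 ->
  lambda * flips T <= 1 / 2 -> mu * flips T <= 1 / 2 ->
  160 * slack + 30 <= - ln (flips T) -> exists M, cost_gap T eps M.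
Proof.
move=> T0 /andP[e0 e1] th1 l2 m2.
have e01 : 0 <= eps <= 1 by apply/andP; split; lra.
have z01 : 0 <= (0 : R) <= 1 by rewrite lexx ler01.
have o01 : 0 <= (1 : R) <= 1 by rewrite lexx ler01.
have l1 : lambda * flips T <= 1 by lra.
have S00 := mincost_stay_le T0 l2 m2 z01; have S11 := mincost_stay_le T0 l2 m2 o01.
have See := mincost_stay_le T0 l2 m2 e01; have Se0 := mincost_fall_le T0 l2 e01.
have S0e := mincost_rise_le T0 l2 e01.
have U0 := mincost_up_ge T0 th1 z01 l1; have Ue := mincost_up_ge T0 th1 e01 l1.
have D0 := mincost_down_ge T0 z01; have De := mincost_down_ge T0 e01.
have A1 : 0 <= ln (1 + lambda) by rewrite ln_ge0 ?lerDl ?ltW.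
have A2 : 0 <= ln (1 + mu) by rewrite ln_ge0 ?lerDl ?ltW.
have A3 : - ln lambda <= `|ln lambda| by rewrite -normrN ler_norm.
have A4 : - ln mu <= `|ln mu| by rewrite -normrN ler_norm.
have A5 := normr_ge0 (ln lambda); have A6 := normr_ge0 (ln mu).
move: (- ln (flips T)) (ln (1 + lambda)) (ln (1 + mu)) (ln lambda) (ln mu)
  `|ln lambda| `|ln mu| S0e Se0 U0 Ue D0 De A1 A2 A3 A4 A5 A6.
clear T0 th1 l1 l2 m2 z01 o01.
move=> L a1 a2 b1 b2 c1 c2 S0e Se0 U0 Ue D0 De A1 A2 A3 A4 A5 A6 hL.
have e0' := ltW e0; have e1' : eps <= 1 by lra.
have eA1 : eps * (- b1) <= c1.
  by apply: le_trans (ler_wpM2l e0' A3) _; exact: ler_piMl.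
have eA2 : eps * (- b2) <= c2.
  by apply: le_trans (ler_wpM2l e0' A4) _; exact: ler_piMl.
have eL : 0 <= eps * L by apply: mulr_ge0 => //; lra.
have eL2 : eps * L <= 1 / 100 * L by apply: ler_wpM2r; lra.
have ea : 0 <= eps * a1 by exact: mulr_ge0.
have Mb : 60 * (eps * L + (c1 + c2 + 1)) + 10 <= (1 - eps) * L - a1 - a2 by lra.
exists (eps * L + (c1 + c2 + 1)).
clear A3 A4 eL2 hL e1.
by split; split; lra.
Qed.

Theorem exists_small_time : exists2 T0 : R, 0 < T0 & forall T : R, 0 < T < T0 ->
  small_time T /\ forall eps : R, 0 < eps < 1 / 100 -> exists M, cost_gap T eps M.
Proof.
have l1 : 0 <= ln (1 + lambda) by rewrite ln_ge0 ?lerDl ?ltW.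
have m1 : 0 <= ln (1 + mu) by rewrite ln_ge0 ?lerDl ?ltW.
have nl0 := normr_ge0 (ln lambda); have nm0 := normr_ge0 (ln mu).
exists (expR (- (160 * slack + 30))); first exact: expR_gt0.
move=> T /andP[T0 TT]; set th := flips T.
have th0 : 0 < th by exact: flips_gt0.
have hL : 160 * slack + 30 <= - ln th.
  rewrite lerNr -[leRHS]expRK ler_ln ?posrE// ?expR_gt0//.
  by apply: le_trans (ltW TT); exact: flips_le.
have small c : 0 < c -> ln (1 + c) <= slack -> c * th <= 1 / 31.
  move=> c0 hc; have -> : c * th = expR (ln c + ln th) by rewrite expRD !lnK ?posrE.
  have : ln c <= ln (1 + c) by rewrite ler_ln ?posrE ?addr_gt0// lerDr.
  move=> lc; apply: (@le_trans _ _ (expR (- 30))); first by rewrite ler_expR; lra.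
  rewrite expRN div1r lef_pV2 ?posrE ?expR_gt0//.
  by have := expR_ge1Dx (30 : R); lra.
have sl : lambda * th <= 1 / 31 by apply: small => //; lra.
have sm : mu * th <= 1 / 31 by apply: small => //; lra.
have s1 : th <= 1.
  have -> : th = expR (ln th) by rewrite lnK ?posrE.
  rewrite -[leRHS]expR0 ler_expR; lra.
split; first by split => //; rewrite ?flips_p01 ?flips_p11 -/th; lra.
by move=> eps eps01; apply: cost_gap_flips => //; rewrite -/th; lra.
Qed.

End SmallTime.

(** * Relabellings of the unit square *)

Section SquareMaps.
Context {R : realType}.
Local Notation leb := (@lebesgue_measure R).
Local Notation leb2 := (leb \x leb)%E.
Local Notation TR := (measurableTypeR R).
Implicit Types (sigma tau : R -> R) (h g : R * R -> R).

Lemma measurable_I01 : measurable (@I01 R : set TR).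
Proof. exact: measurable_itv. Qed.

Lemma leb_I01 : leb (@I01 R) = 1%E.
Proof. by rewrite /I01 lebesgue_measure_itv/= lte_fin ltr01 EFinN sube0. Qed.

Lemma leb_I01_lty : (leb (@I01 R) < +oo)%E.
Proof. by rewrite leb_I01 ltry. Qed.

Lemma leb2_sqr01 : leb2 (@sqr01 R) = 1%E.
Proof.
transitivity (leb (@I01 R) * leb (@I01 R))%E; last by rewrite leb_I01 mule1.
by apply: product_measure1E; exact: measurable_I01.
Qed.

Definition leb01 : {finite_measure set TR -> \bar R} := mfrestr measurable_I01 leb_I01_lty.

Definition smap sigma (z : R * R) : R * R := (sigma z.1, sigma z.2).

Lemma mp_itv sigma x : measure_preserving sigma -> I01 x -> I01 (sigma x).
Proof. by move=> [+ _ _]; exact. Qed.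

Lemma mp_sqr01 sigma z : measure_preserving sigma -> sqr01 z -> sqr01 (smap sigma z).
Proof. by move=> mp [z1 z2]; split; exact: mp_itv. Qed.

Lemma mp_measurable_preimage sigma (A : set TR) : measure_preserving sigma ->
  measurable A -> measurable (I01 `&` sigma @^-1` A : set TR).
Proof.
by move=> [_ ms _] mA; have := ms measurable_I01 A mA.
Qed.

Lemma mp_preimage sigma (A : set TR) : measure_preserving sigma -> measurable A ->
  leb (I01 `&` sigma @^-1` A) = leb (I01 `&` A).
Proof.
move=> [sI ms sm] mA; rewrite -(sm (I01 `&` A)).
- congr (leb _); apply/seteqP; split => x /= [x01 xA]; split => //.
    by split => //; exact: sI.
  by case: xA.
- by apply: measurableI => //; exact: measurable_I01.
- by move=> x [].
Qed.

(** A measure on the square is determined by rectangles. *)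
Lemma sqr_measure_unique (M : {measure set (TR * TR)%type -> \bar R}) :
  (forall A B : set TR, measurable A -> measurable B ->
     M (A `*` B) = (leb (A `&` I01) * leb (B `&` I01))%E) ->
  forall X : set (TR * TR), measurable X -> (leb01 \x leb01)%E X = M X.
Proof. by move=> H; exact: product_measure_unique. Qed.

(** A relabelling is only controlled on the unit interval; outside it is replaced by
0 to obtain a globally measurable map. *)
Definition mmap sigma : R -> R := sigma \_ I01.

Lemma measurable_mmap sigma : measure_preserving sigma ->
  measurable_fun (setT : set TR) (mmap sigma : TR -> TR).
Proof.
by move=> [_ ms _]; apply/(measurable_restrictT _ measurable_I01); exact: ms.
Qed.

Lemma measurable_smap sigma : measure_preserving sigma ->
  measurable_fun (setT : set (TR * TR)) (smap (mmap sigma) : TR * TR -> TR * TR).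
Proof.
move=> mp; have mm := measurable_mmap mp.
apply: measurable_fun_pair => /=.
  exact: (measurableT_comp mm measurable_fst).
exact: (measurableT_comp mm measurable_snd).
Qed.

Lemma sqr01_measure (X : set (TR * TR)) : measurable X ->
  (leb01 \x leb01)%E X = leb2 (X `&` sqr01).
Proof.
move=> mX; have mS : measurable (@sqr01 R : set (TR * TR)) := measurable_sqr01.
apply: (sqr_measure_unique (M := mrestr leb2 mS)) => //= A B mA mB.
rewrite /mrestr /sqr01 -setXI.
by apply: product_measure1E; apply: measurableI => //; exact: measurable_I01.
Qed.

(** Both sides are measures in [X] that agree on rectangles. *)
Theorem mp_square sigma (X : set (TR * TR)) : measure_preserving sigma -> measurable X ->
  leb2 (sqr01 `&` smap sigma @^-1` X) = leb2 (sqr01 `&` X).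
Proof.
move=> mp mX.
pose M : {measure set (TR * TR)%type -> \bar R} :=
  measure_function_pushforward__canonical__measure_function_Measure
    (leb01 \x leb01)%E (measurable_smap mp).
have E : (leb01 \x leb01)%E X = M X.
  apply: sqr_measure_unique => // A B mA mB.
  have mm := measurable_mmap mp.
  have mmA : measurable (mmap sigma @^-1` A : set TR).
    by rewrite -[X in measurable X]setTI; exact: mm.
  have mmB : measurable (mmap sigma @^-1` B : set TR).
    by rewrite -[X in measurable X]setTI; exact: mm.
  have -> : M (A `*` B) = (leb01 \x leb01)%E (mmap sigma @^-1` A `*` mmap sigma @^-1` B).
    by [].
  have aux (C : set TR) : measurable C -> leb01 (mmap sigma @^-1` C) = leb (C `&` I01).
    move=> mC; rewrite setIC -(mp_preimage mp mC) /leb01/= /mfrestr /mrestr.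
    congr (leb _); apply/seteqP; split => x /=.
      by move=> [+ x01]; rewrite /mmap patchE mem_set.
    by move=> [x01 +]; rewrite /mmap patchE mem_set.
  transitivity (leb01 (mmap sigma @^-1` A) * leb01 (mmap sigma @^-1` B))%E.
    exact: product_measure1E.
  by rewrite !aux.
rewrite (setIC sqr01 X) -sqr01_measure// E.
have -> : M X = (leb01 \x leb01)%E (smap (mmap sigma) @^-1` X) by [].
rewrite sqr01_measure; last first.
  by rewrite -[X in measurable X]setTI; exact: (measurable_smap mp).
congr (leb2 _); apply/seteqP; split => -[x y] /=; rewrite /smap/= /mmap.
  by move=> [[x01 y01] +]; rewrite !patchE !mem_set//.
by move=> [+ [x01 y01]]; rewrite !patchE !mem_set//.
Qed.

Lemma measurable_smap_preimage sigma (X : set (TR * TR)) : measure_preserving sigma ->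
  measurable X -> measurable (sqr01 `&` smap sigma @^-1` X : set (TR * TR)).
Proof.
move=> mp mX.
have -> : sqr01 `&` smap sigma @^-1` X = sqr01 `&` smap (mmap sigma) @^-1` X.
  apply/seteqP; split => -[x y] /= [[x01 y01] +]; rewrite /smap/= /mmap;
  by rewrite !patchE !mem_set.
apply: measurableI; first exact: measurable_sqr01.
by rewrite -[X in measurable X]setTI; exact: (measurable_smap mp).
Qed.

Lemma ae_sqr_comp sigma (P : R * R -> Prop) : measure_preserving sigma ->
  {ae leb2, forall z, sqr01 z -> P z} ->
  {ae leb2, forall z, sqr01 z -> P (smap sigma z)}.
Proof.
move=> mp [N [mN N0 PN]].
exists (sqr01 `&` smap sigma @^-1` N); split.
- exact: measurable_smap_preimage.
- rewrite mp_square//; apply/eqP; rewrite eq_le measure_ge0 andbT.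
  rewrite -[X in (_ <= X)%E]N0; apply: le_measure; rewrite ?inE//=.
  by apply: measurableI => //; exact: measurable_sqr01.
- move=> z /= /not_implyP[z01 nP]; split => //; apply: PN => /= H; apply: nP.
  by apply: H; exact: mp_sqr01.
Qed.

Lemma ae_comp sigma (P : R -> Prop) : measure_preserving sigma ->
  {ae leb, forall x, I01 x -> P x} -> {ae leb, forall x, I01 x -> P (sigma x)}.
Proof.
move=> mp [N [mN N0 PN]].
exists (I01 `&` sigma @^-1` N); split.
- exact: mp_measurable_preimage.
- rewrite mp_preimage//; apply/eqP; rewrite eq_le measure_ge0 andbT.
  rewrite -[X in (_ <= X)%E]N0; apply: le_measure; rewrite ?inE//=.
  by apply: measurableI => //; exact: measurable_I01.
- move=> z /= /not_implyP[z01 nP]; split => //; apply: PN => /= H; apply: nP.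
  by apply: H; exact: mp_itv.
Qed.

Lemma ae_coords (P : R -> Prop) : {ae leb, forall x, I01 x -> P x} ->
  {ae leb2, forall z, sqr01 z -> P z.1 /\ P z.2}.
Proof.
move=> [N [mN N0 PN]].
exists ((N `*` setT) `|` (setT `*` N)); split.
- by apply: measurableU; apply: measurableX.
- apply/eqP; rewrite eq_le measure_ge0 andbT.
  have e1 : leb2 (N `*` setT) = 0%E.
    transitivity (leb N * leb setT)%E; first exact: product_measure1E.
    by rewrite N0 mul0e.
  have e2 : leb2 (setT `*` N) = 0%E.
    transitivity (leb setT * leb N)%E; first exact: product_measure1E.
    by rewrite N0 mule0.
  apply: (@le_trans _ _ (leb2 (N `*` setT) + leb2 (setT `*` N))%E).
    by apply: measureU2; apply: measurableX.
  by rewrite e1 e2 adde0.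
- move=> [x y] /= /not_implyP[[x01 y01]] /not_andP[nP|nP]; [left|right]; split => //=.
    by apply: PN => /= H; apply: nP; exact: H.
  by apply: PN => /= H; apply: nP; exact: H.
Qed.

Lemma mp_comp sigma tau : measure_preserving sigma -> measure_preserving tau ->
  measure_preserving (sigma \o tau).
Proof.
move=> mps mpt; split.
- by move=> x x01; exact: (mp_itv mps (mp_itv mpt x01)).
- move=> _ B mB.
  have -> : I01 `&` (sigma \o tau) @^-1` B = I01 `&` tau @^-1` (I01 `&` sigma @^-1` B).
    apply/seteqP; split => x /= [x01 xB]; split => //; last by case: xB.
    by split => //; exact: mp_itv.
  by apply: mp_measurable_preimage => //; exact: mp_measurable_preimage.
- move=> B mB BI.
  have -> : I01 `&` (sigma \o tau) @^-1` B = I01 `&` tau @^-1` (I01 `&` sigma @^-1` B).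
    apply/seteqP; split => x /= [x01 xB]; split => //; last by case: xB.
    by split => //; exact: mp_itv.
  rewrite mp_preimage//; last exact: mp_measurable_preimage.
  by rewrite setIA setIid mp_preimage// setIidr.
Qed.

Lemma mp_id : measure_preserving (@idfun R).
Proof.
split => //; first by apply: measurable_funTS; exact: measurable_id.
by move=> B mB BI; congr (leb _); apply/seteqP; split => x /= => [[]|xB] //; split => //; exact: BI.
Qed.

Lemma aeS (P Q : R -> Prop) : (forall x, P x -> Q x) ->
  {ae leb, forall x, P x} -> {ae leb, forall x, Q x}.
Proof.
by move=> PQ [N [mN N0 PN]]; exists N; split => // x /= nQ; apply: PN => /= /PQ.
Qed.

Lemma mpb_id : mp_bijection (@idfun R).
Proof.
split; first exact: mp_id; exists idfun; split; first exact: mp_id.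
  by apply: (aeS (P := fun=> True)) => //; exact: aeW.
by apply: (aeS (P := fun=> True)) => //; exact: aeW.
Qed.

Lemma ae2I (P Q : R -> Prop) : {ae leb, forall x, I01 x -> P x} ->
  {ae leb, forall x, I01 x -> Q x} -> {ae leb, forall x, I01 x -> P x /\ Q x}.
Proof.
have aef := ae_filter_ringOfSetsType leb.
by apply: filterS2 => x hP hQ x01; split; [exact: hP|exact: hQ].
Qed.

Lemma mpb_comp sigma tau : mp_bijection sigma -> mp_bijection tau ->
  mp_bijection (sigma \o tau).
Proof.
move=> [mps [sigma' [mps' ss' s's]]] [mpt [tau' [mpt' tt' t't]]].
split; first exact: mp_comp.
exists (tau' \o sigma'); split; first exact: mp_comp.
- have := ae2I (ae_comp mpt ss') tt'; apply: aeS => x H x01.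
  by have /= [-> ->] := H x01.
- have := ae2I (ae_comp mps' t't) s's; apply: aeS => x H x01.
  by have /= [-> ->] := H x01.
Qed.

Lemma aeS2 (P Q : R * R -> Prop) : (forall x, P x -> Q x) ->
  {ae leb2, forall x, P x} -> {ae leb2, forall x, Q x}.
Proof.
by move=> PQ [N [mN N0 PN]]; exists N; split => // x /= nQ; apply: PN => /= /PQ.
Qed.

Lemma ae2I2 (P Q : R * R -> Prop) : {ae leb2, forall x, sqr01 x -> P x} ->
  {ae leb2, forall x, sqr01 x -> Q x} -> {ae leb2, forall x, sqr01 x -> P x /\ Q x}.
Proof.
have aef := ae_filter_ringOfSetsType (leb2 : {measure set (TR * TR)%type -> \bar R}).
by apply: filterS2 => x hP hQ x01; split; [exact: hP|exact: hQ].
Qed.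

Lemma gequiv_refl h : gequiv h h.
Proof.
exists idfun; first exact: mpb_id.
by apply: (aeS2 (P := fun=> True)) => [[x y]//|]; exact: aeW.
Qed.

Lemma gequiv_trans h1 h2 h3 : gequiv h1 h2 -> gequiv h2 h3 -> gequiv h1 h3.
Proof.
move=> [sigma ms hs] [tau mt ht].
exists (tau \o sigma); first exact: mpb_comp.
have := ae2I2 hs (ae_sqr_comp ms.1 ht); apply: aeS2 => z H z01.
by have [-> ] := H z01; rewrite /relabel /smap /= => ->.
Qed.

Lemma gequiv_sym h g : gequiv h g -> gequiv g h.
Proof.
move=> [sigma [ms [tau [mt st ts]]] hs]; exists tau.
  by split => //; exists sigma; split.
have := ae2I2 (ae_sqr_comp mt hs) (ae_coords ts); apply: aeS2 => -[x y] H z01.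
by have := H z01; rewrite /relabel /smap /= => -[-> [-> ->]].
Qed.

Lemma gclass_eq h g : gequiv h g -> gclass h = gclass g.
Proof.
move=> hg; apply/seteqP; split => k [gk kh]; split => //; apply: gequiv_trans kh _ => //.
exact: gequiv_sym.
Qed.

Lemma gclass_gequiv h g : graphon h -> gclass h = gclass g -> gequiv h g.
Proof.
move=> gh E; have : gclass h h by split => //; exact: gequiv_refl.
by rewrite E => -[]. Qed.

End SquareMaps.

(** * Realising block labels by measure-preserving bijections *)

Section Quantile.
Context {R : realType}.
Local Notation leb := (@lebesgue_measure R).
Local Notation TR := (measurableTypeR R).
Variables (B : set R) (a c : R).
Hypotheses (mB : measurable (B : set TR)) (BI : B `<=` I01) (Bc : leb B = c%:E).
Implicit Types (x y : R).

(** The distribution function of the part [B], shifted so that it maps [B] onto an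
interval of the same length starting at [a]. *)
Definition cumul x : R := a + fine (leb (B `&` `]-oo, x]%classic)).

Let part x := leb (B `&` `]-oo, x]%classic).

Let mray x : measurable (B `&` `]-oo, x]%classic : set TR).
Proof. by apply: measurableI => //; exact: measurable_itv. Qed.

Let part_fin x : part x \is a fin_num.
Proof.
rewrite ge0_fin_numE; last exact: measure_ge0.
apply: (@le_lt_trans _ _ (leb B)); last by rewrite Bc ltry.
by apply: le_measure; rewrite ?inE//; exact: mray.
Qed.

Lemma cumulE x : (cumul x - a)%:E = leb (B `&` `]-oo, x]%classic).
Proof. by rewrite /cumul addrC addKr fineK//; exact: part_fin. Qed.

Lemma cumul_ge x : a <= cumul x.
Proof. by rewrite -subr_ge0 -lee_fin cumulE measure_ge0. Qed.

Lemma cumul_le x : cumul x <= a + c.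
Proof.
by rewrite -lerBlDl -lee_fin cumulE -Bc; apply: le_measure; rewrite ?inE//; exact: mray.
Qed.

Lemma cumul_nd : nondecreasing cumul.
Proof.
move=> x y xy; rewrite -(lerD2r (- a)) -lee_fin !cumulE.
apply: le_measure; rewrite ?inE//.
by apply: setIS; apply: subset_itvl; rewrite bnd_simp.
Qed.

Lemma cumul_lip x y : x <= y -> cumul y - cumul x <= y - x.
Proof.
move=> xy.
have : (part y <= part x + leb `]x, y]%classic)%E.
  apply: (@le_trans _ _ (leb ((B `&` `]-oo, x]) `|` `]x, y]%classic))).
    apply: le_measure; rewrite ?inE; [exact: mray| |].
      by apply: measurableU; [exact: mray|exact: measurable_itv].
    move=> z /= [Bz]; rewrite !in_itv/= => zy; case: (leP z x) => zx; [left|right] => //.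
  by apply: measureU2; [exact: mray|exact: measurable_itv].
rewrite lebesgue_measure_itv/= lte_fin /part -!cumulE; case: ifPn => [_|].
  by rewrite -EFinB -EFinD lee_fin; lra.
by rewrite -leNgt => yx; rewrite adde0 lee_fin; lra.
Qed.

Lemma cumul0 x : x <= 0 -> cumul x = a.
Proof.
move=> x0; apply/eqP; rewrite -subr_eq0 -eqe cumulE eq_le measure_ge0 andbT.
have -> : 0%:E = leb [set (0 : R)] by rewrite lebesgue_measure_set1.
apply: le_measure; rewrite ?inE//.
move=> z /= [/BI]; rewrite /I01/= !in_itv/= => /andP[z0 _] zx.
by apply/eqP; rewrite eq_le z0 (le_trans zx).
Qed.

Lemma cumul1 x : 1 <= x -> cumul x = a + c.
Proof.
move=> x1; apply/eqP; rewrite addrC -subr_eq -eqe cumulE -Bc; apply/eqP.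
congr (leb _); apply/seteqP; split => [z []//|z Bz]; split => //=.
by have := BI Bz; rewrite /I01/= !in_itv/= => /andP[_ z1]; exact: le_trans x1.
Qed.

(** The left inverse of [cumul].  Capping [y] at [a + c] keeps the set nonempty for
every [y], hence the function monotone on the whole line. *)
Definition quantile y : R := inf [set x | I01 x /\ Num.min y (a + c) <= cumul x].

Let has y : [set x | I01 x /\ Num.min y (a + c) <= cumul x] 1.
Proof.
split; first by rewrite /I01/= in_itv/= ler01 lexx.
by rewrite cumul1// ge_min lexx orbT.
Qed.

Let hlb y : has_lbound [set x | I01 x /\ Num.min y (a + c) <= cumul x].
Proof. by exists 0 => x [+ _]; rewrite /I01/= in_itv/= => /andP[]. Qed.

Lemma quantile_itv y : I01 (quantile y).
Proof.
rewrite /I01/= in_itv/=; apply/andP; split.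
  apply: lb_le_inf; first by exists 1; exact: has.
  by move=> x [+ _]; rewrite /I01/= in_itv/= => /andP[].
by apply: ge_inf => //; exact: hlb.
Qed.

Lemma quantile_nd : nondecreasing quantile.
Proof.
move=> y y' yy'; apply: lb_le_inf; first by exists 1; exact: has.
move=> x [x01 h]; apply: ge_inf; first exact: hlb.
split => //; apply: le_trans h; rewrite le_min !ge_min yy' /=.
by rewrite lexx orbT.
Qed.

(** The distribution function is continuous, being 1-Lipschitz, so no value is
skipped. *)
Lemma cumul_quantile y : a < y <= a + c -> cumul (quantile y) = y.
Proof.
move=> /andP[ay yc]; have my : Num.min y (a + c) = y by rewrite (min_idPl yc).
apply/eqP; rewrite eq_le; apply/andP; split; rewrite leNgt; apply/negP => lt.
- pose q := quantile y; pose e := cumul q - y.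
  have e0 : 0 < e by rewrite subr_gt0.
  have := quantile_itv y; rewrite /I01/= in_itv/= -/q => /andP[q0 q1].
  have qe : 0 <= q - e.
    rewrite leNgt; apply/negP => qe.
    have := cumul_lip q0; rewrite (cumul0 (lexx 0)) => h.
    by move: qe; rewrite /e; lra.
  have : quantile y <= q - e.
    apply: ge_inf; first exact: hlb.
    split; first by rewrite /I01/= in_itv/= qe /=; lra.
    have qq : q - e <= q by lra.
    by rewrite my; have := cumul_lip qq; rewrite {2}/e; lra.
  by rewrite -/q; lra.
- have : quantile y + (y - cumul (quantile y)) <= quantile y.
    apply: lb_le_inf; first by exists 1; exact: has.
    move=> x [x01]; rewrite my => yx.
    have qx : quantile y <= x.
      by apply: ge_inf; [exact: hlb|split => //; rewrite my].
    by have := cumul_lip qx; lra.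
  by lra.
Qed.

Lemma quantile_le y x : a < y <= a + c -> (quantile y <= x) = (y <= cumul x).
Proof.
move=> yac; have /andP[ay yc] := yac; apply/idP/idP => h.
  by rewrite -(cumul_quantile yac); exact: cumul_nd.
have x0 : 0 <= x.
  by rewrite leNgt; apply/negP => x0; move: h; rewrite cumul0 ?(ltW x0)// leNgt ay.
case: (leP x 1) => x1.
  apply: ge_inf; first exact: hlb.
  by split; [rewrite /I01/= in_itv/= x0|rewrite (min_idPl yc)].
have := quantile_itv y; rewrite /I01/= in_itv/= => /andP[_ q1].
exact: le_trans (ltW x1).
Qed.

Lemma measurable_cumul : measurable_fun (setT : set TR) (cumul : TR -> TR).
Proof. by apply: nondecreasing_measurable => // x y; exact: cumul_nd. Qed.

Lemma measurable_quantile : measurable_fun (setT : set TR) (quantile : TR -> TR).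
Proof. by apply: nondecreasing_measurable => // x y; exact: quantile_nd. Qed.

(** Two measures are compared on the half-lines [x, +oo), where both are increments
of the distribution function. *)
Theorem quantile_push (E : set TR) : measurable E ->
  leb (`]a, a + c]%classic `&` quantile @^-1` E) = leb (B `&` E).
Proof.
have mJ : measurable (`]a, a + c]%classic : set TR) by exact: measurable_itv.
pose m1 : {measure set TR -> \bar R} :=
  measure_function_pushforward__canonical__measure_function_Measure
    (mrestr leb mJ) measurable_quantile.
pose m2 : {measure set TR -> \bar R} := mrestr leb mB.
have m1E X : m1 X = leb (`]a, a + c]%classic `&` quantile @^-1` X) by rewrite setIC.
have m2E X : m2 X = leb (B `&` X) by rewrite setIC.
move=> mE; rewrite -m1E -m2E; move: E mE.
apply: (@measure_unique _ R TR (@RGenOInfty.G R) (fun n => `](- n%:R), +oo[%classic)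
  _ _ _ _ m1 m2).
- by rewrite RGenOInfty.measurableE.
- move=> _ _ [x ->] [y ->]; exists (Num.max x y).
  by apply/seteqP; split => z /=; rewrite !in_itv/= !andbT gt_max => /andP.
- by move=> n; exists (- n%:R).
- apply/seteqP; split => // x _; exists (Num.truncn `|x|).+1 => //=.
  rewrite in_itv/= andbT ltrNl (le_lt_trans (ler_norm _))// normrN.
  exact: truncnS_gt.
- move=> _ [x ->]; rewrite m1E m2E.
  have -> : `]a, a + c]%classic `&` quantile @^-1` `]x, +oo[%classic =
      `]cumul x, a + c]%classic.
    apply/seteqP; split => y /=; rewrite !in_itv/= !andbT.
      by move=> [yac]; rewrite !ltNge quantile_le// => ->; case/andP: yac.
    move=> /andP[xy yc].
    have yac : a < y <= a + c by rewrite yc (le_lt_trans (cumul_ge x)).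
    by split => //; rewrite ltNge quantile_le// -ltNge.
  have -> : B `&` `]x, +oo[%classic = B `\` (B `&` `]-oo, x]%classic).
    apply/seteqP; split => y /=; rewrite !in_itv/= ?andbT.
      by move=> [By xy]; split => // -[_]; rewrite leNgt xy.
    by move=> [By h]; split => //; rewrite ltNge; apply/negP => yx; apply: h.
  have -> : leb (B `\` (B `&` `]-oo, x]%classic)) =
      (leb B - leb (B `&` (B `&` `]-oo, x]%classic)))%E.
    by apply: measureD => //; rewrite [X in (X < _)%E]Bc ltry.
  rewrite setIA setIid Bc -cumulE lebesgue_measure_itv/= lte_fin; case: ifPn => h.
    by rewrite -!EFinB; congr EFin; ring.
  have := cumul_le x; rewrite -leNgt in h => h'.
  by rewrite -EFinB; congr EFin; lra.
- move=> n; rewrite m1E; apply: (@le_lt_trans _ _ (leb `]a, a + c]%classic)).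
    apply: le_measure; rewrite ?inE//; apply: measurableI => //.
    rewrite -[X in measurable X]setTI; apply: measurable_quantile => //.
  by rewrite lebesgue_measure_itv/=; case: ifP => _; rewrite ?ltry -?EFinB ?ltry.
Qed.

End Quantile.

Lemma measure_parts d (X : measurableType d) (R : realType)
    (m : {measure set X -> \bar R}) (J : finType) (c : X -> J) (D : set X) :
  (forall j, measurable (D `&` c @^-1` [set j])) ->
  m D = (\sum_(j : J) m (D `&` c @^-1` [set j]))%E.
Proof.
move=> mD.
have DE : D = \bigcup_(j in [set` index_enum J]) (D `&` c @^-1` [set j]).
  apply/seteqP; split => [x Dx|x [j _ []]//].
  by exists (c x) => //=; rewrite mem_index_enum.
rewrite {1}DE measure_fin_bigcup//=.
- by rewrite -fsbig_seq// index_enum_uniq.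
- by move=> i j _ _ [x [[_ /= <-] [_ /= <-]]].
Qed.

Section Blocks.
Context {R : realType}.
Local Notation leb := (@lebesgue_measure R).
Local Notation leb2 := (leb \x leb)%E.
Local Notation TR := (measurableTypeR R).
Implicit Types (x y : R) (k : R -> 'I_3) (i : 'I_3).

Definition o0 : 'I_3 := Ordinal (isT : 0 < 3)%N.
Definition o1 : 'I_3 := Ordinal (isT : 1 < 3)%N.
Definition o2 : 'I_3 := Ordinal (isT : 2 < 3)%N.

Lemma ord3P (P : 'I_3 -> Prop) : P o0 -> P o1 -> P o2 -> forall i, P i.
Proof.
move=> h0 h1 h2 [[|[|[|//]]] h].
- by have -> : Ordinal h = o0 by exact: val_inj.
- by have -> : Ordinal h = o1 by exact: val_inj.
- by have -> : Ordinal h = o2 by exact: val_inj.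
Qed.

(** The index of the interval of the example that contains the point. *)
Definition blk x : 'I_3 := if x < 1 / 5 then o0 else if x < 3 / 5 then o1 else o2.

Definition left i : R := match val i with 0%N => 0 | 1%N => 1 / 5 | _ => 3 / 5 end.
Definition len i : R := match val i with 0%N => 1 / 5 | _ => 2 / 5 end.

Definition part (J : finType) (k : R -> J) (j : J) : set R := I01 `&` k @^-1` [set j].

Definition measurable_label (J : finType) (k : R -> J) :=
  forall j, measurable (part k j : set TR).

(** The same partition with the endpoints assigned to the block on the left, as the
half-open intervals of the quantile functions require. *)
Definition lblk x : 'I_3 := if x <= 1 / 5 then o0 else if x <= 3 / 5 then o1 else o2.

Lemma lblkP i x : 0 < x <= 1 -> lblk x = i <-> left i < x <= left i + len i.
Proof.
move=> /andP[x0 x1]; rewrite /lblk; elim/ord3P: i; rewrite /left /len /=;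
  case: (leP x (1 / 5)) => h; [|case: (leP x (3 / 5)) => h'| |case: (leP x (3 / 5)) => h'
    | |case: (leP x (3 / 5)) => h'];
  by split => [/(congr1 val)//= _|/andP[h1 h2]];
    first [by []|by apply/andP; split; lra|by exfalso; lra|by lra].
Qed.

Lemma blkP i x : 0 <= x < 1 -> blk x = i <-> left i <= x < left i + len i.
Proof.
move=> /andP[x0 x1]; rewrite /blk; elim/ord3P: i; rewrite /left /len /=;
  case: (ltP x (1 / 5)) => h; [|case: (ltP x (3 / 5)) => h'| |case: (ltP x (3 / 5)) => h'
    | |case: (ltP x (3 / 5)) => h'];
  by split => [/(congr1 val)//= _|/andP[h1 h2]];
    first [by []|by apply/andP; split; lra|by exfalso; lra|by lra].
Qed.

Lemma left_ge0 i : 0 <= left i.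
Proof. by elim/ord3P: i; rewrite /left /=; lra. Qed.

Lemma len_gt0 i : 0 < len i.
Proof. by elim/ord3P: i; rewrite /len /=; lra. Qed.

Lemma left_len_le1 i : left i + len i <= 1.
Proof. by elim/ord3P: i; rewrite /left /len /=; lra. Qed.

Lemma leb_parts k (X : set TR) : measurable_label k -> measurable X -> X `<=` I01 ->
  leb X = (\sum_i leb (part k i `&` X))%E.
Proof.
move=> mk mX XI.
have E i : X `&` k @^-1` [set i] = part k i `&` X.
  apply/seteqP; split => x /= [h1 h2]; first by split => //; split => //; exact: XI.
  by case: h1.
under eq_bigr do rewrite -E.
by apply: measure_parts => i; rewrite E; apply: measurableI => //; exact: mk.
Qed.

Lemma leb_set0_eq (A B : set TR) (N : set TR) : measurable A -> measurable B ->
  measurable N -> leb N = 0%E -> A `\` N = B `\` N -> leb A = leb B.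
Proof.
move=> mA mB mN N0 AB.
have aux (C : set TR) : measurable C -> leb C = leb (C `\` N).
  move=> mC; rewrite -[in LHS](setUIDK C N) [LHS]measureU//.
  - rewrite (_ : _ (C `&` N) = 0%E) ?add0e//.
    by apply/eqP; rewrite eq_le measure_ge0 andbT -N0 le_measure ?inE//; exact: measurableI.
  - exact: measurableI.
  - exact: measurableD.
  - by apply/seteqP; split => // x [[_ +] []].
by rewrite (aux A)// AB -aux.
Qed.

Lemma measurable_lblk : measurable_label lblk.
Proof.
have mI := @measurable_I01 R.
have E i : part lblk i = I01 `&` [set` match val i with 0%N => `]-oo, 1 / 5]%R
    | 1%N => `]1 / 5, 3 / 5]%R | _ => `]3 / 5, +oo[%R end].
  apply/seteqP; rewrite /part /lblk; elim/ord3P: i; split => x /= [x01];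
    rewrite in_itv/= ?andbT; case: (leP x (1 / 5)) => h;
    try (case: (leP x (3 / 5)) => h'); move=> H; split => //;
    try (by move/(congr1 val): H); exfalso; lra.
by move=> i; rewrite E; apply: measurableI => //; elim/ord3P: i; exact: measurable_itv.
Qed.

Lemma measurable_blk : measurable_label blk.
Proof.
have mI := @measurable_I01 R.
have E i : part blk i = I01 `&` [set` match val i with 0%N => `]-oo, 1 / 5[%R
    | 1%N => `[1 / 5, 3 / 5[%R | _ => `[3 / 5, +oo[%R end].
  apply/seteqP; rewrite /part /blk; elim/ord3P: i; split => x /= [x01];
    rewrite in_itv/= ?andbT; case: (ltP x (1 / 5)) => h;
    try (case: (ltP x (3 / 5)) => h'); move=> H; split => //;
    try (by move/(congr1 val): H); exfalso; lra.
by move=> i; rewrite E; apply: measurableI => //; elim/ord3P: i; exact: measurable_itv.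
Qed.

(** The block endpoints, where [blk] and [lblk] may differ. *)
Definition corners : set R := [set x | exists i, x = left i \/ x = left i + len i].

Lemma corners_null : measurable (corners : set TR) /\ leb corners = 0%E.
Proof.
have fin : finite_set corners.
  have -> : corners = (left @` setT) `|` ((fun i => left i + len i) @` setT).
    apply/seteqP; split => x.
      by move=> [i [->|->]]; [left|right]; exists i.
    by move=> [[i _ <-]|[i _ <-]]; exists i; [left|right].
  by rewrite finite_setU; split; apply: finite_image; exact: finite_finset.
split; last exact/countable_lebesgue_measure0/finite_set_countable.
by apply: countable_measurable; [exact: measurable_set1|exact: finite_set_countable].
Qed.

Lemma corner01 : corners 0 /\ corners 1.
Proof.
split; first by exists o0; left.
by exists o2; right; rewrite /left /len/=; lra.
Qed.

Lemma corners_open i x : ~ corners x -> left i < x <= left i + len i ->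
  left i < x < left i + len i.
Proof.
move=> nc /andP[h1 h2]; rewrite h1 lt_neqAle h2 andbT; apply/eqP => xE.
by apply: nc; exists i; right.
Qed.

Lemma part_lblk_corners i (X : set TR) : measurable X ->
  leb (part lblk i `&` X) = leb (`]left i, left i + len i]%classic `&` X).
Proof.
have [mc c0] := corners_null; move=> mX.
apply: (leb_set0_eq (N := corners)) => //.
- by apply: measurableI => //; exact: measurable_lblk.
- by apply: measurableI => //; exact: measurable_itv.
- apply/seteqP; split => x [[h Xx] nc]; (split => //; split => //).
    case: h; rewrite /I01/= !in_itv/= => /andP[x0 x1] xi; apply/lblkP => //.
    by rewrite x1 andbT lt_neqAle x0 andbT; apply/eqP => xE; apply: nc; rewrite -xE; have [] := corner01.
  move: h; rewrite /= in_itv/= => h.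
  have xx : 0 < x <= 1.
    have := left_ge0 i; have := left_len_le1 i; case/andP: h => h1 h2 h3 h4.
    by apply/andP; split; lra.
  split; last exact/lblkP.
  by rewrite /I01/= in_itv/=; case/andP: xx => /ltW -> ->.
Qed.

Lemma leb_part_blk i : leb (part blk i) = (len i)%:E.
Proof.
have [mc c0] := corners_null.
transitivity (leb `]left i, left i + len i]%classic); last first.
  rewrite lebesgue_measure_itv/= lte_fin ltrDl len_gt0 -EFinB; congr EFin; ring.
apply: (leb_set0_eq (N := corners)) => //.
- exact: measurable_blk.
- have nc1 x : I01 x -> ~ corners x -> 0 < x < 1.
    rewrite /I01/= in_itv/= => /andP[x0 x1] nc; rewrite !lt_neqAle x0 x1 !andbT.
    have [k0 k1] := corner01.
    by apply/andP; split; apply/eqP => xE; apply: nc; [rewrite -xE|rewrite xE].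
  apply/seteqP; split => x [h nc]; (split => //).
    case: h => x01 xi; have /andP[x0 x1] := nc1 x x01 nc.
    have := (blkP i (x := x)) => /(_ _)[]; first by rewrite (ltW x0).
    move=> /(_ xi)/andP[h1 h2] _; rewrite /= in_itv/= (ltW h2) andbT lt_neqAle h1 andbT.
    by apply/eqP => xE; apply: nc; exists i; left.
  move: h; rewrite /= in_itv/= => h.
  have /andP[h1 h2] := corners_open nc h.
  have := left_ge0 i; have := left_len_le1 i => h3 h4.
  split; first by rewrite /I01/= in_itv/=; apply/andP; split; lra.
  by apply/blkP; apply/andP; split; lra.
Qed.

End Blocks.

Section LabelBijection.
Context {R : realType}.
Local Notation leb := (@lebesgue_measure R).
Local Notation TR := (measurableTypeR R).
Implicit Types (x y : R) (i : 'I_3).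

(** A map that is measurable on each part and distributes the parts without overlap
of mass preserves measure. *)
Lemma mp_glue (p : R -> R) (k : R -> 'I_3) (g : 'I_3 -> R -> R) :
  measurable_label k -> (forall i, measurable_fun (setT : set TR) (g i : TR -> TR)) ->
  (forall x, I01 x -> p x = g (k x) x) -> (forall x, I01 x -> I01 (p x)) ->
  (forall D : set TR, measurable D -> D `<=` I01 ->
     (\sum_i leb (part k i `&` g i @^-1` D) = leb D)%E) ->
  measure_preserving p.
Proof.
move=> mk mg pE pI psum.
have preE (D : set R) i : part k i `&` (I01 `&` p @^-1` D) = part k i `&` g i @^-1` D.
  apply/seteqP; split => x /=.
    by move=> [[x01 /= xi] [_]]; rewrite pE// xi.
  by move=> [[x01 /= xi] h]; split => //; split => //=; rewrite pE// xi.
have mpre (D : set TR) i : measurable D -> measurable (part k i `&` g i @^-1` D : set TR).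
  move=> mD; apply: measurableI; first exact: mk.
  by rewrite -[X in measurable X]setTI; exact: mg.
have mp (D : set TR) : measurable D -> measurable (I01 `&` p @^-1` D : set TR).
  move=> mD.
  have -> : I01 `&` p @^-1` D = \bigcup_(i in [set: 'I_3]) (part k i `&` g i @^-1` D).
    apply/seteqP; split => x.
      move=> [x01 xD]; exists (k x) => //.
      by rewrite -preE; split => //; split.
    by move=> [i _]; rewrite -preE => -[].
  by apply: fin_bigcup_measurable; [exact: finite_finset|move=> i _; exact: mpre].
split => //; first by move=> _ D mD; exact: mp.
move=> D mD DI; rewrite (leb_parts mk); [|exact: mp|by move=> x []].
by under eq_bigr do rewrite preE; exact: psum.
Qed.

Variable k : R -> 'I_3.
Hypotheses (mk : measurable_label k) (lk : forall i, leb (part k i) = (len i)%:E).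

Let F i := cumul (part k i) (left i).
Let Q i := quantile (part k i) (left i) (len i).
Let J i : set R := `]left i, left i + len i]%classic.

Let kI i : part k i `<=` I01. Proof. by move=> x []. Qed.
Let mF i : measurable_fun (setT : set TR) (F i : TR -> TR).
Proof. exact: measurable_cumul (mk i) (lk i). Qed.
Let mQ i : measurable_fun (setT : set TR) (Q i : TR -> TR).
Proof. exact: measurable_quantile (kI (i := i)) (lk i). Qed.
Let mJ i : measurable (J i : set TR). Proof. exact: measurable_itv. Qed.

Let pushQ i (E : set TR) : measurable E ->
  leb (J i `&` Q i @^-1` E) = leb (part k i `&` E).
Proof. exact: quantile_push (mk i) (kI (i := i)) (lk i) _. Qed.

Let FQ i y : J i y -> F i (Q i y) = y.
Proof.
by rewrite /J/= in_itv/=; exact: cumul_quantile (mk i) (kI (i := i)) (lk i) _.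
Qed.

Let mpreF i (E : set TR) : measurable E -> measurable (F i @^-1` E : set TR).
Proof. by move=> mE; rewrite -[X in measurable X]setTI; exact: mF. Qed.

Let pushF i (E : set TR) : measurable E ->
  leb (part k i `&` F i @^-1` E) = leb (J i `&` E).
Proof.
move=> mE; rewrite -pushQ; last exact: mpreF.
congr (leb _); apply/seteqP; split => y /= [Jy].
  by rewrite /= FQ.
by rewrite /= FQ.
Qed.

Let pi x := F (k x) x.
Let tau y := Q (lblk y) y.

Let pi_mp : measure_preserving pi.
Proof.
apply: (mp_glue mk mF) => //.
- move=> x x01; rewrite /pi /F /I01/= in_itv/=.
  have := cumul_ge (left (k x)) (mk (k x)) (lk (k x)) x.
  have := cumul_le (left (k x)) (mk (k x)) (lk (k x)) x.
  have := @left_ge0 R (k x); have := @left_len_le1 R (k x) => h1 h2 h3 h4.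
  by apply/andP; split; lra.
- move=> D mD DI; rewrite (leb_parts measurable_lblk mD DI).
  by apply: eq_bigr => i _; rewrite pushF// part_lblk_corners.
Qed.

Let tau_mp : measure_preserving tau.
Proof.
apply: (mp_glue measurable_lblk mQ) => //.
- by move=> y _; exact: quantile_itv (mk _) (kI (i := _)) (lk _) _.
- move=> D mD DI; rewrite (leb_parts mk mD DI).
  apply: eq_bigr => i _; rewrite part_lblk_corners ?pushQ//.
  by rewrite -[X in measurable X]setTI; exact: mQ.
Qed.

Let ae_part (P : R -> Prop) : (forall i, exists2 N : set TR, measurable N /\ leb N = 0%E &
    forall x, part k i x -> ~ N x -> P x) -> {ae leb, forall x, I01 x -> P x}.
Proof.
move=> H; have [i|N HN] := @boolp.choice 'I_3 (set TR)
    (fun i N => (measurable N /\ leb N = 0%E) /\ forall x, part k i x -> ~ N x -> P x).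
  by have [N h1 h2] := H i; exists N.
exists (\bigcup_i N i); split.
- by apply: fin_bigcup_measurable; [exact: finite_finset|move=> i _; exact: (HN i).1.1].
- apply/eqP; rewrite eq_le measure_ge0 andbT.
  have -> : \bigcup_i N i = N o0 `|` N o1 `|` N o2.
    apply/seteqP; split => x.
      by move=> [i _]; elim/ord3P: i => h; [left; left|left; right|right].
    by move=> [[h|h]|h]; [exists o0|exists o1|exists o2].
  apply: (@le_trans _ _ (leb (N o0 `|` N o1) + leb (N o2))%E).
    by apply: measureU2; [apply: measurableU; apply: (HN _).1.1|exact: (HN _).1.1].
  rewrite (HN o2).1.2 adde0; apply: (@le_trans _ _ (leb (N o0) + leb (N o1))%E).
    by apply: measureU2; exact: (HN _).1.1.
  by rewrite (HN o0).1.2 (HN o1).1.2 adde0.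
- move=> x /= /not_implyP[x01 nP]; apply: contrapT => nN; apply: nP.
  by apply: (HN (k x)).2 => // Nx; apply: nN; exists (k x).
Qed.

Let pi_block : {ae leb, forall x, I01 x -> blk (pi x) = k x /\ tau (pi x) = x}.
Proof.
have [mc c0] := @corners_null R.
apply: ae_part => i.
pose E : set TR := [set x | Q i (F i x) != x].
have mE : measurable E.
  have mQF : measurable_fun (setT : set TR) ((fun x => Q i (F i x) - x) : TR -> TR).
    by apply: measurable_funB => //; exact: (measurableT_comp (mQ i) (mF i)).
  have := mQF measurableT _ (measurableC (measurable_set1 (0 : R))).
  rewrite setTI; congr measurable; apply/seteqP; split => x /=.
    by move/eqP; rewrite subr_eq0.
  by move=> h; apply/eqP; rewrite subr_eq0.
exists (part k i `&` (E `|` F i @^-1` corners)).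
  split; first by apply: measurableI; [exact: mk|apply: measurableU => //; exact: mpreF].
  rewrite setIUr; apply/eqP; rewrite eq_le measure_ge0 andbT.
  apply: (@le_trans _ _ (leb (part k i `&` E) + leb (part k i `&` F i @^-1` corners))%E).
    by apply: measureU2; (apply: measurableI; [exact: mk|]) => //; exact: mpreF.
  rewrite pushF// -pushQ//.
  have -> : J i `&` Q i @^-1` E = set0.
    by apply/seteqP; split => // y [Jy]; rewrite /= /E/= FQ// eqxx.
  rewrite measure0 add0e -c0; apply: le_measure; rewrite ?inE//.
  exact: measurableI.
move=> x xi nN.
have [x01 kx] := xi; rewrite /= in kx.
have xQ : Q i (F i x) = x.
  by apply/eqP/negPn/negP => h; apply: nN; split => //; left.
have nc : ~ corners (F i x) by move=> h; apply: nN; split => //; right.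
have Fi : left i < F i x < left i + len i.
  have := cumul_ge (left i) (mk i) (lk i) x; have := cumul_le (left i) (mk i) (lk i) x.
  rewrite -/(F i x) => h1 h2; apply: corners_open => //.
  by rewrite h1 andbT lt_neqAle h2 andbT; apply/eqP => h; apply: nc; exists i; left.
have := @left_ge0 R i; have := @left_len_le1 R i; case/andP: (Fi) => h1 h2 h3 h4.
rewrite /pi kx; split.
  by apply/blkP; [apply/andP; split; lra|rewrite h2 (ltW h1)].
rewrite /tau (_ : lblk (F i x) = i)//.
by apply/lblkP; [apply/andP; split; lra|rewrite h1 (ltW h2)].
Qed.

Let pi_tau : {ae leb, forall y, I01 y -> pi (tau y) = y}.
Proof.
have [mc c0] := @corners_null R.
pose N i : set TR := J i `&` Q i @^-1` (~` part k i).
have mN i : measurable (N i).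
  apply: measurableI => //; rewrite -[X in measurable X]setTI; apply: mQ => //.
  by apply: measurableC; exact: mk.
have N0 i : leb (N i) = 0%E.
  by rewrite pushQ ?setICr ?measure0//; apply: measurableC; exact: mk.
exists (corners `|` \bigcup_i N i); split.
- by apply: measurableU => //; apply: fin_bigcup_measurable; [exact: finite_finset|].
- apply/eqP; rewrite eq_le measure_ge0 andbT.
  have -> : \bigcup_i N i = N o0 `|` N o1 `|` N o2.
    apply/seteqP; split => x.
      by move=> [i _]; elim/ord3P: i => h; [left; left|left; right|right].
    by move=> [[h|h]|h]; [exists o0|exists o1|exists o2].
  apply: (@le_trans _ _ (leb corners + leb (N o0 `|` N o1 `|` N o2))%E).
    by apply: measureU2 => //; do 2 apply: measurableU => //.
  rewrite c0 add0e; apply: (@le_trans _ _ (leb (N o0 `|` N o1) + leb (N o2))%E).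
    by apply: measureU2 => //; apply: measurableU => //.
  rewrite N0 adde0; apply: (@le_trans _ _ (leb (N o0) + leb (N o1))%E).
    exact: measureU2.
  by rewrite !N0 adde0.
- move=> y /= /not_implyP[y01 ne]; apply: contrapT => nN; apply: ne.
  have nc : ~ corners y by move=> h; apply: nN; left.
  have y01' : 0 < y <= 1.
    move: y01; rewrite /I01/= in_itv/= => /andP[y0 ->]; rewrite andbT lt_neqAle y0 andbT.
    by apply/eqP => h; apply: nc; rewrite -h; have [] := @corner01 R.
  have Jy : J (lblk y) y by rewrite /J/= in_itv/=; apply/lblkP.
  have ki : part k (lblk y) (Q (lblk y) y).
    by apply: contrapT => h; apply: nN; right; exists (lblk y).
  by rewrite /tau /pi; case: ki => _ /= ->; exact: FQ.
Qed.

(** On each part the distribution function sends the part to the block of the same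
length, and the quantile function sends it back; the two glued maps are inverse to
each other almost everywhere. *)
Theorem label_bijection : exists2 p, mp_bijection p &
  {ae leb, forall x, I01 x -> blk (p x) = k x}.
Proof.
exists pi.
  split => //; exists tau; split => //.
  by apply: aeS pi_block => x H x01; case: (H x01).
by apply: aeS pi_block => x H x01; case: (H x01).
Qed.

End LabelBijection.

Section SwapBlocks.
Context {R : realType}.
Local Notation leb := (@lebesgue_measure R).
Local Notation TR := (measurableTypeR R).
Implicit Types (x y : R) (i : 'I_3).

(** Lebesgue measure is determined by its values on half-open intervals. *)
Lemma leb_translate (c : R) (E : set TR) : measurable E ->
  leb ((fun x => x + c) @^-1` E) = leb E.
Proof.
move=> mE; have mf : measurable_fun (setT : set TR) ((fun x => x + c) : TR -> TR).
  by apply: measurable_funD => //; exact: measurable_cst.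
pose M : {measure set TR -> \bar R} :=
  measure_function_pushforward__canonical__measure_function_Measure leb mf.
rewrite -[LHS]/(M E); apply/esym/lebesgue_measure_unique => // X [[a b] _ <-].
have -> : M `]a, b]%classic = leb `]a - c, b - c]%classic.
  rewrite -[LHS]/(leb ((fun x => x + c) @^-1` `]a, b]%classic)).
  congr (leb _); apply/seteqP; split => x /=; rewrite !in_itv/= => /andP[h1 h2];
    by apply/andP; split; lra.
rewrite !lebesgue_measure_itv/= !lte_fin.
have -> : (a - c < b - c) = (a < b) by rewrite ltrD2r.
by case: ifP => // _; rewrite -!EFinB; congr EFin; ring.
Qed.

Definition swap23 i : 'I_3 := match val i with 0%N => o0 | 1%N => o2 | _ => o1 end.

Lemma swap23K i : swap23 (swap23 i) = i.
Proof. by elim/ord3P: i. Qed.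

(** The displacement of each block under the exchange of the second and the third. *)
Definition shift_of i : R := match val i with 0%N => 0 | 1%N => 2 / 5 | _ => - (2 / 5) end.

Lemma in_A2 x : I01 x -> (x \in A2) = (blk x == o1).
Proof.
rewrite /I01/= in_itv/= => /andP[x0 x1]; rewrite /blk; apply/idP/idP.
  by rewrite inE /A2/= in_itv/= => /andP[h1 h2]; rewrite h2 ltNge h1.
case: (ltP x (1 / 5)) => h //; case: (ltP x (3 / 5)) => h' // _.
by rewrite inE /A2/= in_itv/= h h'.
Qed.

Lemma in_A3 x : I01 x -> (x \in A3) = (blk x == o2).
Proof.
rewrite /I01/= in_itv/= => /andP[x0 x1]; rewrite /blk; apply/idP/idP.
  rewrite inE /A3/= in_itv/= => /andP[h1 h2]; rewrite (ltNge x (3 / 5)) h1/=.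
  by case: ltP => // h; exfalso; lra.
case: (ltP x (1 / 5)) => h //; case: (ltP x (3 / 5)) => h' // _.
by rewrite inE /A3/= in_itv/= h' x1.
Qed.

Lemma in_A1 x : I01 x -> (x \in A1) = (blk x == o0).
Proof.
rewrite /I01/= in_itv/= => /andP[x0 x1]; rewrite /blk; apply/idP/idP.
  by rewrite inE /A1/= in_itv/= => /andP[h1 h2]; rewrite h2.
case: (ltP x (1 / 5)) => h; last by case: ifP.
by rewrite inE /A1/= in_itv/= x0 h.
Qed.

Lemma sigmaexE x : I01 x -> sigmaex x = x + shift_of (blk x).
Proof.
move=> x01; rewrite /sigmaex in_A2// in_A3//.
by elim/ord3P: (blk x); rewrite /shift_of/= ?addr0.
Qed.

Lemma corner_shift i x : ~ corners x -> I01 x -> left i < x < left i + len i ->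
  left (swap23 i) < x + shift_of i < left (swap23 i) + len (swap23 i).
Proof.
move=> _ _; elim/ord3P: i; rewrite /left /len /shift_of /= => /andP[h1 h2];
  by apply/andP; split; lra.
Qed.

(** Away from the corners, a point is interior to its block, and the exchange is an
open condition. *)
Lemma blk_open x : I01 x -> ~ corners x ->
  left (blk x) < x < left (blk x) + len (blk x).
Proof.
move=> x01 nc; have [k0 k1] := @corner01 R.
move: (x01); rewrite /I01/= in_itv/= => /andP[x0 x1].
have x1' : x < 1 by rewrite lt_neqAle x1 andbT; apply/eqP => h; apply: nc; rewrite h.
have x01' : 0 <= x < 1 by rewrite x0 x1'.
have [h _] := blkP (blk x) x01'.
have /andP[h1 h2] := h erefl.
by rewrite h2 andbT lt_neqAle h1 andbT; apply/eqP => e; apply: nc; exists (blk x); left.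
Qed.

Lemma open_itv i x : left i < x < left i + len i -> I01 x /\ blk x = i.
Proof.
move=> /andP[h1 h2]; have := @left_ge0 R i; have := @left_len_le1 R i => h3 h4.
split; first by rewrite /I01/= in_itv/=; apply/andP; split; lra.
by apply/blkP; apply/andP; split; lra.
Qed.

Lemma sigmaex_mp : measure_preserving (@sigmaex R).
Proof.
have [mc c0] := @corners_null R.
have mD i : measurable_fun (setT : set TR) ((fun x => x + shift_of i) : TR -> TR).
  by apply: measurable_funD => //; exact: measurable_cst.
apply: (mp_glue measurable_blk mD).
- exact: sigmaexE.
- move=> x x01; rewrite sigmaexE//; move: x01.
  rewrite /I01/= !in_itv/= /blk => /andP[x0 x1].
  case: (ltP x (1 / 5)) => h; [|case: (ltP x (3 / 5)) => h'];
    by rewrite /shift_of/=; apply/andP; split; lra.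
- move=> D mD' DI; rewrite (leb_parts measurable_blk mD' DI).
  pose s : 'I_3 -> 'I_3 := swap23.
  rewrite [RHS](reindex_inj (h := s)); last by move=> i j /(congr1 s); rewrite /s !swap23K.
  apply: eq_bigr => i _.
  rewrite -(leb_translate (shift_of i) (E := part blk (s i) `&` D)); last first.
    by apply: measurableI => //; exact: measurable_blk.
  have mpre (E : set TR) : measurable E ->
      measurable ((fun x => x + shift_of i) @^-1` E : set TR).
    by move=> mE; rewrite -[X in measurable X]setTI; exact: mD.
  apply: (leb_set0_eq (N := corners `|` (fun x => x + shift_of i) @^-1` corners)).
  + by apply: measurableI; [exact: measurable_blk|exact: mpre].
  + by apply: mpre; apply: measurableI => //; exact: measurable_blk.
  + by apply: measurableU => //; exact: mpre.
  + have c0' : leb ((fun x => x + shift_of i) @^-1` corners) = 0%E by rewrite leb_translate.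
    transitivity (leb corners); last exact: c0.
    by apply: (@measureU0 _ TR R leb corners _ mc (mpre _ mc) c0').
  + apply/seteqP; split => x [h nc]; (split => //); have nc1 : ~ corners x by move=> ?; apply: nc; left.
      case: h => [[x01 /= xi] Dx]; have := blk_open x01 nc1; rewrite xi => xo.
      have [y01 yi] := open_itv (corner_shift nc1 x01 xo).
      by split => //; split.
    case: h => [[y01 /= yi] Dx]; have nc2 : ~ corners (x + shift_of i) by move=> ?; apply: nc; right.
    have := blk_open y01 nc2; rewrite yi => yo.
    have [x01 xi] : I01 x /\ blk x = i.
      apply: open_itv; move: yo; rewrite /s; elim/ord3P: (i);
        rewrite /left /len /shift_of /= => /andP[h1 h2]; by apply/andP; split; lra.
    by split => //; split.
Qed.

Lemma sigmaex_blk : {ae leb, forall x, I01 x -> blk (sigmaex x) = swap23 (blk x) /\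
  sigmaex (sigmaex x) = x}.
Proof.
have [mc c0] := @corners_null R.
exists corners; split => // x /= /not_implyP[x01 ne]; apply: contrapT => nc; apply: ne.
have [y01 yi] := open_itv (corner_shift nc x01 (blk_open x01 nc)).
rewrite (sigmaexE x01); split => //; rewrite (sigmaexE y01) yi.
by elim/ord3P: (blk x); rewrite /shift_of/=; lra.
Qed.

Lemma sigmaex_mpb : mp_bijection (@sigmaex R).
Proof.
split; first exact: sigmaex_mp.
exists sigmaex; split; first exact: sigmaex_mp.
  by apply: aeS sigmaex_blk => x H x01; case: (H x01).
by apply: aeS sigmaex_blk => x H x01; case: (H x01).
Qed.

End SwapBlocks.

(** * Couplings of the three blocks *)

Section Couplings.
Context {R : realType}.
Local Notation I3 := 'I_3.
Implicit Types (m : I3 * I3 -> R) (p q : I3 * I3) (i j k : I3).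

(** The masses of the pairs of labels of two block labels of the interval. *)
Definition coupling m : Prop :=
  [/\ forall p, 0 <= m p, forall i, \sum_j m (i, j) = len i &
      forall j, \sum_i m (i, j) = len j].

Definition pairsum m (F : I3 * I3 -> I3 * I3 -> R) : R :=
  \sum_p \sum_q m p * m q * F p q.

(** The mass of the pairs of labels that are not related by [s]. *)
Definition off m (s : I3 -> I3) : R := 1 - \sum_i m (i, s i).

(** The block pairs 11, 23 and 32, where both graphons of the example are 1. *)
Definition hi i k : bool := k == swap23 i.

Definition mismatch p q : bool := hi p.1 q.1 != hi p.2 q.2.

Lemma swap23_o0 : swap23 o0 = o0. Proof. by []. Qed.
Lemma swap23_o1 : swap23 o1 = o2. Proof. by []. Qed.
Lemma swap23_o2 : swap23 o2 = o1. Proof. by []. Qed.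

Lemma sum3 (f : I3 -> R) : \sum_i f i = f o0 + f o1 + f o2.
Proof.
rewrite !big_ord_recl big_ord0 addr0 addrA.
by congr (f _ + f _ + f _); apply/val_inj.
Qed.

Lemma sum33 (f : I3 * I3 -> R) : \sum_p f p = \sum_i \sum_j f (i, j).
Proof. by rewrite pair_bigA; apply: eq_bigr => -[]. Qed.

Lemma pairsumM m (f g : I3 * I3 -> R) :
  pairsum m (fun p q => f p * g q) = (\sum_p m p * f p) * (\sum_q m q * g q).
Proof.
rewrite /pairsum mulr_suml; apply: eq_bigr => p _; rewrite mulr_sumr.
by apply: eq_bigr => q _; ring.
Qed.

Lemma pairsumD m (F G : I3 * I3 -> I3 * I3 -> R) :
  pairsum m (fun p q => F p q + G p q) = pairsum m F + pairsum m G.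
Proof.
rewrite /pairsum -big_split; apply: eq_bigr => p _; rewrite -big_split/=.
by apply: eq_bigr => q _; ring.
Qed.

Lemma le_pairsum m (F G : I3 * I3 -> I3 * I3 -> R) : (forall p, 0 <= m p) ->
  (forall p q, F p q <= G p q) -> pairsum m F <= pairsum m G.
Proof.
move=> m0 FG; apply: ler_sum => p _; apply: ler_sum => q _.
by apply: ler_wpM2l; rewrite ?mulr_ge0.
Qed.

Lemma pairsumZ m (c : R) (F : I3 * I3 -> I3 * I3 -> R) :
  pairsum m (fun p q => c * F p q) = c * pairsum m F.
Proof.
rewrite /pairsum mulr_sumr; apply: eq_bigr => p _; rewrite mulr_sumr.
by apply: eq_bigr => q _; ring.
Qed.

Definition core p : bool := p == (o0, o0).
Definition leak p : bool := (p.1 == o0) != (p.2 == o0).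
Definition straight p : bool := (p.1 != o0) && (p.1 == p.2).
Definition crossed p : bool := [&& p.1 != o0, p.2 != o0 & p.1 != p.2].

(** A selection of the mismatches, in the form of products so that their mass
factors.  It suffices for the lower bound of [coupling_mismatch]. *)
Lemma mismatch_ge p q :
  (core p * leak q + leak p * core q + (p == (o0, o1)) * (q == (o0, o1)) +
   (p == (o0, o2)) * (q == (o0, o2)) + straight p * crossed q +
   crossed p * straight q <= mismatch p q)%N.
Proof.
case: p => i j; case: q => k l.
by elim/ord3P: i; elim/ord3P: j; elim/ord3P: k; elim/ord3P: l.
Qed.

Lemma coupling_eqs m : coupling m ->
  [/\ [/\ 0 <= m (o0, o0), 0 <= m (o0, o1), 0 <= m (o0, o2), 0 <= m (o1, o0) & 0 <= m (o2, o0)],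
      [/\ 0 <= m (o1, o1), 0 <= m (o1, o2), 0 <= m (o2, o1) & 0 <= m (o2, o2)],
      [/\ m (o0, o0) + m (o0, o1) + m (o0, o2) = 1 / 5,
          m (o1, o0) + m (o1, o1) + m (o1, o2) = 2 / 5 &
          m (o2, o0) + m (o2, o1) + m (o2, o2) = 2 / 5] &
      [/\ m (o0, o0) + m (o1, o0) + m (o2, o0) = 1 / 5,
          m (o0, o1) + m (o1, o1) + m (o2, o1) = 2 / 5 &
          m (o0, o2) + m (o1, o2) + m (o2, o2) = 2 / 5]].
Proof.
move=> [m0 mr mc].
have r0 := mr o0; have r1 := mr o1; have r2 := mr o2.
have c0 := mc o0; have c1 := mc o1; have c2 := mc o2.
rewrite !sum3 /len/= in r0 r1 r2 c0 c1 c2.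
by split; split.
Qed.

(** Let [d] be the mass missing from the pairing of the small block with itself, and
[X], [Y] the masses of the straight and of the crossed pairings of the two large
blocks.  A point is in the small block exactly when the pattern is 1 against the
small block, which gives a mismatch [4 * (1 / 5 - d) * d]; the points of the square
of the small block that are sent to the square of a large block give [d ^+ 2 / 2]
more.  Straight and crossed pairings mismatch each other,
which gives [2 * X * Y], and [X + Y >= 3 / 5] makes this of order [min X Y]. *)
Theorem coupling_mismatch m : coupling m ->
  Num.min (off m id) (off m swap23) <= 20 * pairsum m (fun p q => (mismatch p q)%:R).
Proof.
move=> cm; have [m0 _ _] := cm.
have D : pairsum m (fun p q => ((core p)%:R * (leak q)%:R + (leak p)%:R * (core q)%:R +
    (p == (o0, o1))%:R * (q == (o0, o1))%:R + (p == (o0, o2))%:R * (q == (o0, o2))%:R +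
    (straight p)%:R * (crossed q)%:R + (crossed p)%:R * (straight q)%:R))
    <= pairsum m (fun p q => (mismatch p q)%:R).
  apply: le_pairsum => // p q; rewrite -!natrM -!natrD ler_nat; exact: mismatch_ge.
have [[a00 a01 a02 a10 a20] [a11 a12 a21 a22] [r0 r1 r2] [c0 c1 c2]] := coupling_eqs cm.
rewrite !pairsumD !pairsumM !sum33 !sum3 /= !(mulr0, mulr1, addr0, add0r) in D.
rewrite /off !sum3 /= swap23_o0 swap23_o1 swap23_o2.
move: D; set P := pairsum _ _.
move: (m (o0, o0)) (m (o0, o1)) (m (o0, o2)) (m (o1, o0)) (m (o1, o1)) (m (o1, o2))
  (m (o2, o0)) (m (o2, o1)) (m (o2, o2)) a00 a01 a02 a10 a20 a11 a12 a21 a22 r0 r1 r2 c0 c1 c2.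
move=> m00 m01 m02 m10 m11 m12 m20 m21 m22 a00 a01 a02 a10 a20 a11 a12 a21 a22 r0 r1 r2 c0 c1 c2.
(* The distances of the coupling to the two good ones are [2 * d + Y] and [2 * d + X]. *)
set d := 1 / 5 - m00; set X := m11 + m22; set Y := m12 + m21 => hP.
have d0 : 0 <= d by rewrite /d; lra.
have d1 : d <= 1 / 5 by rewrite /d; lra.
have XY : X + Y = 4 / 5 - d by rewrite /X /Y /d; lra.
have X0 : 0 <= X by rewrite addr_ge0.
have Y0 : 0 <= Y by rewrite addr_ge0.
have dd : d ^+ 2 <= 2 * (m01 * m01 + m02 * m02).
  have -> : d = m01 + m02 by rewrite /d; lra.
  by have := sqr_ge0 (m01 - m02); rewrite !expr2; lra.
have dP : 4 * (1 / 5 - d) * d + d ^+ 2 / 2 + 2 * (X * Y) <= P.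
  have e1 : m01 + m02 + m10 + m20 = 2 * d by rewrite /d; lra.
  have e2 : m00 = 1 / 5 - d by rewrite /d; lra.
  by move: hP; rewrite e1 e2; lra.
have q1 : 2 * d <= 20 * (4 * (1 / 5 - d) * d + d ^+ 2 / 2).
  have : 0 <= d * (1 / 5 - d) by rewrite mulr_ge0//; lra.
  by lra.
have -> : 1 - (m00 + m11 + m22) = 2 * d + Y by rewrite /d /Y; lra.
have -> : 1 - (m00 + m12 + m21) = 2 * d + X by rewrite /d /X; lra.
case: (lerP Y X) => YX; rewrite ge_min.
  apply/orP; left; have : 0 <= (X - 3 / 10) * Y by rewrite mulr_ge0//; lra.
  by lra.
apply/orP; right; have : 0 <= (Y - 3 / 10) * X by rewrite mulr_ge0//; lra.
by lra.
Qed.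

Definition aligned (s : I3 -> I3) : Prop := s = id \/ s = swap23.

(** Off-diagonal mass leaves a row as often as it enters the corresponding column,
which accounts for the factor 2. *)
Lemma coupling_aligned_ge m s i : coupling m -> aligned s ->
  len i - off m s / 2 <= m (i, s i).
Proof.
move=> cm [|] ->; have [_ _ [r0 r1 r2] [c0 c1 c2]] := coupling_eqs cm;
  have [[a00 a01 a02 a10 a20] [a11 a12 a21 a22] _ _] := coupling_eqs cm;
  rewrite /off !sum3 /= ?swap23_o0 ?swap23_o1 ?swap23_o2;
  by elim/ord3P: i; rewrite /len /= ?swap23_o0 ?swap23_o1 ?swap23_o2; lra.
Qed.

Lemma off_ge0 m s : coupling m -> aligned s -> 0 <= off m s.
Proof.
move=> cm [|] ->; have [_ _ [r0 r1 r2] [c0 c1 c2]] := coupling_eqs cm;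
  have [[a00 a01 a02 a10 a20] [a11 a12 a21 a22] _ _] := coupling_eqs cm;
  rewrite /off !sum3 /= ?swap23_o0 ?swap23_o1 ?swap23_o2; lra.
Qed.

Lemma hi_aligned s i k : aligned s -> hi (s i) (s k) = hi i k.
Proof. by case=> ->//; rewrite /hi (inj_eq (can_inj swap23K)). Qed.

Lemma pairsum_aligned m s (G : I3 -> I3 -> R) :
  pairsum m (fun p q => ((p.2 == s p.1) && (q.2 == s q.1))%:R * G p.1 q.1) =
  \sum_i \sum_k m (i, s i) * m (k, s k) * G i k.
Proof.
rewrite /pairsum sum33; apply: eq_bigr => i _ /=.
have aux (f : I3 -> R) : \sum_j (j == s i)%:R * f j = f (s i).
  rewrite (bigD1 (s i))//= eqxx mul1r big1 ?addr0// => j /negPf ->; exact: mul0r.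
transitivity (\sum_j (j == s i)%:R * \sum_q m (i, j) * m q * ((q.2 == s q.1)%:R * G i q.1)).
  apply: eq_bigr => j _; rewrite mulr_sumr; apply: eq_bigr => q _.
  by case: eqP => _ /=; rewrite ?mul1r// !mul0r mulr0.
rewrite aux sum33; apply: eq_bigr => k _ /=.
rewrite (bigD1 (s k))//= eqxx mul1r big1 ?addr0// => j /negPf ->.
by rewrite mul0r mulr0.
Qed.

(** The mismatches cost at least [(60 * M + 10) * off / 20], while shrinking the aligned
entries saves at most [3 * M * off]. *)
Theorem pairsum_gap m (F : I3 * I3 -> I3 * I3 -> R) (M J : R) : coupling m -> 0 <= M ->
  (forall p q, 0 <= F p q) ->
  (forall p q, mismatch p q -> 60 * M + 10 <= F p q) ->
  (forall s, aligned s ->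
    (forall i k, F (i, s i) (k, s k) <= M) /\
    \sum_i \sum_k len i * len k * F (i, s i) (k, s k) = J) ->
  exists2 s, aligned s & J + off m s / 2 <= pairsum m F.
Proof.
move=> cm M0 F0 FB FJ; have [m0 _ _] := cm.
have [s [as_ sD]] : exists s, aligned s /\
    off m s <= 20 * pairsum m (fun p q => (mismatch p q)%:R).
  have := coupling_mismatch cm; rewrite ge_min => /orP[h|h].
    by exists id; split => //; left.
  by exists swap23; split => //; right.
exists s => //; have [FM <-] := FJ _ as_.
have o0 := off_ge0 cm as_; set o := off m s in sD o0 *.
have low : (60 * M + 10) * pairsum m (fun p q => (mismatch p q)%:R) +
   \sum_i \sum_k m (i, s i) * m (k, s k) * F (i, s i) (k, s k) <= pairsum m F.
  rewrite -(pairsum_aligned m s (fun i k => F (i, s i) (k, s k))) -pairsumZ -pairsumD.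
  apply: le_pairsum => // -[i j] [k l] /=.
  case: eqP => [->|_] /=; last first.
    by case: (boolP (mismatch _ _)) => [/FB|_]; rewrite ?mulr1 ?mul0r ?mulr0 ?addr0.
  case: eqP => [->|_] /=; last first.
    by case: (boolP (mismatch _ _)) => [/FB|_]; rewrite ?mulr1 ?mul0r ?mulr0 ?addr0.
  by rewrite /mismatch /= (hi_aligned _ _ as_) eqxx mulr0 add0r mul1r.
have diag : \sum_i \sum_k len i * len k * F (i, s i) (k, s k) - 3 * M * o <=
   \sum_i \sum_k m (i, s i) * m (k, s k) * F (i, s i) (k, s k).
  have -> : 3 * M * o = \sum_i \sum_k (len i + len k) * (o / 2) * M.
    by rewrite !sum3 /len /=; field.
  rewrite -sumrB; apply: ler_sum => i _; rewrite -sumrB; apply: ler_sum => k _.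
  have hi_ := coupling_aligned_ge i cm as_; have hk := coupling_aligned_ge k cm as_.
  rewrite -/o in hi_ hk.
  have mi := m0 (i, s i); have mk := m0 (k, s k).
  have li : m (i, s i) <= len i.
    have [_ mr _] := cm; rewrite -mr (bigD1 (s i))//= lerDl sumr_ge0//.
  have li0 := ltW (@len_gt0 R i); have lk0 := ltW (@len_gt0 R k).
  have f0 := F0 (i, s i) (k, s k); have f1 := FM i k.
  have key : len i * len k - (len i + len k) * (o / 2) <= m (i, s i) * m (k, s k).
    have h1 := ler_wpM2l mi hk; have h2 := ler_wpM2r lk0 hi_.
    have h3 : m (i, s i) * (o / 2) <= len i * (o / 2) by rewrite ler_wpM2r//; lra.
    lra.
  have h1 := ler_wpM2r f0 key.
  have h2 : (len i + len k) * (o / 2) * F (i, s i) (k, s k) <= (len i + len k) * (o / 2) * M.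
    by apply: ler_wpM2l => //; rewrite mulr_ge0 ?addr_ge0//; lra.
  lra.
have h1 : (60 * M + 10) * o <= (60 * M + 10) * (20 * pairsum m (fun p q => (mismatch p q)%:R)).
  by apply: ler_wpM2l => //; lra.
have h2 : 0 <= M * o by exact: mulr_ge0.
lra.
Qed.

End Couplings.

(** * Actions of block-constant paths *)

Section BlockIntegrals.
Context {R : realType}.
Local Notation leb := (@lebesgue_measure R).
Local Notation leb2 := (leb \x leb)%E.
Local Notation TR := (measurableTypeR R).
Variables (J : finType) (c : R -> J).
Hypothesis mc : measurable_label c.
Local Open Scope ereal_scope.

Definition mass (j : J) : R := fine (leb (part c j)).

Lemma mass_ge0 j : (0 <= mass j)%R.
Proof. exact: fine_ge0. Qed.

Lemma leb_part_le1 j : leb (part c j) <= 1.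
Proof.
rewrite -(@leb_I01 R); apply: le_measure; rewrite ?inE//.
- exact: measurable_I01.
- by move=> x [].
Qed.

Lemma massE j : (mass j)%:E = leb (part c j).
Proof.
rewrite fineK// ge0_fin_numE//; exact: le_lt_trans (leb_part_le1 j) (ltry _).
Qed.

Lemma measurable_box p q : measurable (part c p `*` part c q : set (TR * TR)).
Proof. exact: measurableX. Qed.

(** A block function is a finite combination of indicators of boxes. *)
Lemma block_simple (G : J -> J -> \bar R) z : sqr01 z ->
  G (c z.1) (c z.2) =
  \sum_(pq : J * J) G pq.1 pq.2 * (\1_(part c pq.1 `*` part c pq.2) z)%:E.
Proof.
move=> [z1 z2]; have zp : (part c (c z.1) `*` part c (c z.2)) z by split; split.
rewrite (bigD1 (c z.1, c z.2))//= indicE mem_set// mule1 big1 ?addr0//.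
move=> -[p q] /= ne; rewrite indicE memNset ?mule0// => -[[_ /= e1] [_ /= e2]].
by move/eqP: ne; apply; rewrite e1 e2.
Qed.

Lemma measurable_block_term (G : J -> J -> \bar R) (pq : J * J) :
  measurable_fun (sqr01 : set (TR * TR))
    (fun z : TR * TR => G pq.1 pq.2 * (\1_(part c pq.1 `*` part c pq.2) z)%:E).
Proof.
have h : measurable_fun (sqr01 : set (TR * TR))
    (fun z : TR * TR => (\1_(part c pq.1 `*` part c pq.2) z : R)%:E).
  apply/measurable_EFinP; apply: measurable_indic; exact: measurable_box.
apply: emeasurable_funM => //; exact: measurable_cst.
Qed.

Lemma measurable_block (G : J -> J -> \bar R) :
  measurable_fun (sqr01 : set (TR * TR)) (fun z : TR * TR => G (c z.1) (c z.2)).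
Proof.
apply: (eq_measurable_fun (fun z : TR * TR =>
  \sum_(pq : J * J) G pq.1 pq.2 * (\1_(part c pq.1 `*` part c pq.2) z)%:E)).
  by move=> z; rewrite inE => z01; rewrite -block_simple.
apply: emeasurable_sum => pq; exact: measurable_block_term.
Qed.

Lemma integral_blocks (G : J -> J -> \bar R) : (forall p q, 0 <= G p q) ->
  \int[leb2]_(z in sqr01) G (c z.1) (c z.2) =
  \sum_p \sum_q (mass p * mass q)%:E * G p q.
Proof.
move=> G0.
transitivity (\int[leb2]_(z in sqr01)
    \sum_(pq : J * J) G pq.1 pq.2 * (\1_(part c pq.1 `*` part c pq.2) z)%:E).
  by apply: eq_integral => z; rewrite inE => z01; exact: block_simple.
rewrite ge0_integral_sum//=; [|exact: measurable_sqr01|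
   by move=> pq; exact: measurable_block_term|
   by move=> pq z _; rewrite mule_ge0// lee_fin indicE].
rewrite pair_bigA/=; apply: eq_bigr => -[p q] _ /=.
rewrite ge0_integralZl//=; last 2 first.
- exact: measurable_sqr01.
- apply/measurable_EFinP; apply: measurable_indic; exact: measurable_box.
rewrite integral_indic//=; [|exact: measurable_sqr01|exact: measurable_box].
rewrite setIidl; last by move=> z [[h1 _] [h2 _]].
rewrite muleC; congr (_ * _); rewrite EFinM !massE; exact: product_measure1E.
Qed.

End BlockIntegrals.

Section BlockAction.
Context {R : realType}.
Local Notation leb := (@lebesgue_measure R).
Local Notation leb2 := (leb \x leb)%E.
Local Notation TR := (measurableTypeR R).
Variables (lambda mu : R).
Hypotheses (lambda0 : 0 < lambda) (mu0 : 0 < mu).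
Variable T : R.
Hypothesis T0 : 0 < T.

Definition blockcost (J : finType) (c : R -> J) (U V : J -> J -> R) : R :=
  \sum_p \sum_q mass c p * mass c q * mincost lambda mu T (U p q) (V p q).

(** Fubini is trivial here: at each time the integral over the square is a finite sum. *)
Theorem action_blocks_le (J : finType) (c : R -> J) (U V : J -> J -> R)
    (h : R -> R * R -> R) : measurable_label c ->
  (forall p q, 0 <= U p q <= 1) -> (forall p q, 0 <= V p q <= 1) ->
  (forall z, sqr01 z -> h ^~ z = fstar lambda mu T (U (c z.1) (c z.2)) (V (c z.1) (c z.2))) ->
  (action lambda mu T h <= (blockcost c U V)%:E)%E.
Proof.
move=> mc U01 V01 hE.
have mm0 p q : (0 <= (mass c p * mass c q)%:E)%E.
  by rewrite lee_fin; apply: mulr_ge0; exact: mass_ge0.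
have [w wP] := @boolp.choice (J * J)%type (R * R)%type
  (fun pq x => optimal_weights lambda mu x.1 x.2 T (U pq.1 pq.2) (V pq.1 pq.2))
  (fun pq => let: ex_intro x0 (ex_intro x1 P) :=
     exists_optimal_weights lambda0 mu0 T0 (U01 pq.1 pq.2) (V01 pq.1 pq.2) in
     ex_intro _ (x0, x1) P).
pose L p q := lagrangian_along lambda mu T (U p q) (w (p, q)).1 (w (p, q)).2.
have Lm p q : measurable_fun setT (L p q).
  exact: (measurable_lagrangian_along lambda0 mu0 T0 (wP (p, q))).
have L0 p q t : (0 <= L p q t)%E by exact: lagrangian_ge0.
rewrite /action; case: asboolP => [_|]; last first.
  case; apply: aeW => z z01; rewrite hE//.
  exact: (fstar_abs_continuous lambda0 mu0 T0 (U01 _ _) (V01 _ _) (wP (_, _))).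
pose S t : \bar R := (\sum_p \sum_q (mass c p * mass c q)%:E * L p q t)%E.
have SE t : `]0, T[%classic t -> (\int[leb2]_(z in sqr01)
    lagrangian lambda mu (h t z) (derive1 (h ^~ z) t) = S t)%E.
  rewrite /= in_itv/= => tT; rewrite /S -(integral_blocks mc)//.
  apply: eq_integral => z; rewrite inE => z01.
  have e : h t z = fstar lambda mu T (U (c z.1) (c z.2)) (V (c z.1) (c z.2)) t.
    by rewrite -hE.
  by rewrite e hE// (fstar_lagrangian lambda0 mu0 T0 (U01 _ _) (V01 _ _) (wP (_, _))).
have Sm : measurable_fun setT S.
  by apply: emeasurable_sum => p; apply: emeasurable_sum => q; apply: measurable_funeM.
have mS : measurable_fun `]0%R, T[%classic (fun t => \int[leb2]_(z in sqr01)
    lagrangian lambda mu (h t z) (derive1 (h ^~ z) t))%E.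
  apply: (eq_measurable_fun S); first by move=> t; rewrite inE => tT; rewrite SE.
  exact: measurable_funTS.
rewrite (integral_itv_bndoo _ _ mS).
apply: (@le_trans _ _ (\int[leb]_(t in `[0%R, T]) S t)%E).
  rewrite le_eqVlt; apply/orP; left; apply/eqP.
  rewrite [RHS]integral_itv_bndoo; last exact: measurable_funTS.
  by apply: eq_integral => t; rewrite inE => tT; rewrite SE.
rewrite /S ge0_integral_sum//=; last first.
- by move=> p t _; apply: sume_ge0 => q _; exact: mule_ge0 (mm0 _ _) (L0 _ _ _).
- by move=> p; apply: emeasurable_sum => q; apply: measurable_funeM; exact: measurable_funTS (Lm _ _).
rewrite /blockcost -sumEFin; apply: lee_sum => p _.
rewrite ge0_integral_sum//=; last first.
- by move=> q t _; exact: mule_ge0 (mm0 _ _) (L0 _ _ _).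
- by move=> q; apply: measurable_funeM; exact: measurable_funTS (Lm _ _).
rewrite -sumEFin; apply: lee_sum => q _.
rewrite ge0_integralZl//=; last first.
- exact: measurable_funTS (Lm _ _).
rewrite [leRHS]EFinM; apply: lee_wpmul2l; first exact: mm0.
rewrite (mincost_optimal lambda0 mu0 T0 (U01 p q) (V01 p q) (wP (p, q))).
exact: (optimal_path_cost lambda0 mu0 T0 (U01 p q) (V01 p q) (wP (p, q))).
Qed.

End BlockAction.

Section BlockStability.
Context {R : realType}.
Local Notation leb := (@lebesgue_measure R).
Local Notation leb2 := (leb \x leb)%E.
Local Notation TR := (measurableTypeR R).
Variables (lambda mu : R).
Hypotheses (lambda0 : 0 < lambda) (mu0 : 0 < mu).
Variable T : R.
Hypothesis T0 : 0 < T.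

Definition discrepancy (h w : R * R -> R) (eta : R) : set (R * R) :=
  [set z | sqr01 z /\ eta <= `|h z - w z|].

Lemma measurable_discrepancy h w eta : measurable_fun (sqr01 : set (TR * TR)) h ->
  measurable_fun (sqr01 : set (TR * TR)) w ->
  measurable (discrepancy h w eta : set (TR * TR)).
Proof.
move=> mh mw; have mf : measurable_fun (sqr01 : set (TR * TR)) (fun z => `|h z - w z|).
  apply: measurableT_comp => //.
  exact: measurable_funB.
have := mf measurable_sqr01 `[eta, +oo[%classic (measurable_itv _).
congr measurable; apply/seteqP; split => z /=; rewrite in_itv/= andbT => -[h1 h2];
  by split.
Qed.

Lemma measurable_rblock (J : finType) (c : R -> J) (G : J -> J -> R) : measurable_label c ->
  measurable_fun (sqr01 : set (TR * TR)) (fun z => G (c z.1) (c z.2)).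
Proof.
by move=> mc; apply/measurable_EFinP; exact: (measurable_block mc (fun p q => (G p q)%:E)).
Qed.

(** The stability bound for one edge, integrated over the square, with the indicator
of the set where the path is at distance at least [eta] from the optimal one.  The null
set where the endpoints are not the prescribed ones is removed from the bound. *)
Theorem action_blocks_ge (J : finType) (c : R -> J) (U V : J -> J -> R)
    (g : R -> R * R -> R) (t eta : R) : measurable_label c ->
  (forall p q, 0 <= U p q <= 1) -> (forall p q, 0 <= V p q <= 1) -> gpath T g ->
  {ae leb2, forall z, sqr01 z -> g 0 z = U (c z.1) (c z.2)} ->
  {ae leb2, forall z, sqr01 z -> g T z = V (c z.1) (c z.2)} ->
  0 <= t <= T -> 0 < eta ->
  ((blockcost lambda mu T c U V)%:E + (eta ^+ 2 / 8)%:E * leb2 (discrepancy (g t)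
    (fun z => fstar lambda mu T (U (c z.1) (c z.2)) (V (c z.1) (c z.2)) t) eta)
   <= action lambda mu T g)%E.
Proof.
move=> mc U01 V01 pg g0 gT tT eta0.
rewrite /action; case: asboolP => [acg|_]; last by rewrite leey.
have [N [mN N0 NP]] := ae2I2 g0 gT.
set w := (fun z : R * R => _); set D := discrepancy _ _ _.
have mw : measurable_fun (sqr01 : set (TR * TR)) w.
  exact: (measurable_rblock (fun p q => fstar lambda mu T (U p q) (V p q) t) mc).
have [mgt _ gt01] := pg t tT.
have mD : measurable (D : set (TR * TR)) by exact: measurable_discrepancy.
pose K0 z : \bar R := ((mincost lambda mu T (U (c z.1) (c z.2)) (V (c z.1) (c z.2)))%:E +
  (eta ^+ 2 / 8)%:E * (\1_D z)%:E)%E.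
have e80 : (0 <= (eta ^+ 2 / 8)%:E)%E by rewrite lee_fin divr_ge0// sqr_ge0.
have mK1 : measurable_fun (sqr01 : set (TR * TR)) (fun z =>
    (mincost lambda mu T (U (c z.1) (c z.2)) (V (c z.1) (c z.2)))%:E).
  exact: (measurable_block mc (fun p q => (mincost lambda mu T (U p q) (V p q))%:E)).
have mK2 : measurable_fun (sqr01 : set (TR * TR)) (fun z => (\1_D z : R)%:E).
  by apply/measurable_EFinP; apply: measurable_indic.
have mK2' : measurable_fun (sqr01 : set (TR * TR)) (fun z => (eta ^+ 2 / 8)%:E * (\1_D z)%:E)%E.
  exact: measurable_funeM.
have K2_0 z : (0 <= (\1_D z : R)%:E)%E by rewrite lee_fin indicE.
have K0_0 z : (0 <= K0 z)%E.
  by rewrite adde_ge0 ?mule_ge0// lee_fin mincost_ge0.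
have mK0 : measurable_fun (sqr01 : set (TR * TR)) K0 by exact: emeasurable_funD.
have mKN : measurable_fun (sqr01 : set (TR * TR)) (fun z => (\1_(~` N) z : R)%:E).
  by apply/measurable_EFinP; apply: measurable_indic; exact: measurableC.
pose K z : \bar R := (K0 z * (\1_(~` N) z)%:E)%E.
have mK : measurable_fun (sqr01 : set (TR * TR)) K by exact: emeasurable_funM.
have -> : ((blockcost lambda mu T c U V)%:E + (eta ^+ 2 / 8)%:E * leb2 D =
    \int[leb2]_(z in sqr01) K z)%E.
  transitivity (\int[leb2]_(z in sqr01) K0 z)%E; last first.
    apply: ae_eq_integral => //; first exact: measurable_sqr01.
    exists N; split => // z; apply: contra_notP => nN /= _.
    by rewrite /K indicE mem_set ?mule1.
  rewrite /K0 ge0_integralD//=; last first.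
  - by move=> z _; rewrite mule_ge0.
  - by move=> z _; rewrite lee_fin mincost_ge0.
  - exact: measurable_sqr01.
  rewrite (integral_blocks mc (G := fun p q => (mincost lambda mu T (U p q) (V p q))%:E)); last first.
    by move=> p q; rewrite lee_fin mincost_ge0.
  rewrite ge0_integralZl//=; last exact: measurable_sqr01.
  rewrite integral_indic//=; last exact: measurable_sqr01.
  congr (_ + _ * leb2 _)%E; last by rewrite setIidl// => z [].
  rewrite /blockcost -sumEFin; apply: eq_bigr => p _; rewrite -sumEFin.
  by apply: eq_bigr => q _; rewrite EFinM.
apply: action_lower_bound => //.
  by move=> z _; rewrite /K mule_ge0// lee_fin indicE.
move=> z z01 acz ell mell ell0 ellP.
rewrite /K indicE; case: (boolP (z \in ~` N)); last first.
  by rewrite mule0 integral_ge0.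
rewrite inE => nN; rewrite mule1.
have [e0 eT] : g 0 z = U (c z.1) (c z.2) /\ g T z = V (c z.1) (c z.2).
  by apply: contrapT => nP; apply: nN; apply: NP => H; apply: nP; exact: H.
set a := U _ _ in e0; set b := V _ _ in eT.
have a01 : 0 <= a <= 1 by exact: U01.
have b01 : 0 <= b <= 1 by exact: V01.
have [x0 [x1 opt]] := exists_optimal_weights lambda0 mu0 T0 a01 b01.
have f01 u : 0 <= u <= T -> 0 <= g u z <= 1 by move=> uT; have [_ _] := pg u uT; exact.
have dom : dominates_lagrangian lambda mu 0 T (g ^~ z) ell by split.
have opt' : optimal_weights lambda mu x0 x1 T (g 0 z) (g T z) by rewrite e0 eT.
have := path_cost_stability lambda0 mu0 T0 (abs_continuous_seq acz) f01 dom opt' tT.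
apply: le_trans; rewrite /K0 -/a -/b (mincost_optimal lambda0 mu0 T0 a01 b01 opt) e0 eT.
rewrite -EFinM -EFinD lee_fin lerD2l.
rewrite indicE; case: (boolP (z \in D)) => [|_]; last by rewrite mulr0 divr_ge0// sqr_ge0.
rewrite inE => -[_]; rewrite mulr1 /w -/a -/b (fstarE lambda0 mu0 T0 a01 b01 opt tT) => hz.
rewrite ler_pM2r ?invr_gt0// -[leRHS]real_normK ?num_real//.
by apply: lerXn2r => //; rewrite nnegrE ?normr_ge0// ltW.
Qed.

End BlockStability.

(** * Pairs of block labels *)

Section BlockLabels.
Context {R : realType}.
Local Notation leb := (@lebesgue_measure R).
Local Notation leb2 := (leb \x leb)%E.
Local Notation TR := (measurableTypeR R).
Implicit Types (k l : R -> 'I_3) (sigma : R -> R) (s : 'I_3 -> 'I_3).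

(** A labelling of the interval by three labels with the masses of the example; up to
null sets these are the maps [blk \o sigma] with [sigma] a bijection, by
[label_bijection]. *)
Definition block_label k : Prop :=
  measurable_label k /\ forall i, leb (part k i) = (len i)%:E.

Lemma block_label_blk : block_label blk.
Proof. by split; [exact: measurable_blk|exact: leb_part_blk]. Qed.

Lemma block_label_comp k sigma : block_label k -> measure_preserving sigma ->
  block_label (k \o sigma).
Proof.
move=> [mk lk] ms.
have e i : part (k \o sigma) i = I01 `&` sigma @^-1` (part k i).
  apply/seteqP; split => x [x01 /= h]; split => //.
    by split => //; exact: mp_itv.
  by case: h.
split=> i; rewrite e; first exact: mp_measurable_preimage.
rewrite mp_preimage//.
by rewrite -lk; congr (leb _); apply/seteqP; split => x //= -[] // ?; split.
Qed.

Definition pairing k l (x : R) : 'I_3 * 'I_3 := (k x, l x).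

Lemma part_pairing k l i j : part (pairing k l) (i, j) = part k i `&` part l j.
Proof.
by apply/seteqP; split => [x [x01 [h1 h2]]|x [[x01 h1] [_ h2]]]; do ?split => //=;
  rewrite /pairing h1 h2.
Qed.

Lemma measurable_pairing k l : measurable_label k -> measurable_label l ->
  measurable_label (pairing k l).
Proof. by move=> mk ml [i j]; rewrite part_pairing; exact: measurableI. Qed.

Lemma coupling_pairing k l : block_label k -> block_label l ->
  coupling (mass (pairing k l)).
Proof.
move=> [mk lk] [ml ll]; have mp := measurable_pairing mk ml.
split=> [p|i|j]; first exact: mass_ge0.
- apply: EFin_inj; rewrite -sumEFin -lk (leb_parts ml (mk i)); last by move=> x [].
  by apply: eq_bigr => j _; rewrite massE// part_pairing setIC.
- apply: EFin_inj; rewrite -sumEFin -ll (leb_parts mk (ml j)); last by move=> x [].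
  by apply: eq_bigr => i _; rewrite massE// part_pairing.
Qed.

Definition disagree k l : set R := [set x | I01 x /\ k x <> l x].

Lemma measurable_disagree k l : measurable_label k -> measurable_label l ->
  measurable (disagree k l : set TR).
Proof.
move=> mk ml.
have -> : disagree k l = \bigcup_i (part k i `\` part l i).
  apply/seteqP; split => [x [x01 ne]|x [i _ [[x01 h1] h2]]].
    by exists (k x) => //; split => // -[_ e]; apply: ne; rewrite e.
  by split => // e; apply: h2; split => //=; rewrite -e.
by apply: fin_bigcup_measurable => // i _; exact: measurableD.
Qed.

Lemma measurable_label_comp k s : measurable_label k -> measurable_label (s \o k).
Proof.
move=> mk i; have -> : part (s \o k) i = \bigcup_(j in [set j | s j = i]) part k j.
  apply/seteqP; split => [x [x01 /= e]|x [j /= e [x01 /= h]]].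
    by exists (k x).
  by split => //=; rewrite h.
by apply: fin_bigcup_measurable => // j _; exact: mk.
Qed.

Lemma leb_disagree k l s : block_label k -> block_label l ->
  leb (disagree l (s \o k)) = (off (mass (pairing k l)) s)%:E.
Proof.
move=> [mk lk] [ml ll]; have mp := measurable_pairing mk ml.
have md : measurable (disagree l (s \o k) : set TR).
  by apply: measurable_disagree => //; exact: measurable_label_comp.
set m := mass _.
have h : leb (I01 `\` disagree l (s \o k)) = (\sum_i m (i, s i))%:E.
  have mA : measurable (I01 `\` disagree l (s \o k) : set TR).
    by apply: measurableD => //; exact: measurable_I01.
  rewrite (leb_parts mk mA); last by move=> x [].
  rewrite -sumEFin; apply: eq_bigr => i _; rewrite massE//.
  congr (leb _); apply/seteqP; split => x.
    move=> [[x01 /= e] [_ nd]]; split => //=; rewrite /pairing e; congr (_, _).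
    by apply: contrapT => ne; apply: nd; split => //=; rewrite e.
  move=> [x01 [h1 h2]]; split; first by split.
  by split => // -[_]; rewrite /= h1 h2.
have hD : leb (I01 `\` disagree l (s \o k)) = (leb I01 - leb (disagree l (s \o k)))%E.
  have hI : I01 `&` disagree l (s \o k) = disagree l (s \o k).
    by apply/setIidr => x [].
  rewrite -[in RHS]hI; apply: measureD => //; first exact: measurable_I01.
  exact: leb_I01_lty.
have fd : leb (disagree l (s \o k)) \is a fin_num.
  rewrite ge0_fin_numE//; apply: le_lt_trans leb_I01_lty.
  apply: le_measure; rewrite ?inE//; [exact: measurable_I01|by move=> x []].
move: hD; rewrite h leb_I01 -(fineK fd) -EFinB => /eqP; rewrite eqe => /eqP e.
by rewrite /off e; congr EFin; lra.
Qed.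

Lemma measurable_mismatch k l : measurable_label k -> measurable_label l ->
  measurable ([set z | sqr01 z /\ mismatch (pairing k l z.1) (pairing k l z.2)] : set (TR * TR)).
Proof.
move=> mk ml; have mp := measurable_pairing mk ml.
have := @measurable_block R _ _ mp (fun p q => (mismatch p q)%:R%:E).
move=> /(_ measurable_sqr01 [set 1%E] (emeasurable_set1 _)).
congr measurable; apply/seteqP; split => z /= [z01]; last by move=> ->.
move=> e; split => //; move: e; case: (mismatch _ _) => // /eqP.
by rewrite eqe -[X in _ == X]/(1%:R) eqr_nat.
Qed.

Lemma leb2_mismatch k l : block_label k -> block_label l ->
  leb2 [set z | sqr01 z /\ mismatch (pairing k l z.1) (pairing k l z.2)] =
  (pairsum (mass (pairing k l)) (fun p q => (mismatch p q)%:R))%:E.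
Proof.
move=> [mk lk] [ml ll]; have mp := measurable_pairing mk ml.
have -> : (pairsum (mass (pairing k l)) (fun p q => (mismatch p q)%:R))%:E =
    (\int[leb2]_(z in sqr01) (fun p q => ((mismatch p q)%:R)%:E) (pairing k l z.1) (pairing k l z.2))%E.
  rewrite (integral_blocks mp (G := fun p q => (mismatch p q)%:R%:E)); last first.
    by move=> p q; rewrite lee_fin.
  rewrite /pairsum -sumEFin; apply: eq_bigr => p _; rewrite -sumEFin.
  by apply: eq_bigr => q _; rewrite EFinM.
set D := [set z | _].
have mD : measurable (D : set (TR * TR)) by exact: measurable_mismatch.
transitivity (\int[leb2]_(z in sqr01) (\1_D z)%:E)%E.
  rewrite integral_indic//; last exact: measurable_sqr01.
  by rewrite setIidl// => z [].
apply: eq_integral => z; rewrite inE => z01; rewrite indicE; congr (_%:R%:E).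
by congr nat_of_bool; apply/idP/idP => [|h]; rewrite inE => //; case.
Qed.

(** The combinatorial bound, read on two labels. *)
Theorem near_aligned k l (e : R) : block_label k -> block_label l ->
  (leb2 [set z | sqr01 z /\ mismatch (pairing k l z.1) (pairing k l z.2)] <= e%:E)%E ->
  exists2 s, aligned s & (leb (disagree l (s \o k)) <= (20 * e)%:E)%E.
Proof.
move=> bk bl; rewrite leb2_mismatch// lee_fin => h.
have := coupling_mismatch (coupling_pairing bk bl); rewrite ge_min => /orP[] hs.
  by exists id; [left|rewrite leb_disagree// lee_fin; lra].
by exists swap23; [right|rewrite leb_disagree// lee_fin; lra].
Qed.

End BlockLabels.

(** * Limits of block kernels up to relabelling *)

Section LabelLimits.
Context {R : realType}.
Local Notation leb := (@lebesgue_measure R).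
Local Notation leb2 := (leb \x leb)%E.
Local Notation TR := (measurableTypeR R).
Implicit Types (k l : R -> 'I_3).

Lemma measure_le_cover d (X : measurableType d) (m : {measure set X -> \bar R})
    (A B C : set X) : measurable A -> measurable B -> measurable C ->
  A `<=` B `|` C -> (m A <= m B + m C)%E.
Proof.
move=> mA mB mC ABC; apply: (@le_trans _ _ (m (B `|` C))).
  by apply: le_measure; rewrite ?inE//; exact: measurableU.
by apply: measureU2.
Qed.

Definition strips (B : set R) : set (R * R) := B `*` I01 `|` I01 `*` B.

Lemma measurable_strips (B : set TR) : measurable B ->
  measurable (strips B : set (TR * TR)).
Proof.
by move=> mB; apply: measurableU; apply: measurableX => //; exact: measurable_I01.
Qed.

Lemma leb2_strips (B : set TR) : measurable B -> (leb2 (strips B) <= leb B + leb B)%E.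
Proof.
move=> mB; have mI := @measurable_I01 R.
have mBI : measurable (B `*` I01 : set (TR * TR)) by exact: measurableX.
have mIB : measurable (I01 `*` B : set (TR * TR)) by exact: measurableX.
have lBI : leb2 (B `*` I01) = leb B.
  transitivity (leb B * leb I01)%E; first exact: product_measure1E.
  by rewrite leb_I01 mule1.
have lIB : leb2 (I01 `*` B) = leb B.
  transitivity (leb I01 * leb B)%E; first exact: product_measure1E.
  by rewrite leb_I01 mul1e.
have h : (leb2 (strips B) <= leb2 (B `*` I01) + leb2 (I01 `*` B))%E.
  by apply: measure_le_cover => //; exact: measurableU.
by apply: le_trans h _; rewrite lBI lIB.
Qed.

Lemma small_half_pow (a e : R) : 0 < e -> exists n, a / 2 ^+ n <= e.
Proof.
move=> e0; have h := archi_boundP (divr_ge0 (normr_ge0 a) (ltW e0)).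
exists (Num.bound (`|a| / e)); set n := Num.bound _ in h *.
rewrite ler_pdivrMr ?exprn_gt0//; apply: (le_trans (ler_norm a)).
rewrite mulrC -ler_pdivrMr//; apply: (le_trans (ltW h)).
by rewrite -natrX ler_nat ltnW// ltn_expl.
Qed.

Lemma le_of_half_pow (x y : \bar R) (a : R) : (0 <= a)%R ->
  (forall n, (x <= y + (a / 2 ^+ n)%:E)%E) -> (x <= y)%E.
Proof.
move=> a0 h; apply/lee_addgt0Pr => e e0; have [n hn] := small_half_pow a e0.
by apply: le_trans (h n) _; apply: leeD2l; rewrite lee_fin.
Qed.

Lemma geometric_cover (F : nat -> set TR) (a : R) n : 0 <= a ->
  (forall m, measurable (F m)) -> (forall m, (leb (F m) <= (a / 2 ^+ m.+1)%:E)%E) ->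
  (leb (\bigcup_i F (n + i)%N) <= (a / 2 ^+ n)%:E)%E.
Proof.
move=> a0 mF hF.
have mU : measurable (\bigcup_i F (n + i)%N : set TR).
  by apply: bigcup_measurable.
have sub : (leb (\bigcup_i F (n + i)%N) <= \sum_(i <oo) leb (F (n + i)%N))%E.
  by apply: measure_sigma_subadditive.
apply: le_trans sub _.
have e0 : 0 <= a / 2 ^+ n by rewrite divr_ge0// exprn_ge0.
apply: le_trans (epsilon_trick0 xpredT e0).
apply: lee_nneseries => // i _; apply: le_trans (hF _) _.
rewrite lee_fin natrX -addnS exprD invfM mulrA; exact: lexx.
Qed.

Variables (k_ : nat -> R -> 'I_3) (a : R).
Hypotheses (a0 : 0 <= a) (bk : forall n, block_label (k_ n)).
Hypothesis close : forall n, (leb (disagree (k_ n.+1) (k_ n)) <= (a / 2 ^+ n.+1)%:E)%E.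

(** The points whose label still changes after step [n]. *)
Definition late n : set R := \bigcup_i disagree (k_ (n + i).+1) (k_ (n + i)%N).

Definition settled (j : 'I_3) : set R := \bigcup_n (part (k_ n) j `\` late n).

(** The eventual label; the default [o0] covers both the points that settle at the
first label and the null set of those that never settle. *)
Definition limit_label (x : R) : 'I_3 :=
  if x \in settled o1 then o1 else if x \in settled o2 then o2 else o0.

Lemma measurable_late n : measurable (late n : set TR).
Proof.
by apply: bigcup_measurable => i _; apply: measurable_disagree; exact: (proj1 (bk _)).
Qed.

Lemma leb_late n : (leb (late n) <= (a / 2 ^+ n)%:E)%E.
Proof.
apply: (geometric_cover (F := fun m => disagree (k_ m.+1) (k_ m))) => // m.
by apply: measurable_disagree; exact: (proj1 (bk _)).
Qed.

Lemma stable_after n m x : I01 x -> ~ late n x -> (n <= m)%N -> k_ m x = k_ n x.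
Proof.
move=> x01 nl /subnKC <-; elim: (m - n)%N => [|i ih]; first by rewrite addn0.
rewrite addnS -ih; apply: contrapT => ne; apply: nl; exists i => //; by split.
Qed.

Lemma limit_label_eq n x : I01 x -> ~ late n x -> limit_label x = k_ n x.
Proof.
move=> x01 nl; have sP j : settled j x -> k_ n x = j.
  move=> [m _ [[_ /= <-] nlm]].
  by rewrite -(stable_after x01 nl (leq_maxl n m)) (stable_after x01 nlm (leq_maxr n m)).
have sn : settled (k_ n x) x by exists n => //; split.
rewrite /limit_label; case: (boolP (x \in settled o1)) => [|/negP h1].
  by rewrite inE => /sP.
case: (boolP (x \in settled o2)) => [|/negP h2]; first by rewrite inE => /sP.
move: sn; elim/ord3P: (k_ n x) => // h; [case: h1|case: h2]; by rewrite inE.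
Qed.

Lemma measurable_settled j : measurable (settled j : set TR).
Proof.
apply: bigcup_measurable => n _; apply: measurableD; last exact: measurable_late.
by have [] := bk n.
Qed.

Lemma measurable_limit_label : measurable_label limit_label.
Proof.
have m1 := measurable_settled o1; have m2 := measurable_settled o2.
have s01 j : settled j `<=` I01 by move=> x [n _ [[]]].
elim/ord3P.
- have -> : part limit_label o0 = I01 `\` (settled o1 `|` settled o2).
    apply/seteqP; split => x [x01 /=]; rewrite /limit_label.
      case: (boolP (x \in settled o1)) => // /negP h1.
      case: (boolP (x \in settled o2)) => // /negP h2 _.
      by split => // -[] h; [apply: h1|apply: h2]; rewrite inE.
    move=> nh; split => //=; rewrite /limit_label !memNset// => h; apply: nh; [right|left]; exact: h.
  by apply: measurableD; [exact: measurable_I01|exact: measurableU].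
- have -> : part limit_label o1 = settled o1.
    apply/seteqP; split => x.
      move=> [x01 /=]; rewrite /limit_label; case: (boolP (x \in settled o1)) => [|_].
        by rewrite inE.
      by case: ifP.
    by move=> h; split; [exact: s01 h|rewrite /= /limit_label mem_set].
  exact: m1.
- have -> : part limit_label o2 = settled o2 `\` settled o1.
    apply/seteqP; split => x.
      move=> [x01 /=]; rewrite /limit_label; case: (boolP (x \in settled o1)) => // /negP h1.
      case: (boolP (x \in settled o2)) => //; rewrite inE => h2 _; split => // h; apply: h1.
      by rewrite inE.
    by move=> [h n]; split; [exact: s01 h|rewrite /= /limit_label memNset// mem_set].
  exact: measurableD.
Qed.

Lemma disagree_limit_late n : disagree limit_label (k_ n) `<=` late n.
Proof. by move=> x [x01 ne]; apply: contrapT => nl; apply: ne; exact: limit_label_eq. Qed.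

Lemma leb_disagree_limit n : (leb (disagree limit_label (k_ n)) <= (a / 2 ^+ n)%:E)%E.
Proof.
apply: le_trans (leb_late n); apply: le_measure; rewrite ?inE.
- by apply: measurable_disagree; [exact: measurable_limit_label|exact: (proj1 (bk _))].
- exact: measurable_late.
- exact: disagree_limit_late.
Qed.

(** Outside [late n] the limit label is [k_ n], and the measure of [late n] tends to 0;
this determines the measure of each part. *)
Theorem block_label_limit : block_label limit_label.
Proof.
have ml := measurable_limit_label; split => // i; apply/eqP; rewrite eq_le; apply/andP; split.
  apply: (le_of_half_pow a0) => n; have [mk lk] := bk n.
  rewrite -(lk i); apply: le_trans (leeD2l _ (leb_late n)).
  apply: measure_le_cover => //; first exact: measurable_late.
  move=> x [x01 /= xi]; case: (pselect (late n x)) => h; [by right|left].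
  by split => //=; rewrite -(limit_label_eq x01 h).
apply: (le_of_half_pow a0) => n; have [mk lk] := bk n.
rewrite -(lk i); apply: le_trans (leeD2l _ (leb_late n)).
apply: measure_le_cover => //; first exact: measurable_late.
move=> x [x01 /= xi]; case: (pselect (late n x)) => h; [by right|left].
by split => //=; rewrite (limit_label_eq x01 h).
Qed.

End LabelLimits.

Section BlockLimit.
Context {R : realType}.
Local Notation leb := (@lebesgue_measure R).
Local Notation leb2 := (leb \x leb)%E.
Local Notation TR := (measurableTypeR R).
Implicit Types (k l : R -> 'I_3).

Definition hi_gap (w : 'I_3 -> 'I_3 -> R) (g : R) : Prop :=
  forall i j i' j', hi i j != hi i' j' -> g <= `|w i j - w i' j'|.

Definition block (w : 'I_3 -> 'I_3 -> R) k (z : R * R) : R := w (k z.1) (k z.2).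

Variables (W : R * R -> R) (w : 'I_3 -> 'I_3 -> R) (g : R).
Hypotheses (g0 : 0 < g) (gap : hi_gap w g).
Hypothesis mW : measurable_fun (sqr01 : set (TR * TR)) W.

Definition approximant (e : R) k : Prop :=
  block_label k /\ (leb2 (discrepancy W (block w k) e) <= e%:E)%E.

Lemma measurable_disc k e : block_label k ->
  measurable (discrepancy W (block w k) e : set (TR * TR)).
Proof.
by move=> [mk _]; apply: measurable_discrepancy => //; exact: (measurable_rblock w mk).
Qed.

Lemma discrepancyS h f (e e' : R) : e <= e' -> discrepancy h f e' `<=` discrepancy h f e.
Proof. by move=> ee z [z01 h1]; split => //; exact: le_trans h1. Qed.

Lemma approximantS e e' k : e <= e' -> approximant e k -> approximant e' k.
Proof.
move=> ee [bk h]; split => //; apply: (@le_trans _ _ e%:E); last by rewrite lee_fin.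
apply: le_trans h; apply: le_measure; rewrite ?inE.
- exact: measurable_disc.
- exact: measurable_disc.
- exact: discrepancyS.
Qed.

(** Two block kernels close to [W] are close to each other, so by the gap their
patterns differ on a small set only. *)
Lemma approximants_aligned e e' k l : e + e' < g -> approximant e k -> approximant e' l ->
  exists2 s, aligned s & (leb (disagree l (s \o k)) <= (20 * (e + e'))%:E)%E.
Proof.
move=> eg [bk hk] [bl hl]; apply: near_aligned => //.
rewrite EFinD; apply: le_trans (leeD hk hl).
apply: measure_le_cover.
- by apply: measurable_mismatch; [case: bk|case: bl].
- exact: measurable_disc.
- exact: measurable_disc.
- move=> z [z01 mis].
  have := gap mis; rewrite /= => h.
  case: (lerP e `|W z - block w k z|) => h1; first by left.
  case: (lerP e' `|W z - block w l z|) => h2; first by right.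
  exfalso; move: h.
  have := ler_distD (W z) (block w k z) (block w l z).
  rewrite (distrC (block w k z) (W z)) /block; lra.
Qed.

Lemma disagree_trans k l m : measurable_label k -> measurable_label l ->
  measurable_label m ->
  (leb (disagree k m) <= leb (disagree k l) + leb (disagree l m))%E.
Proof.
move=> mk ml mm; apply: measure_le_cover; try exact: measurable_disagree.
move=> x [x01 ne]; case: (pselect (k x = l x)) => [e|]; last by left.
by right; split => //; rewrite -e.
Qed.

Lemma disagree_sym k l : disagree k l = disagree l k.
Proof. by apply/seteqP; split => x [x01 ne]; split => // e; apply: ne. Qed.

(** On the two large blocks, of total length [4 / 5], a label cannot agree both with [k]
and with its exchange. *)
Lemma disagree_swap k l : block_label k ->  measurable_label l ->
  ((4 / 5)%:E <= leb (disagree l k) + leb (disagree l (swap23 \o k)))%E.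
Proof.
move=> [mk lk] ml.
have -> : (4 / 5)%:E = leb (I01 `\` part k o0) :> \bar R.
  transitivity (leb I01 - leb (part k o0))%E.
    by rewrite lk leb_I01 /len /= -EFinB; congr EFin; lra.
  have hI : I01 `&` part k o0 = part k o0 by apply/setIidr => x [].
  rewrite -[in LHS]hI; apply/esym/measureD => //; first exact: measurable_I01.
  exact: leb_I01_lty.
have ms : measurable_label (swap23 \o k) by exact: measurable_label_comp.
apply: measure_le_cover.
- by apply: measurableD => //; exact: measurable_I01.
- exact: measurable_disagree.
- exact: measurable_disagree.
- move=> x [x01 nk]; case: (pselect (l x = k x)) => [e|]; last by left.
  right; split => //; rewrite e => h; apply: nk; split => //=.
  by move: h; rewrite /=; elim/ord3P: (k x).
Qed.

(** Fix one approximant [k0].  Every finer one is close to [k0] or to its exchange; one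
of the two types occurs at all precisions, and approximants of the same type are
close to each other, since an exchange between them would contradict
[disagree_swap].  Hence a sequence of them converges to a label that represents [W]
exactly. *)
Theorem block_limit : (forall e, 0 < e -> exists k, approximant e k) ->
  exists2 k, block_label k & {ae leb2, forall z, sqr01 z -> W z = block w k z}.
Proof.
move=> appr.
(* Small enough for the gap, and for [120 * e0 < 4 / 5]. *)
pose e0 := Num.min (g / 4) (1 / 1000).
have k10 : (0 : R) < 1 / 1000.
  lra.
have e00 : 0 < e0.
  by rewrite lt_min k10 andbT; exact: divr_gt0.
have e0g : e0 <= g / 4 by rewrite ge_min lexx.
have e01 : e0 <= 1 / 1000 by rewrite ge_min lexx orbT.
have [k0 ak0] := appr e0 e00.
pose good s e k := approximant e k /\ (leb (disagree k (s \o k0)) <= (40 * e0)%:E)%E.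
have [s as_ gs] : exists2 s, aligned s & forall e, 0 < e -> exists k, good s e k.
  (* At each precision one of the two types occurs. *)
  have one e : 0 < e -> exists s, aligned s /\ exists k, good s e k.
    move=> ep; have m0 : 0 < Num.min e e0 by rewrite lt_min ep.
    have me : Num.min e e0 <= e by rewrite ge_min lexx.
    have me0 : Num.min e e0 <= e0 by rewrite ge_min lexx orbT.
    have [k ak] := appr _ m0; have lt : e0 + Num.min e e0 < g by lra.
    have [s as_ hs] := approximants_aligned lt ak0 ak.
    exists s; split => //; exists k; split; first exact: approximantS ak.
    by apply: le_trans hs _; rewrite lee_fin; lra.
  case: (pselect (forall e, 0 < e -> exists k, good id e k)) => [h|].
    by exists id => //; left.
  move=> /existsNP[e1 /not_implyP[e1p n1]]; exists swap23; first by right.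
  move=> e ep; have m0 : 0 < Num.min e e1 by rewrite lt_min ep.
  have [s [[|] -> [k [ak hk]]]] := one _ m0.
    by exfalso; apply: n1; exists k; split => //; apply: approximantS ak; rewrite ge_min lexx orbT.
  by exists k; split => //; apply: approximantS ak; rewrite ge_min lexx.
pose e_ n := e0 / 2 ^+ n.+1.
have e_0 n : 0 < e_ n by rewrite divr_gt0// exprn_gt0.
have e_S n : e_ n.+1 = e_ n / 2 by rewrite /e_ (exprS _ n.+1) invfM [in RHS]mulrC mulrCA.
have e_le n : e_ n <= e0 / 2.
  rewrite /e_ exprS invfM mulrA ler_piMr ?divr_ge0//; first exact: ltW.
  by rewrite invf_le1 ?exprn_gt0// exprn_ege1// ler1n.
have [k_ kP] := @boolp.choice nat (R -> 'I_3) (fun n k => good s (e_ n) k) (fun n => gs _ (e_0 n)).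
have bk n : block_label (k_ n) by have [[]] := kP n.
have msk0 : measurable_label (s \o k0) by apply: measurable_label_comp; case: ak0 => -[].
have close n : (leb (disagree (k_ n.+1) (k_ n)) <= ((40 * e0) / 2 ^+ n.+1)%:E)%E.
  have [a1 d1] := kP n; have [a2 d2] := kP n.+1.
  have l1 := e_le n; have l2 := e_le n.+1.
  have lt : e_ n + e_ n.+1 < g by lra.
  have [s' as' hs'] := approximants_aligned lt a1 a2.
  have en : 40 * e0 / 2 ^+ n.+1 = 40 * e_ n by rewrite /e_ mulrA.
  have le40 : 20 * (e_ n + e_ n.+1) <= 40 * e_ n by rewrite e_S; have := e_0 n; lra.
  case: as' hs' => -> hs'.
    by apply: le_trans hs' _; rewrite lee_fin en.
  exfalso.
  have h1 := disagree_swap (bk n) (proj1 (bk n.+1)).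
  have h2 := disagree_trans (proj1 (bk n.+1)) msk0 (proj1 (bk n)).
  rewrite (disagree_sym (s \o k0)) in h2.
  have h3 := le_trans h1 (leeD (le_trans h2 (leeD d2 d1)) hs').
  by move: h3; rewrite -!EFinD lee_fin; lra.
have a0 : 0 <= 40 * e0 by rewrite mulr_ge0// ltW.
have bL := block_label_limit a0 bk close.
exists (limit_label k_) => //; set k := limit_label k_ in bL *.
have ml : measurable_label k by case: bL.
have disc0 e : 0 < e -> leb2 (discrepancy W (block w k) e) = 0%E.
  move=> ep; apply/eqP; rewrite eq_le measure_ge0 andbT.
  apply/lee_addgt0Pr => d d0; rewrite add0e.
  have m0 : 0 < Num.min d e by rewrite lt_min d0.
  have [n hn] := small_half_pow (e0 / 2 + 2 * (40 * e0)) m0.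
  have [hnd hne] : (e0 / 2 + 2 * (40 * e0)) / 2 ^+ n <= d /\
      (e0 / 2 + 2 * (40 * e0)) / 2 ^+ n <= e.
    by move: hn; rewrite le_min => /andP[].
  have split_ : (e0 / 2 + 2 * (40 * e0)) / 2 ^+ n = e_ n + 2 * (40 * e0 / 2 ^+ n).
    by rewrite /e_ exprS invfM; lra.
  have an0 : 0 <= 40 * e0 / 2 ^+ n by rewrite divr_ge0// exprn_ge0.
  pose D := disagree k (k_ n).
  have mD : measurable (D : set TR) by apply: measurable_disagree => //; exact: (proj1 (bk n)).
  have hD : (leb D <= (40 * e0 / 2 ^+ n)%:E)%E by exact: (leb_disagree_limit a0 bk close).
  have [[_ an] _] := kP n.
  have h1 : (leb2 (discrepancy W (block w k) e) <=
      leb2 (discrepancy W (block w (k_ n)) (e_ n)) + leb2 (strips D))%E.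
    apply: measure_le_cover; [exact: measurable_disc|exact: measurable_disc|exact: measurable_strips|].
    move=> z [[z1 z2] hz].
    case: (pselect (k z.1 = k_ n z.1)) => E1; last by right; left; split.
    case: (pselect (k z.2 = k_ n z.2)) => E2; last by right; right; split.
    left; split => //; rewrite /block -E1 -E2; apply: le_trans hz; lra.
  apply: le_trans h1 _.
  have h2 : (leb2 (strips D) <= (2 * (40 * e0 / 2 ^+ n))%:E)%E.
    apply: le_trans (leb2_strips mD) _.
    have -> : 2 * (40 * e0 / 2 ^+ n) = 40 * e0 / 2 ^+ n + 40 * e0 / 2 ^+ n by lra.
    by rewrite EFinD; exact: leeD.
  apply: le_trans (leeD an h2) _; rewrite -EFinD lee_fin; lra.
exists (\bigcup_n discrepancy W (block w k) n.+1%:R^-1); split.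
- by apply: bigcup_measurable => n _; exact: measurable_disc.
- apply/measure_negligible; first by apply: bigcup_measurable => n _; exact: measurable_disc.
  apply: negligible_bigcup => n; apply/negligibleP; first exact: measurable_disc.
  by apply: disc0; rewrite invr_gt0.
- move=> z /= /not_implyP[z01 ne]; have d0 : 0 < `|W z - block w k z|.
    by rewrite normr_gt0 subr_eq0; exact/eqP.
  have [n hn] := small_half_pow 1 d0.
  exists (2 ^ n)%N => //; split => //; apply: le_trans hn.
  rewrite div1r lef_pV2 ?posrE ?exprn_gt0// -natrX ler_nat; exact: leqnSn.
Qed.

End BlockLimit.

(** * Values of the optimal paths *)

Section PathValues.
Context {R : realType}.
Variables (lambda mu : R).
Hypotheses (lambda0 : 0 < lambda) (mu0 : 0 < mu).
Variable T : R.
Hypothesis smallT : small_time lambda mu T.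
Local Notation p0 := (p01 lambda mu).
Local Notation p1 := (p11 lambda mu).
Local Notation psi0 := (psi0 lambda mu).
Local Notation psi1 := (psi1 lambda mu).
Local Notation phi := (phi lambda mu).
Local Notation opt := (optimal_weights lambda mu).
Local Notation f := (fstar lambda mu T).

Let T0 : 0 < T. Proof. by case: smallT. Qed.

(** A present edge contributes at most [a].  An absent edge is present at time [t]
either because it ends present, which contributes at most [b], or because it flips
twice, which has conditional probability at most [1 / 240]. *)
Lemma phi_le (a b x0 x1 t : R) : 0 <= a <= 1 -> opt x0 x1 T a b -> 0 <= t <= T ->
  phi x0 x1 T a t <= a + b + 1 / 240.
Proof.
move=> /andP[a0 a1] o /andP[t0 tT]; have [_ s0 s1] := smallT.
have [pz pz1] := optimal_weights_psi_gt0 lambda0 mu0 o T0.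
have [x00 x10 _ pT _] := o.
have q0 := p01_ge0 lambda0 mu0 t0; have q1 := p11_le1 lambda0 mu0 t0.
have q0T := p01_le lambda0 mu0 tT.
have r0 : 0 <= T - t by lra. have rT : T - t <= T by lra.
have d1 := p11_le1 lambda0 mu0 r0; have dT := p11_ge lambda0 mu0 rT.
have dg := p11_gt0 lambda0 mu0 r0; have q1g := p11_gt0 lambda0 mu0 t0.
have P0 := p01_ge0 lambda0 mu0 (ltW T0); have P1 := p11_gt0 lambda0 mu0 (ltW T0).
have z0 : 0 <= psi0 x0 x1 (T - t).
  have := p01_lt1 lambda0 mu0 r0; have := p01_ge0 lambda0 mu0 r0 => h1 h2.
  by apply: addr_ge0; apply: mulr_ge0 => //; lra.
have z1 : 0 <= psi1 x0 x1 (T - t) by apply: addr_ge0; apply: mulr_ge0 => //; lra.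
have term1 : a * p1 t * psi1 x0 x1 (T - t) / psi1 x0 x1 T <= a.
  rewrite ler_pdivrMr// -mulrA; apply: ler_wpM2l => //.
  have := psi1D lambda0 mu0 x0 x1 t (T - t); rewrite subrKC => ->.
  by rewrite lerDr; apply: mulr_ge0 => //; lra.
have u1 : psi1 x0 x1 (T - t) <= (1 - p1 T) * x0 + x1.
  rewrite /psi1; apply: lerD; first by apply: ler_wpM2r => //; lra.
  by rewrite ler_piMl.
have term2 : (1 - a) * p0 t * psi1 x0 x1 (T - t) / psi0 x0 x1 T <=
    (1 - a) * p0 T * x1 / psi0 x0 x1 T + 1 / 240.
  rewrite ler_pdivrMr// [leRHS]mulrDl divfK ?gt_eqF//.
  have b1 : p0 t * psi1 x0 x1 (T - t) <= p0 T * ((1 - p1 T) * x0 + x1).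
    by apply: ler_pM.
  have a1' : 0 <= 1 - a by lra.
  have b2 := ler_wpM2l a1' b1.
  have b3 : 15 / 16 * x0 <= psi0 x0 x1 T.
    rewrite /psi0; have : 0 <= p0 T * x1 by rewrite mulr_ge0.
    have : 15 / 16 * x0 <= (1 - p0 T) * x0 by apply: ler_wpM2r => //; lra.
    lra.
  have b4 : p0 T * ((1 - p1 T) * x0) <= 1 / 16 * (1 / 16 * x0).
    apply: ler_pM => //; first by apply: mulr_ge0 => //; have := p11_le1 lambda0 mu0 (ltW T0); lra.
    exact: ler_wpM2r.
  have b5 : (1 - a) * (p0 T * ((1 - p1 T) * x0)) <= 1 * (p0 T * ((1 - p1 T) * x0)).
    apply: ler_wpM2r; last lra.
    by apply: mulr_ge0 => //; apply: mulr_ge0 => //; have := p11_le1 lambda0 mu0 (ltW T0); lra.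
  lra.
have term3 : (1 - a) * p0 T * x1 / psi0 x0 x1 T <= b.
  rewrite -pT /phi subrr (psi1_at0 lambda0 mu0) lerDr.
  apply: divr_ge0; last exact: ltW.
  by apply: mulr_ge0 => //; apply: mulr_ge0 => //; exact: ltW.
rewrite /phi; lra.
Qed.

(** To end at density 0 all weight must be on absent edges. *)
Lemma weights_end0 (a x0 x1 : R) : 0 <= a <= 1 -> opt x0 x1 T a 0 -> x0 = 1 /\ x1 = 0.
Proof.
move=> /andP[a0 a1] o; have [pz pz1] := optimal_weights_psi_gt0 lambda0 mu0 o T0.
have [x00 x10 s pT _] := o.
have P0 := p01_gt0 lambda0 mu0 T0; have P1 := p11_gt0 lambda0 mu0 (ltW T0).
move: pT; rewrite /phi subrr (psi1_at0 lambda0 mu0) => e.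
suff x1e : x1 = 0 by split => //; lra.
apply/eqP; rewrite eq_le x10 andbT leNgt; apply/negP => xg.
have h1 : 0 <= a * p1 T * x1 / psi1 x0 x1 T.
  apply: divr_ge0; last exact: ltW.
  by apply: mulr_ge0 => //; apply: mulr_ge0 => //; exact: ltW.
have h2 : 0 <= (1 - a) * p0 T * x1 / psi0 x0 x1 T.
  apply: divr_ge0; last exact: ltW.
  by apply: mulr_ge0 => //; apply: mulr_ge0 => //; lra.
have [e1 e2] : a * p1 T * x1 / psi1 x0 x1 T = 0 /\ (1 - a) * p0 T * x1 / psi0 x0 x1 T = 0.
  by split; lra.
have ae : a = 0.
  apply/eqP; apply: contraTT isT => an; exfalso.
  have : 0 < a * p1 T * x1 / psi1 x0 x1 T.
    by do !apply: mulr_gt0 => //; rewrite ?invr_gt0// lt_neqAle eq_sym an.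
  lra.
have : 0 < (1 - a) * p0 T * x1 / psi0 x0 x1 T.
  by do !apply: mulr_gt0 => //; rewrite ?invr_gt0// ae; lra.
lra.
Qed.

Lemma fstar_low a b t : 0 <= a <= 1 / 100 -> 0 <= b <= 1 / 100 -> 0 <= t <= T ->
  f a b t <= 1 / 2.
Proof.
move=> /andP[a0 a1] /andP[b0 b1] tT.
have a01 : 0 <= a <= 1 by apply/andP; split; lra.
have b01 : 0 <= b <= 1 by apply/andP; split; lra.
have [x0 [x1 o]] := exists_optimal_weights lambda0 mu0 T0 a01 b01.
rewrite (fstarE lambda0 mu0 T0 a01 b01 o tT).
have := phi_le a01 o tT; lra.
Qed.

Lemma fstar_high t : 0 <= t <= T -> 3 / 4 <= f 1 1 t.
Proof.
move=> tT; have o01 : 0 <= (1 : R) <= 1 by rewrite ler01 lexx.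
have [_ s0 s1] := smallT; have /andP[t0 tT'] := tT.
have [x0 [x1 o]] := exists_optimal_weights lambda0 mu0 T0 o01 o01.
rewrite (fstarE lambda0 mu0 T0 o01 o01 o tT).
have [x00 x10 s pT _] := o; have P1 := p11_lt1 lambda0 mu0 T0.
have [pz pz1] := optimal_weights_psi_gt0 lambda0 mu0 o T0.
have x0e : x0 = 0.
  move: pT; rewrite /phi !subrr (psi1_at0 lambda0 mu0) !mul0r addr0 mul1r => h.
  have e : p1 T * x1 = psi1 x0 x1 T by rewrite -[RHS]mul1r -h divfK ?gt_eqF.
  have /eqP : (1 - p1 T) * x0 = 0 by move: e; rewrite /psi1; lra.
  by rewrite mulf_eq0 => /orP[] /eqP //; lra.
have x1e : x1 = 1 by lra.
have r0 : 0 <= T - t by lra. have rT : T - t <= T by lra.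
rewrite /phi /psi1 x0e x1e subrr !mul0r !mulr0 !add0r !mulr1 addr0 mul1r.
have P1g := p11_gt0 lambda0 mu0 (ltW T0).
have h1 := p11_ge lambda0 mu0 tT'; have h2 := p11_ge lambda0 mu0 rT.
rewrite ler_pdivlMr//; have := ler_pM (ltW P1g) (ltW P1g) h1 h2.
have : 3 / 4 * p1 T <= p1 T * p1 T by apply: ler_wpM2r; lra.
lra.
Qed.

(** Along the paths from 0 the ratio [psi1 (T - t) / psi0 T] increases strictly with
the weight [x1], which is positive as soon as the final density is. *)
Lemma fstar00_lt_0e (e t : R) : 0 < e <= 1 -> 0 < t < T -> f 0 0 t < f 0 e t.
Proof.
move=> /andP[e0 e1] /andP[t0 tT]; have tT' : 0 <= t <= T by rewrite !ltW.
have z01 : 0 <= (0 : R) <= 1 by rewrite ler01 lexx.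
have e01 : 0 <= e <= 1 by rewrite ltW.
have [x0 [x1 o]] := exists_optimal_weights lambda0 mu0 T0 z01 z01.
have [y0 [y1 o']] := exists_optimal_weights lambda0 mu0 T0 z01 e01.
rewrite (fstarE lambda0 mu0 T0 z01 z01 o tT') (fstarE lambda0 mu0 T0 z01 e01 o' tT').
have [-> ->] := weights_end0 z01 o.
have [pz pz1] := optimal_weights_psi_gt0 lambda0 mu0 o' T0.
have [y00 y10 _ _ [_ /(_ e0) y1g]] := o'.
have P0 := p01_lt1 lambda0 mu0 (ltW T0).
have q0 := p01_gt0 lambda0 mu0 t0.
have w : 0 < 1 - p0 T by lra.
rewrite /phi !mul0r !add0r subr0 !mul1r -2!(mulrA (p0 t)) ltr_pM2l//.
rewrite /psi1 {1}/psi0 !mulr1 !mulr0 !addr0 ltr_pdivrMr// mulrAC ltr_pdivlMr//.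
have := mulr_gt0 y1g (_ : 0 < p1 (T - t) - p0 T); rewrite subr_gt0.
move=> /(_ (p01_ltp11 lambda0 mu0 _ _)); rewrite /psi0; lra.
Qed.

(** Both paths have final weight on absent edges only, and edges that start present
are present at time [t] with larger conditional probability. *)
Lemma fstar00_lt_e0 (e t : R) : 0 < e <= 1 -> 0 < t < T -> f 0 0 t < f e 0 t.
Proof.
move=> /andP[e0 e1] /andP[t0 tT]; have tT' : 0 <= t <= T by rewrite !ltW.
have z01 : 0 <= (0 : R) <= 1 by rewrite ler01 lexx.
have e01 : 0 <= e <= 1 by rewrite ltW.
have [x0 [x1 o]] := exists_optimal_weights lambda0 mu0 T0 z01 z01.
have [y0 [y1 o']] := exists_optimal_weights lambda0 mu0 T0 e01 z01.
rewrite (fstarE lambda0 mu0 T0 z01 z01 o tT') (fstarE lambda0 mu0 T0 e01 z01 o' tT').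
have [-> ->] := weights_end0 z01 o; have [-> ->] := weights_end0 e01 o'.
have P0 := p01_lt1 lambda0 mu0 (ltW T0); have P1 := p11_lt1 lambda0 mu0 T0.
have q0 := p01_gt0 lambda0 mu0 t0.
have r0 : 0 < T - t by lra.
have q := p11_lt1 lambda0 mu0 r0.
rewrite /phi /psi1 /psi0 !mulr1 !mulr0 !addr0 !mul0r add0r subr0 mul1r.
set Q := 1 - p1 (T - t); have Q0 : 0 < Q by rewrite /Q; lra.
have tt := p01_ltp11 lambda0 mu0 t t; have TT := p01_ltp11 lambda0 mu0 T T.
have i1 : (1 - p0 T)^-1 < (1 - p1 T)^-1 by rewrite ltf_pV2 ?posrE; lra.
have i0 : 0 < (1 - p0 T)^-1 by rewrite invr_gt0; lra.
have k : p0 t * (1 - p0 T)^-1 < p1 t * (1 - p1 T)^-1.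
  by apply: ltr_pM => //; exact: ltW.
have := mulr_gt0 (mulr_gt0 e0 Q0) (_ : 0 < p1 t * (1 - p1 T)^-1 - p0 t * (1 - p0 T)^-1).
rewrite subr_gt0 => /(_ k); lra.
Qed.

End PathValues.

(** * The two block paths of the example *)

Section ExampleBlocks.
Context {R : realType}.
Local Notation leb := (@lebesgue_measure R).
Local Notation leb2 := (leb \x leb)%E.
Local Notation TR := (measurableTypeR R).
Implicit Types (i k : 'I_3) (eps : R) (z : R * R).

(** The table of [uex]. *)
Definition ub eps i k : R :=
  if hi i k then 1
  else if [|| (i == o1) && (k == o1), (i == o0) && (k == o2) | (i == o2) && (k == o0)]
  then 0 else eps.

(** The table of [rex]. *)
Definition rb eps i k : R :=
  if hi i k then 1
  else if [|| (i == o1) && (k == o1), (i == o0) && (k == o1) | (i == o1) && (k == o0)]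
  then 0 else eps.

Lemma uexE eps z : sqr01 z -> uex eps z = block (ub eps) blk z.
Proof.
move=> [z1 z2]; rewrite /uex /block [z]surjective_pairing.
rewrite !in_setU !in_setX !in_A1// !in_A2// !in_A3//=.
by elim/ord3P: (blk z.1); elim/ord3P: (blk z.2).
Qed.

Lemma rexE eps z : sqr01 z -> rex eps z = block (rb eps) blk z.
Proof.
move=> [z1 z2]; rewrite /rex /block [z]surjective_pairing.
rewrite !in_setU !in_setX !in_A1// !in_A2// !in_A3//=.
by elim/ord3P: (blk z.1); elim/ord3P: (blk z.2).
Qed.

Lemma ub_sym eps i k : ub eps i k = ub eps k i.
Proof. by elim/ord3P: i; elim/ord3P: k. Qed.

Lemma rb_sym eps i k : rb eps i k = rb eps k i.
Proof. by elim/ord3P: i; elim/ord3P: k. Qed.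

Lemma ub_hi eps i k : hi i k -> ub eps i k = 1.
Proof. by rewrite /ub => ->. Qed.

Lemma rb_hi eps i k : hi i k -> rb eps i k = 1.
Proof. by rewrite /rb => ->. Qed.

Lemma ub_low eps i k : ~~ hi i k -> ub eps i k = 0 \/ ub eps i k = eps.
Proof. by rewrite /ub => /negPf ->; case: ifP; [left|right]. Qed.

Lemma rb_low eps i k : ~~ hi i k -> rb eps i k = 0 \/ rb eps i k = eps.
Proof. by rewrite /rb => /negPf ->; case: ifP; [left|right]. Qed.

Lemma ub01 eps i k : 0 <= eps <= 1 -> 0 <= ub eps i k <= 1.
Proof. by rewrite /ub => e01; case: ifP => _; [|case: ifP => _]; rewrite ?lexx ?ler01. Qed.

Lemma rb01 eps i k : 0 <= eps <= 1 -> 0 <= rb eps i k <= 1.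
Proof. by rewrite /rb => e01; case: ifP => _; [|case: ifP => _]; rewrite ?lexx ?ler01. Qed.

Lemma graphon_block (w : 'I_3 -> 'I_3 -> R) (k : R -> 'I_3) : measurable_label k ->
  (forall i j, w i j = w j i) -> (forall i j, 0 <= w i j <= 1) -> graphon (block w k).
Proof.
move=> mk ws w01; split; [exact: (measurable_rblock w mk)|by move=> x y _ _; exact: ws|].
by move=> z _; exact: w01.
Qed.

End ExampleBlocks.

Section ExamplePaths.
Context {R : realType}.
Local Notation leb := (@lebesgue_measure R).
Local Notation leb2 := (leb \x leb)%E.
Local Notation TR := (measurableTypeR R).
Variables (lambda mu : R).
Hypotheses (lambda0 : 0 < lambda) (mu0 : 0 < mu).
Variables (T eps : R).
Hypotheses (smallT : small_time lambda mu T) (epsP : 0 < eps < 1 / 100).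
Implicit Types (i k : 'I_3) (z : R * R) (s : 'I_3 -> 'I_3) (t : R).
Local Notation u := (uex eps).
Local Notation r := (rex eps).
Local Notation r' := (relabel (rex eps) sigmaex).
Local Notation H := (hstar lambda mu T).

Let T0 : 0 < T. Proof. by case: smallT. Qed.

Let e01 : 0 <= eps <= 1. Proof. by move: epsP => /andP[h1 h2]; apply/andP; split; lra. Qed.

(** The optimal path from block [(i, k)] of [uex] to block [(s i, s k)] of [rex]. *)
Definition pathblock s t i k : R :=
  fstar lambda mu T (ub eps i k) (rb eps (s i) (s k)) t.

Definition blockpath s t : R * R -> R := block (pathblock s t) blk.

Lemma fstar_end a b : 0 <= a <= 1 -> 0 <= b <= 1 ->
  fstar lambda mu T a b 0 = a /\ fstar lambda mu T a b T = b.
Proof.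
move=> a01 b01; have [x0 [x1 o]] := exists_optimal_weights lambda0 mu0 T0 a01 b01.
rewrite !(fstarE lambda0 mu0 T0 a01 b01 o) ?lexx ?ltW//.
by split; [exact: (phi_at0 lambda0 mu0 T0 o)|case: o].
Qed.

Lemma fstar01 a b t : 0 <= a <= 1 -> 0 <= b <= 1 -> 0 <= t <= T ->
  0 <= fstar lambda mu T a b t <= 1.
Proof.
move=> a01 b01 tT; have [x0 [x1 o]] := exists_optimal_weights lambda0 mu0 T0 a01 b01.
rewrite (fstarE lambda0 mu0 T0 a01 b01 o)//; exact: (phi_itv lambda0 mu0 T0 a01 o tT).
Qed.

Lemma gpath_blockpath s : gpath T (blockpath s).
Proof.
move=> t tT; apply: graphon_block; first exact: measurable_blk.
- by move=> i j; rewrite /pathblock ub_sym rb_sym.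
- by move=> i j; apply: fstar01 => //; [exact: ub01|exact: rb01].
Qed.

Lemma pathblock_high s t i k : aligned s -> 0 <= t <= T -> hi i k ->
  3 / 4 <= pathblock s t i k.
Proof.
by move=> as_ tT h; rewrite /pathblock ub_hi// rb_hi ?hi_aligned//; exact: fstar_high.
Qed.

Lemma pathblock_low s t i k : aligned s -> 0 <= t <= T -> ~~ hi i k ->
  pathblock s t i k <= 1 / 2.
Proof.
move=> as_ tT h; move: epsP => /andP[h1 h2].
have h' : ~~ hi (s i) (s k) by rewrite hi_aligned.
by rewrite /pathblock; case: (ub_low eps h) => ->; case: (rb_low eps h') => ->;
  apply: fstar_low => //; apply/andP; split; lra.
Qed.

Lemma gap_pathblock s s' t i j i' j' : aligned s -> aligned s' -> 0 <= t <= T ->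
  hi i j != hi i' j' -> 1 / 4 <= `|pathblock s t i j - pathblock s' t i' j'|.
Proof.
move=> as_ as' tT; case: (boolP (hi i j)); case: (boolP (hi i' j')) => // h h' _.
  have := pathblock_low as' tT h; have := pathblock_high as_ tT h' => h1 h2.
  by rewrite ger0_norm; lra.
have := pathblock_low as_ tT h'; have := pathblock_high as' tT h => h1 h2.
by rewrite ler0_norm; lra.
Qed.

Lemma hstar_straight t z : sqr01 z -> H u r t z = blockpath id t z.
Proof. by move=> z01; rewrite /hstar uexE// rexE. Qed.

(** Almost everywhere [sigmaex] exchanges the blocks, so its relabelling of [rex] is the
table of [rex] read on exchanged labels. *)
Lemma hstar_crossed : {ae leb2, forall z, sqr01 z -> forall t, H u r' t z = blockpath swap23 t z}.
Proof.
have h : {ae leb, forall x, I01 x -> blk (sigmaex x) = swap23 (blk x)}.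
  by apply: aeS sigmaex_blk => x hx x01; case: (hx x01).
apply: aeS2 (ae_coords h) => z hz z01 t; have [e1 e2] := hz z01.
have s01 : sqr01 (smap sigmaex z) by apply: mp_sqr01 => //; exact: sigmaex_mp.
rewrite /hstar uexE// /relabel -/(smap sigmaex z) rexE//.
by rewrite /blockpath /block /pathblock /= e1 e2.
Qed.

(** Time-dependent relabellings make the class of a path depend only on the classes
of its states. *)
Lemma eq_pclass (h h' : R -> R * R -> R) :
  (forall t, 0 <= t <= T -> gequiv (h t) (h' t)) -> pclass T h = pclass T h'.
Proof.
move=> hh; apply/seteqP; split => g [pg eg]; split => // t tT.
  exact: gequiv_trans (eg t tT) (hh t tT).
exact: gequiv_trans (eg t tT) (gequiv_sym (hh t tT)).
Qed.

Lemma gequiv_ae (h h' : R * R -> R) : {ae leb2, forall z, sqr01 z -> h z = h' z} ->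
  gequiv h h'.
Proof.
move=> hh; exists idfun; first exact: mpb_id.
by apply: aeS2 hh => z hz z01; rewrite hz//; case: z {hz z01}.
Qed.

Lemma pclass_straight : pclass T (H u r) = pclass T (blockpath id).
Proof.
by apply: eq_pclass => t _; apply: gequiv_ae; apply: aeW => z; exact: hstar_straight.
Qed.

Lemma pclass_crossed : pclass T (H u r') = pclass T (blockpath swap23).
Proof.
apply: eq_pclass => t _; apply: gequiv_ae; apply: aeS2 hstar_crossed => z hz z01; exact: hz.
Qed.

Lemma blockpath_start s : gequiv (blockpath s 0) u.
Proof.
apply: gequiv_ae; apply: aeW => z z01; rewrite uexE// /blockpath /block /pathblock.
by rewrite (fstar_end (ub01 _ _ e01) (rb01 _ _ e01)).1.
Qed.

(** For the exchange, [sigmaex] is the required relabelling. *)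
Lemma blockpath_stop s : aligned s -> gequiv (blockpath s T) r.
Proof.
have hT s' z : blockpath s' T z = rb eps (s' (blk z.1)) (s' (blk z.2)).
  by rewrite /blockpath /block /pathblock (fstar_end (ub01 _ _ e01) (rb01 _ _ e01)).2.
case=> ->; first by apply: gequiv_ae; apply: aeW => z z01; rewrite rexE// hT.
exists sigmaex; first exact: sigmaex_mpb.
have h : {ae leb, forall x, I01 x -> blk (sigmaex x) = swap23 (blk x)}.
  by apply: aeS sigmaex_blk => x hx x01; case: (hx x01).
apply: aeS2 (ae_coords h) => z hz z01; have [e1 e2] := hz z01.
have s01 : sqr01 (smap sigmaex z) by apply: mp_sqr01 => //; exact: sigmaex_mp.
by rewrite /relabel -/(smap sigmaex z) rexE// hT /block /= e1 e2.
Qed.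

Lemma admissible_blockpath s : aligned s -> admissible T u r (pclass T (blockpath s)).
Proof.
move=> as_; exists (blockpath s); split => //; first exact: gpath_blockpath.
- exact: gclass_eq (blockpath_start s).
- exact: gclass_eq (blockpath_stop as_).
Qed.

Definition paircost (p q : 'I_3 * 'I_3) : R :=
  mincost lambda mu T (ub eps p.1 q.1) (rb eps p.2 q.2).

Definition alignedcost s : R :=
  \sum_i \sum_k len i * len k * paircost (i, s i) (k, s k).

(** The exchange permutes the five pairs of values that occur and preserves their
multiplicities: the pairs (eps, 0) and (eps, eps), and the pairs (0, eps) and
(0, 0), trade places on block pairs of equal area. *)
Lemma alignedcostE s : aligned s -> alignedcost s = alignedcost id.
Proof.
case=> ->//; rewrite /alignedcost !sum3 /paircost /= !swap23_o0 !swap23_o1 !swap23_o2.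
rewrite /ub /rb /hi /= /len /=; ring.
Qed.

Lemma action_blockpath s : aligned s ->
  (action lambda mu T (blockpath s) <= (alignedcost id)%:E)%E.
Proof.
move=> as_; rewrite -(alignedcostE as_).
apply: le_trans (action_blocks_le (c := blk) (U := ub eps)
  (V := fun i k => rb eps (s i) (s k)) lambda0 mu0 T0 _ _ _ _) _ => //.
- exact: measurable_blk.
- by move=> *; exact: ub01.
- by move=> *; exact: rb01.
rewrite lee_fin /blockcost /alignedcost; apply: ler_sum => i _; apply: ler_sum => k _.
by rewrite /mass !leb_part_blk.
Qed.

Lemma paircost_gap (M : R) (m : 'I_3 * 'I_3 -> R) : cost_gap lambda mu T eps M -> coupling m ->
  exists2 s, aligned s & alignedcost id + off m s / 2 <= pairsum m paircost.
Proof.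
move=> [[M00 M11 Me0 M0e Mee] [B01 B10 Be1 B1e]] cm.
apply: (pairsum_gap cm (M := M)).
- exact: le_trans (mincost_ge0 _ _ _ _ _) M00.
- by move=> p q; exact: mincost_ge0.
- move=> [i j] [k l]; rewrite /mismatch /paircost /=.
  case: (boolP (hi i k)) => h; case: (boolP (hi j l)) => h' // _.
    by rewrite ub_hi//; case: (rb_low eps h') => ->.
  by rewrite (rb_hi _ h'); case: (ub_low eps h) => ->.
- move=> s as_; split; last exact: alignedcostE.
  move=> i k; rewrite /paircost /=.
  case: (boolP (hi i k)) => h; first by rewrite ub_hi// rb_hi// hi_aligned.
  have h' : ~~ hi (s i) (s k) by rewrite hi_aligned.
  by case: (ub_low eps h) => ->; case: (rb_low eps h') => ->.
Qed.

End ExamplePaths.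

(** * Minimisers *)

Section Minimisers.
Context {R : realType}.
Local Notation leb := (@lebesgue_measure R).
Local Notation leb2 := (leb \x leb)%E.
Local Notation TR := (measurableTypeR R).
Variables (lambda mu : R).
Hypotheses (lambda0 : 0 < lambda) (mu0 : 0 < mu).
Variables (T eps M : R).
Hypotheses (smallT : small_time lambda mu T) (epsP : 0 < eps < 1 / 100).
Hypothesis gapM : cost_gap lambda mu T eps M.
Implicit Types (i : 'I_3) (z : R * R) (s : 'I_3 -> 'I_3) (t : R).
Local Notation u := (uex eps).
Local Notation r := (rex eps).
Local Notation r' := (relabel (rex eps) sigmaex).
Local Notation H := (hstar lambda mu T).
Local Notation act := (action lambda mu T).
Local Notation pathblock := (pathblock lambda mu T eps).
Local Notation blockpath := (blockpath lambda mu T eps).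
Local Notation Jmin := (alignedcost lambda mu T eps id).

Let T0 : 0 < T. Proof. by case: smallT. Qed.

Let e01 : 0 <= eps <= 1. Proof. by move: epsP => /andP[h1 h2]; apply/andP; split; lra. Qed.

(** The label is that of the relabelled point. *)
Lemma gequiv_block (h f : R * R -> R) (w : 'I_3 -> 'I_3 -> R) : gequiv h f ->
  (forall z, sqr01 z -> f z = block w blk z) ->
  exists2 k, block_label k & {ae leb2, forall z, sqr01 z -> h z = block w k z}.
Proof.
move=> [sg [ms _] hf] fE; exists (blk \o sg).
  exact: block_label_comp block_label_blk ms.
apply: aeS2 hf => z hz z01; rewrite hz// /relabel -/(smap sg z) fE//.
exact: mp_sqr01.
Qed.

(** An excess [d] of the action bounds both the distance of the coupling to one of the
two good ones and the measure of the set where the path is far from the optimal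
one; the type [s] and the label [k] do not depend on the time. *)
Lemma action_near_block g (d : R) : gpath T g -> gequiv (g 0) u -> gequiv (g T) r ->
  0 <= d -> (act g <= (Jmin + d)%:E)%E ->
  exists s k, [/\ aligned s, block_label k & forall t e, 0 <= t <= T -> 0 < e ->
    (leb2 (discrepancy (g t) (block (pathblock s t) k) e) <= (8 * d / e ^+ 2 + 4 * d)%:E)%E].
Proof.
move=> pg g0 gT d0 ad.
have [k bk kE] := gequiv_block g0 (@uexE R eps).
have [l bl lE] := gequiv_block gT (@rexE R eps).
have [mk ml] := (proj1 bk, proj1 bl).
have mp := measurable_pairing mk ml; have cp := coupling_pairing bk bl.
have [s as_ hs] := paircost_gap gapM cp.
exists s, k; split => // t e tT e0.
pose U (p q : 'I_3 * 'I_3) := ub eps p.1 q.1; pose V (p q : 'I_3 * 'I_3) := rb eps p.2 q.2.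
have low := action_blocks_ge lambda0 mu0 T0 (c := pairing k l) (U := U) (V := V) mp
  (fun p q => ub01 _ _ e01) (fun p q => rb01 _ _ e01) pg kE lE tT e0.
set D := discrepancy _ _ _ in low.
have mD : measurable (D : set (TR * TR)).
  apply: measurable_discrepancy; first by have [] := pg t tT.
  exact: (measurable_rblock (fun p q => fstar lambda mu T (U p q) (V p q) t) mp).
have fD : leb2 D \is a fin_num.
  rewrite ge0_fin_numE//; apply: (@le_lt_trans _ _ 1%E); last exact: ltry.
  rewrite -(@leb2_sqr01 R); apply: le_measure; rewrite ?inE//; first exact: measurable_sqr01.
  by move=> z [].
have o0 : 0 <= off (mass (pairing k l)) s by exact: off_ge0.
have D0 : 0 <= fine (leb2 D) by exact: fine_ge0.
have key : off (mass (pairing k l)) s / 2 + e ^+ 2 / 8 * fine (leb2 D) <= d.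
  have := le_trans low ad; rewrite -(fineK fD) -EFinM -EFinD lee_fin.
  rewrite -[blockcost _ _ _ _ _ _]/(pairsum (mass (pairing k l)) (paircost lambda mu T eps)).
  lra.
have e20 : 0 < e ^+ 2 by rewrite exprn_gt0.
have hD : fine (leb2 D) <= 8 * d / e ^+ 2 by rewrite ler_pdivlMr//; lra.
have hoff : off (mass (pairing k l)) s <= 2 * d.
  have : 0 <= e ^+ 2 / 8 * fine (leb2 D) by rewrite mulr_ge0// divr_ge0// ltW.
  lra.
pose B := disagree l (s \o k).
have ms : measurable_label (s \o k) by exact: measurable_label_comp.
have mB : measurable (B : set TR) by exact: measurable_disagree.
have lB : (leb B <= (2 * d)%:E)%E by rewrite leb_disagree// lee_fin.
have mD' : measurable (discrepancy (g t) (block (pathblock s t) k) e : set (TR * TR)).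
  apply: measurable_discrepancy; first by have [] := pg t tT.
  exact: (measurable_rblock (pathblock s t) mk).
have h1 : (leb2 (discrepancy (g t) (block (pathblock s t) k) e) <=
    leb2 D + leb2 (strips B))%E.
  apply: measure_le_cover => //; first exact: measurable_strips.
  move=> z [[z1 z2] hz].
  case: (pselect (l z.1 = s (k z.1))) => E1; last by right; left; split.
  case: (pselect (l z.2 = s (k z.2))) => E2; last by right; right; split.
  by left; split => //; rewrite /U /V /= E1 E2.
apply: le_trans h1 _; apply: (@le_trans _ _ ((8 * d / e ^+ 2)%:E + ((2 * d)%:E + (2 * d)%:E))%E).
  apply: leeD; first by rewrite -(fineK fD) lee_fin.
  by apply: le_trans (leb2_strips mB) _; exact: leeD.
by rewrite -!EFinD lee_fin; lra.
Qed.

Lemma action_ge g : gpath T g -> gequiv (g 0) u -> gequiv (g T) r -> (Jmin%:E <= act g)%E.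
Proof.
move=> pg g0 gT.
have [k bk kE] := gequiv_block g0 (@uexE R eps).
have [l bl lE] := gequiv_block gT (@rexE R eps).
have mp := measurable_pairing (proj1 bk) (proj1 bl); have cp := coupling_pairing bk bl.
have [s as_ hs] := paircost_gap gapM cp.
have tT : 0 <= (0 : R) <= T by rewrite lexx ltW.
have low := action_blocks_ge lambda0 mu0 T0 (c := pairing k l)
  (U := fun p q => ub eps p.1 q.1) (V := fun p q => rb eps p.2 q.2) mp
  (fun p q => ub01 _ _ e01) (fun p q => rb01 _ _ e01) pg kE lE tT ltr01.
apply: le_trans low; apply: (@le_trans _ _ (pairsum (mass (pairing k l))
  (paircost lambda mu T eps))%:E).
  by rewrite lee_fin; have := off_ge0 cp as_; lra.
by apply: leeDl; apply: mule_ge0 => //; rewrite lee_fin divr_ge0// sqr_ge0.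
Qed.

Lemma admissible_ge C : admissible T u r C -> (Jmin%:E <= caction lambda mu T C)%E.
Proof.
move=> [h [ph -> h0 hT]]; apply: le_ereal_inf_tmp => _ [g [pg eg] <-].
have t0 : 0 <= (0 : R) <= T by rewrite lexx ltW.
have tT : 0 <= T <= T by rewrite lexx ltW.
apply: action_ge => //.
  by apply: gequiv_trans (eg _ t0) _; apply: gclass_gequiv => //; exact: ph.
by apply: gequiv_trans (eg _ tT) _; apply: gclass_gequiv => //; exact: ph.
Qed.

Lemma caction_blockpath s : aligned s ->
  (caction lambda mu T (pclass T (blockpath s)) <= Jmin%:E)%E.
Proof.
move=> as_; apply: le_trans (action_blockpath lambda0 mu0 smallT epsP as_).
apply: ereal_inf_lbound; exists (blockpath s) => //; split.
  exact: gpath_blockpath.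
by move=> t _; exact: gequiv_refl.
Qed.

Lemma blockpath_minimal s : aligned s -> Hstar lambda mu T u r (pclass T (blockpath s)).
Proof.
move=> as_; split; first exact: admissible_blockpath.
by move=> D aD; apply: le_trans (caction_blockpath as_) _; exact: admissible_ge.
Qed.

(** A relabelling that carries [h] to [g] carries the discrepancy of [h] to that of [g]. *)
Lemma discrepancy_comp (h g : R * R -> R) (w : 'I_3 -> 'I_3 -> R) (k : R -> 'I_3)
    (p : R -> R) (e : R) : graphon h -> graphon g -> block_label k -> measure_preserving p ->
  {ae leb2, forall z, sqr01 z -> h z = relabel g p z} ->
  (leb2 (discrepancy h (block w (k \o p)) e) <= leb2 (discrepancy g (block w k) e))%E.
Proof.
move=> [mh _ _] [mg _ _] bk mp [N [mN N0 NP]].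
have mD : measurable (discrepancy g (block w k) e : set (TR * TR)).
  apply: measurable_discrepancy => //; exact: (measurable_rblock w (proj1 bk)).
have mD' : measurable (discrepancy h (block w (k \o p)) e : set (TR * TR)).
  apply: measurable_discrepancy => //.
  exact: (measurable_rblock w (proj1 (block_label_comp bk mp))).
have e1 : leb2 (sqr01 `&` smap p @^-1` discrepancy g (block w k) e) =
    leb2 (discrepancy g (block w k) e).
  by rewrite mp_square// setIidr// => z [].
rewrite -e1 -[leRHS]adde0 -N0; apply: measure_le_cover => //.
  exact: measurable_smap_preimage.
move=> z [z01 hz]; case: (pselect (N z)) => nz; [by right|left].
have hE : h z = g (smap p z).
  by apply: contrapT => ne; apply: nz; apply: NP => /(_ z01).
split => //; split; first exact: mp_sqr01.
by rewrite -hE.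
Qed.

Lemma block_gequiv (h : R * R -> R) (w : 'I_3 -> 'I_3 -> R) (k : R -> 'I_3) :
  block_label k -> {ae leb2, forall z, sqr01 z -> h z = block w k z} ->
  gequiv h (block w blk).
Proof.
move=> [mk lk] hE; have [p mpb pE] := label_bijection mk lk.
exists p => //; apply: aeS2 (ae2I2 hE (ae_coords pE)) => z hz z01.
have [-> [e1 e2]] := hz z01.
by rewrite /relabel /block /= e1 e2.
Qed.

(** One of the two types occurs for arbitrarily small excess, because the conclusion
weakens as the excess grows. *)
Lemma near_minimal_type (h : R -> R * R -> R) :
  gclass (h 0) = gclass u -> gclass (h T) = gclass r -> gpath T h ->
  (caction lambda mu T (pclass T h) <= Jmin%:E)%E ->
  exists2 s, aligned s & forall d, 0 < d -> exists g k, [/\ pclass T h g, block_label k &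
    forall t e, 0 <= t <= T -> 0 < e ->
    (leb2 (discrepancy (g t) (block (pathblock s t) k) e) <= (8 * d / e ^+ 2 + 4 * d)%:E)%E].
Proof.
move=> h0 hT ph hJ.
pose good s d := exists g k, [/\ pclass T h g, block_label k &
    forall t e, 0 <= t <= T -> 0 < e ->
    (leb2 (discrepancy (g t) (block (pathblock s t) k) e) <= (8 * d / e ^+ 2 + 4 * d)%:E)%E].
have one d : 0 < d -> exists2 s, aligned s & good s d.
  move=> d0; have : (caction lambda mu T (pclass T h) < (Jmin + d)%:E)%E.
    by apply: le_lt_trans hJ _; rewrite lte_fin ltrDl.
  move=> /ereal_inf_lt[_ [g [pg eg] <-] ag].
  have t0 : 0 <= (0 : R) <= T by rewrite lexx ltW.
  have tT : 0 <= T <= T by rewrite lexx ltW.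
  have g0 : gequiv (g 0) u.
    by apply: gequiv_trans (eg _ t0) _; apply: gclass_gequiv => //; exact: ph.
  have gT : gequiv (g T) r.
    by apply: gequiv_trans (eg _ tT) _; apply: gclass_gequiv => //; exact: ph.
  have [s [k [as_ bk hk]]] := action_near_block pg g0 gT (ltW d0) (ltW ag).
  by exists s => //; exists g, k; split.
have goodS s d d' : d <= d' -> good s d -> good s d'.
  move=> dd [g [k [hg bk hk]]]; exists g, k; split => // t e tT e0.
  apply: le_trans (hk t e tT e0) _; rewrite lee_fin; apply: lerD; last lra.
  by rewrite ler_pM2r ?invr_gt0 ?exprn_gt0//; lra.
case: (pselect (forall d, 0 < d -> good id d)) => [hg|].
  by exists id => //; left.
move=> /existsNP[d1 /not_implyP[d1p n1]]; exists swap23; first by right.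
move=> d dp; have m0 : 0 < Num.min d d1 by rewrite lt_min dp.
have [s [|] -> hg] := one _ m0.
  by exfalso; apply: n1; apply: goodS hg; rewrite ge_min lexx orbT.
by apply: goodS hg; rewrite ge_min lexx.
Qed.

(** The type is chosen before the time, so that all states of [h] are relabelled states
of the same block path. *)
Lemma minimal_blockpath C : Hstar lambda mu T u r C ->
  exists2 s, aligned s & C = pclass T (blockpath s).
Proof.
move=> [[h [ph -> h0 hT]] hmin].
have hJ : (caction lambda mu T (pclass T h) <= Jmin%:E)%E.
  apply: le_trans (caction_blockpath (or_introl erefl)); apply: hmin.
  exact: admissible_blockpath (or_introl erefl).
have [s as_ hs] := near_minimal_type h0 hT ph hJ.
exists s => //; apply: eq_pclass => t tT.
have [mht _ _] := ph t tT.
have g4 : 0 < 1 / 4 :> R by exact: divr_gt0.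
have [k bk kE] : exists2 k, block_label k &
    {ae leb2, forall z, sqr01 z -> h t z = block (pathblock s t) k z}.
  apply: (block_limit g4) => //; first by move=> *; exact: gap_pathblock.
  move=> e e0.
  (* The excess for which the bound of [near_minimal_type] equals [e]. *)
  have c0 : 0 < 8 / e ^+ 2 + 4 by rewrite addr_gt0// divr_gt0// exprn_gt0.
  have [g [k [[pg eg] bk hk]]] := hs (e / (8 / e ^+ 2 + 4)) (divr_gt0 e0 c0).
  have [p [mp _] hE] := gequiv_sym (eg t tT).
  exists (k \o p); split; first exact: block_label_comp.
  apply: (le_trans (discrepancy_comp (pathblock s t) e (ph _ tT) (pg _ tT) bk mp hE)).
  apply: le_trans (hk t e tT e0) _; rewrite lee_fin.
  have -> : 8 * (e / (8 / e ^+ 2 + 4)) / e ^+ 2 + 4 * (e / (8 / e ^+ 2 + 4)) =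
    (8 / e ^+ 2 + 4) * (e / (8 / e ^+ 2 + 4)) by lra.
  by rewrite mulrC divfK// gt_eqF.
exact: block_gequiv bk kE.
Qed.

(** On the second block the first path goes from 0 to 0; a pattern-preserving
relabelling sends this block to one where the second path goes from 0 to [eps] or
from [eps] to 0. *)
Lemma blockpath_distinct : pclass T (blockpath id) <> pclass T (blockpath swap23).
Proof.
move=> eqC; pose t := T / 2.
have Tg : 0 < T := T0.
have tT' : 0 < t < T by rewrite /t; apply/andP; clear T0; split; lra.
have tT : 0 <= t <= T by move: tT' => /andP[h1 h2]; rewrite !ltW.
have : pclass T (blockpath swap23) (blockpath id).
  rewrite -eqC; split; first exact: gpath_blockpath.
  by move=> t' _; exact: gequiv_refl.
move=> [_ /(_ t tT) eqt].
have [l bl [N [mN N0 NP]]] := gequiv_block eqt (fun z _ => erefl).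
have agree z : sqr01 z -> ~ N z ->
    pathblock id t (blk z.1) (blk z.2) = pathblock swap23 t (l z.1) (l z.2).
  by move=> z01 nz; apply: contrapT => ne; apply: nz; apply: NP => /(_ z01).
have bb := @block_label_blk R.
have mis0 : (leb2 [set z | sqr01 z /\ mismatch (pairing blk l z.1) (pairing blk l z.2)]
    <= (0 : R)%:E)%E.
  rewrite -[leRHS]N0; apply: le_measure; rewrite ?inE//.
    exact: measurable_mismatch (proj1 bb) (proj1 bl).
  move=> z [z01 mis]; apply: contrapT => nz.
  have := gap_pathblock lambda0 mu0 smallT epsP (or_introl erefl) (or_intror erefl) tT mis.
  by rewrite /= agree// subrr normr0; lra.
have [s as_ hs] := near_aligned bb bl mis0; rewrite mulr0 in hs.
pose B := disagree l (s \o blk).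
have mB : measurable (B : set TR).
  by apply: measurable_disagree; [case: bl|apply: measurable_label_comp; case: bb].
have lB : leb B = 0%E by apply/eqP; rewrite eq_le hs measure_ge0.
have null : (leb2 (part blk o1 `*` part blk o1) <= leb2 N + leb2 (strips B))%E.
  apply: measure_le_cover => //; [exact: (measurable_box (proj1 bb))|exact: measurable_strips|].
  move=> z [[z1 /= b1] [z2 /= b2]].
  case: (pselect (N z)) => nz; [by left|right].
  case: (pselect (l z.1 = s (blk z.1))) => E1; last by left; split.
  case: (pselect (l z.2 = s (blk z.2))) => E2; last by right; split.
  exfalso; have := agree z (conj z1 z2) nz; rewrite E1 E2 b1 b2.
  have e1 : 0 < eps <= 1 by move: epsP => /andP[h1 h2]; apply/andP; split; lra.
  have lt1 := fstar00_lt_0e lambda0 mu0 smallT e1 tT'.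
  have lt2 := fstar00_lt_e0 lambda0 mu0 smallT e1 tT'.
  case: as_ => ->; rewrite /pathblock /pathblock /ub /rb /hi /= => h.
    by move: lt1; rewrite h ltxx.
  by move: lt2; rewrite h ltxx.
have box : leb2 (part blk o1 `*` part blk o1) = (4 / 25)%:E.
  have mb := (proj1 bb) o1.
  transitivity (leb (part blk o1) * leb (part blk o1))%E; first exact: product_measure1E.
  by rewrite leb_part_blk /len /= -EFinM; congr EFin; lra.
have := le_trans null (leeD (lexx _) (leb2_strips mB)).
rewrite box N0 lB !adde0 lee_fin; lra.
Qed.

End Minimisers.

Theorem proposition2p11 (R : realType) (lambda mu : R)
    (hlambda : 0 < lambda) (hmu : 0 < mu) :
  exists2 eps0 : R, 0 < eps0 < 1 &
    forall eps : R, 0 < eps < eps0 ->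
      exists2 T0 : R, 0 < T0 &
        forall T : R, 0 < T < T0 ->
          let u := uex eps in
          let r := rex eps in
          let r' := relabel r sigmaex in
          Hstar lambda mu T u r =
            [set pclass T (hstar lambda mu T u r);
                 pclass T (hstar lambda mu T u r')] /\
          pclass T (hstar lambda mu T u r) <> pclass T (hstar lambda mu T u r').
Proof.
exists (1 / 100); first by apply/andP; split; lra.
move=> eps epsP; have [T0 T00 hT0] := exists_small_time hlambda hmu.
exists T0 => // T TT0 u r r'; have [sT /(_ _ epsP)[M gM]] := hT0 T TT0.
rewrite /r' /u /r pclass_straight// pclass_crossed//.
split; last exact: (blockpath_distinct hlambda hmu sT epsP).
apply/seteqP; split => C.
  move=> /(minimal_blockpath hlambda hmu sT epsP gM)[s [|] -> ->]; [by left|by right].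
case=> ->; apply: (blockpath_minimal hlambda hmu sT epsP gM); [by left|by right].
Qed.
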